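(* Let $G$ be a simple algebraic group over $\mathbb C$ with Lie algebra $\mathfrak g$, $B\subset G$ a Borel subgroup with Lie algebra $\mathfrak b$, $\pi:G\to G/B$ the projection, and $(,)$ a symmetric ad-invariant bilinear form on $\mathfrak g$. The BRST complex $C_{BRST}(L\mathfrak b;\pi_*\mathcal D^{ch}_{G;(,)})$ is defined, i.e. the restriction of $(,)$ to $\mathfrak b$ equals minus the Killing form $(,)_{\mathfrak b;(K)}$ of $\mathfrak b$, if and only if $(,)$ is the critical level $(,)_{\mathfrak g;crit}=-\frac12(,)_{\mathfrak g;(K)}$, where $(,)_{\mathfrak g;(K)}$ is the Killing form of $\mathfrak g$.
   Context: For a finite dimensional Lie algebra $\mathfrak a$ the Killing form is $(x,y)_{\mathfrak a;(K)}=\mathrm{tr}_{\mathfrak a}(\mathrm{ad}_x\mathrm{ad}_y)$. For an invariant symmetric bilinear form $(,)$ on $\mathfrak a$, $\mathcal V_{\mathfrak a;(,)}$ denotes the universal affine vertex algebra at level $(,)$, generated by weight $1$ fields $a(z)$, $a\in\mathfrak a$, with $a(z)b(w)\sim (a,b)/(z-w)^2+[a,b](w)/(z-w)$. The BRST complex $C_{BRST}(L\mathfrak a;\mathcal M)$ is defined for modules $\mathcal M$ over $\mathcal V_{\mathfrak a;-(,)_{\mathfrak a;(K)}}$, i.e. at the level equal to minus the Killing form of $\mathfrak a$: it is $C_{BRST}(L\mathfrak a)\otimes\mathcal M$, where $C_{BRST}(L\mathfrak a)$ is generated by odd fields $\phi_i$ (weight $1$), $\phi_i^*$ (weight $0$)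 with $\phi_i(z)\phi_j^*(w)\sim\delta_{ij}/(z-w)$, with differential the zero mode of $\sum_i\phi_i^*\otimes a_i-\frac12\sum c^{ij}_p\phi_p\phi_i^*\phi_j^*\otimes 1$ for a basis $\{a_i\}$ of $\mathfrak a$, $[a_i,a_j]=\sum_pc^{ij}_pa_p$. The sheaf $\pi_*\mathcal D^{ch}_{G;(,)}$ (chiral differential operators on $G$ at level $(,)$, generated by $\mathcal O_G$ in weight $0$ and by $\mathfrak g$ in weight $1$, acting by left invariant vector fields, with $\tau_{(1)}\tau'=(\tau,\tau')$, $\tau_{(0)}\tau'=[\tau,\tau']$) is a module over $\mathcal V_{\mathfrak b;(,)|_{\mathfrak b}}$ through the embedding $\mathfrak b\subset\mathfrak g$. *)

(* Defs.v *)
From mathcomp Require Import all_boot all_order all_algebra.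
From mathcomp Require Import mpoly complex.
From mathcomp Require Import boolp classical_sets reals.

Set Implicit Arguments.
Unset Strict Implicit.
Unset Printing Implicit Defensive.

Import GRing.Theory.
Local Open Scope classical_set_scope.
Local Open Scope ring_scope.

(* The complex numbers are R[i] with R : realType.  Algebraic groups are      *)
(* linear algebraic groups: Zariski-closed subgroups of GL_n, seen as sets of *)
(* invertible matrices.                                                       *)

Definition mxcoord (F : fieldType) (n : nat) (x : 'M[F]_n) : 'I_(n * n) -> F :=
  fun k => mxvec x ord0 k.

Definition zclosed (F : fieldType) (n : nat) (A : set 'M[F]_n) : Prop :=
  exists S : set {mpoly F[n * n]},
    A = [set x | x \in unitmx /\ forall p, S p -> p.@[mxcoord x] = 0].

Definition zconnected (F : fieldType) (n : nat) (A : set 'M[F]_n) : Prop :=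
  A !=set0 /\
  forall Z1 Z2 : set 'M[F]_n, zclosed Z1 -> zclosed Z2 ->
    A `<=` Z1 `|` Z2 -> A `&` (Z1 `&` Z2) = set0 -> A `<=` Z1 \/ A `<=` Z2.

Definition subgroup (F : fieldType) (n : nat) (A : set 'M[F]_n) : Prop :=
  [/\ forall x, A x -> x \in unitmx,
      A 1%:M,
      forall x y, A x -> A y -> A (x *m y)
    & forall x, A x -> A (invmx x)].

Definition algebraic_group (F : fieldType) (n : nat) (A : set 'M[F]_n) : Prop :=
  subgroup A /\ zclosed A.

Definition commutator_subgroup (F : fieldType) (n : nat) (A : set 'M[F]_n) :
    set 'M[F]_n :=
  [set z | forall H : set 'M[F]_n, subgroup H ->
     (forall x y, A x -> A y -> H (x *m y *m invmx x *m invmx y)) -> H z].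

Definition solvable_group (F : fieldType) (n : nat) (A : set 'M[F]_n) : Prop :=
  exists k : nat, iter k (@commutator_subgroup F n) A = [set 1%:M].

Definition normal_in (F : fieldType) (n : nat) (N A : set 'M[F]_n) : Prop :=
  N `<=` A /\ forall g x, A g -> N x -> N (g *m x *m invmx g).

(* Simplicity in the sense of algebraic groups: finite normal subgroups, such *)
(* as the center of SL_n, are allowed.                                        *)
Definition simple_algebraic_group (F : fieldType) (n : nat)
    (G : set 'M[F]_n) : Prop :=
  [/\ algebraic_group G,
      zconnected G,
      ~ (forall x y, G x -> G y -> x *m y = y *m x)
    & forall N : set 'M[F]_n, algebraic_group N -> zconnected N ->
        normal_in N G -> N = [set 1%:M] \/ N = G].

Definition borel_subgroup (F : fieldType) (n : nat)
    (G B : set 'M[F]_n) : Prop :=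
  let P (H : set 'M[F]_n) :=
    [/\ algebraic_group H, zconnected H, solvable_group H & H `<=` G] in
  P B /\ forall H, P H -> B `<=` H -> H = B.

(* L is the Lie algebra of A: the Zariski tangent space of A at the identity. *)
(* Its bracket, that of left invariant vector fields, is the commutator of    *)
(* matrices.                                                                  *)
Definition lie_algebra_of (F : fieldType) (n : nat) (A : set 'M[F]_n)
    (L : {vspace 'M[F]_n}) : Prop :=
  forall X : 'M[F]_n, X \in L <->
    forall p : {mpoly F[n * n]}, (forall x, A x -> p.@[mxcoord x] = 0) ->
      \sum_(k < n * n) (p^`M(k)).@[mxcoord (1%:M : 'M[F]_n)] * mxcoord X k = 0.

(* Meaningful when L is closed under commutators, as the Lie algebra of an    *)
(* algebraic group is.                                                        *)
Definition lie (F : fieldType) (n : nat) (L : {vspace 'M[F]_n})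
    (x y : subvs_of L) : subvs_of L :=
  vsproj L (vsval x *m vsval y - vsval y *m vsval x).

Definition ad (F : fieldType) (n : nat) (L : {vspace 'M[F]_n})
    (x : subvs_of L) : 'End(subvs_of L) := linfun (lie x).

Definition lftrace (F : fieldType) (V : vectType F) (f : 'End(V)) : F :=
  \tr (passmx.mxof (vbasis {:V}) (vbasis {:V}) f).

Definition killing (F : fieldType) (n : nat) (L : {vspace 'M[F]_n})
    (x y : subvs_of L) : F := lftrace (ad x \o ad y)%VF.

Definition critical_level (F : fieldType) (n : nat) (L : {vspace 'M[F]_n})
    (x y : subvs_of L) : F := - (2%:R^-1 * killing x y).

Definition invariant_form (F : fieldType) (n : nat) (L : {vspace 'M[F]_n})
    (f : subvs_of L -> subvs_of L -> F) : Prop :=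
  forall x y z, f (lie x y) z = f x (lie y z).

(* Meaningful when M is contained in L; x is then sent to itself. *)
Definition restrict_form (F : fieldType) (n : nat) (L M : {vspace 'M[F]_n})
    (f : subvs_of L -> subvs_of L -> F) : subvs_of M -> subvs_of M -> F :=
  fun x y => f (vsproj L (vsval x)) (vsproj L (vsval y)).

(* The complex C_BRST(La; M) is defined for modules M over the universal      *)
(* affine vertex algebra of a at the level - killing, and only there.         *)
(* Chiral differential operators on G at level f form a module for b at the   *)
(* level restrict_form f.                                                     *)
Definition BRST_defined (F : fieldType) (n : nat) (L : {vspace 'M[F]_n})
    (level : subvs_of L -> subvs_of L -> F) : Prop :=
  forall x y, level x y = - killing x y.

(* Main.v *)
(* Let kappa be the Killing form of g and n the orthogonal of b for kappa.    *)
(* Then [b, b] <= n <= b, and n is dual to g / b through kappa. For x and y   *)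
(* in b, invariance shows that ad x ad y has the same trace on n and on g / b,*)
(* and this trace is tr_b (ad x ad y) since [b, b] <= n: the Killing form of  *)
(* b is thus one half of kappa. As g is simple, an invariant form is equal to *)
(* c kappa, and c = - 1 / 2 is forced because kappa is nonzero on b.          *)
(*                                                                            *)
(* No root system is used. If s is a subalgebra containing b, stable under B, *)
(* whose derived algebra acts nilpotently on g, then B and exp s generate a   *)
(* connected group preserving a flag of g, which is solvable, so that s = b   *)
(* by maximality of B. The Lie-Kolchin theorem yields such an s = b + C v     *)
(* whenever one of the three facts fails: (1) b contains n, where Cartan's    *)
(* criterion applies to s; (2) b is the stabilizer of a flag of g, hence      *)
(* [b, b] <= n; (3) kappa is nonzero on b, since otherwise every element of b *)
(* is ad-nilpotent. Vectors are moved between groups and Lie algebras along   *)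
(* the curves exp (tX), obtained as solutions of linear differential          *)
(* equations.                                                                 *)

Require Import Defs.
From HB Require Import structures.
From mathcomp Require Import all_boot all_order all_algebra.
From mathcomp Require Import mpoly complex.
From mathcomp Require Import boolp classical_sets reals.
From mathcomp Require Import topology normedtype derive sequences exp realfun.
From mathcomp Require Import ring lra.

Set Implicit Arguments.
Unset Strict Implicit.
Unset Printing Implicit Defensive.

Import Order.TTheory GRing.Theory Num.Theory.
Import numFieldNormedType.Exports.
Import passmx.
Local Open Scope classical_set_scope.
Local Open Scope ring_scope.

(** * Curves of complex numbers *)

(** Write kappa for the Killing form of g, and b for the Lie algebra of B seen inside g. Two facts
    give the theorem: the Killing form of b is half the restriction of kappa ([killing_borel]), and
    every invariant form on g is c times kappa ([invariant_form_scalar], Schur's lemma for the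
    operator representing the form). The condition on b then reads c kappa = - 1/2 kappa on b, and c
    = - 1/2 follows because kappa is nonzero on b ([borel_kappa_neq0]).

    The factor one half is linear algebra ([half_killing]) once the orthogonal of b lies in b
    ([borel_orthogonal_sub]) and contains [b, b] ([borel_isotropic]). These facts and the
    nonvanishing of kappa all come from the maximality of B, in the form [borel_maximal]. To
    contradict maximality, [lie_kolchin] supplies an eigenvector of B modulo b, which is adjoined to
    b; the derived algebra of the result acts nilpotently because it preserves a flag, by
    [cartan_criterion], or because it lies in a b made of ad-nilpotent elements.

    The hypotheses concern Zariski closed groups and the conclusion concerns Lie algebras. The
    bridge consists of [onepar_mem] and [onepar_lie], by which X is tangent to A if and only if exp
    (tX) stays in A, and of [zconnected_alggen], which makes groups generated by exponentials
    connected. Simplicity enters through [alggen_exp_stable]: the exponentials of a nonzero G-stable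
    subspace of g generate G. Nondegeneracy of kappa ([simple_kappa_nondeg]) and irreducibility of g
    ([simple_Ad_stable]) follow.

    Eigenvector statements are made for a pair W < U of stable subspaces and modulo W, so that they
    apply to U / W without forming quotients. *)

Section ExponentialSeries.
Variable R : realType.
Implicit Types (u v : nat -> R) (a x : R).

Definition geo_bounded a u := exists M : R, forall k, `|u k| <= M * a ^+ k.

(** The exponential generating function of [u]. Its derivative is that of the shifted sequence, so
    the powers of a matrix produce a solution of E' = E X. *)
Definition exp_series u x : R := limn (pseries (fun k => u k / k`!%:R) x).

Lemma geo_bounded_shift a u : geo_bounded a u -> geo_bounded a (fun k => u k.+1).
Proof. by case=> M uM; exists (M * a) => k; rewrite -mulrA -exprS. Qed.

Lemma geo_boundedD a u v : geo_bounded a u -> geo_bounded a v ->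
  geo_bounded a (fun k => u k + v k).
Proof.
case=> M uM [N vN]; exists (M + N) => k.
by rewrite mulrDl (le_trans (ler_normD _ _))// lerD.
Qed.

Lemma geo_boundedZ a u x : geo_bounded a u -> geo_bounded a (fun k => x * u k).
Proof.
by case=> M uM; exists (`|x| * M) => k; rewrite normrM -mulrA ler_wpM2l.
Qed.

Lemma cvg_exp_series a u x : 0 <= a -> geo_bounded a u ->
  cvgn (pseries (fun k => u k / k`!%:R) x).
Proof.
move=> a0 [M uM]; apply: normed_cvg.
have uE k : `|u k / k`!%:R * x ^+ k| <= M * exp_coeff (a * `|x|) k.
  rewrite /exp_coeff /= exprMn !normrM normfV normrX normr_nat.
  rewrite -mulrA [leRHS](_ : _ = M * a ^+ k * (k`!%:R^-1 * `|x| ^+ k)); last by ring.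
  by rewrite ler_wpM2r// mulr_ge0 ?exprn_ge0 ?invr_ge0.
apply: (@series_le_cvg _ _ (fun k => M * exp_coeff (a * `|x|) k)).
- by move=> k; rewrite /= normr_ge0.
- by move=> k; rewrite (le_trans _ (uE k)).
- exact: uE.
- have := is_cvg_seriesZ (k := M) (is_cvg_series_exp_coeff (a * `|x|)).
  set f := M *: _; rewrite (_ : f = (fun k => M * exp_coeff (a * `|x|) k))//.
Qed.

Lemma exp_seriesD a u v x : 0 <= a -> geo_bounded a u -> geo_bounded a v ->
  exp_series (fun k => u k + v k) x = exp_series u x + exp_series v x.
Proof.
move=> a0 bu bv.
have := lim_seriesD (cvg_exp_series (x := x) a0 bu) (cvg_exp_series (x := x) a0 bv).
rewrite /exp_series /pseries; set f := (X in series X).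
rewrite (_ : f = (fun k => (u k + v k) / k`!%:R * x ^+ k))//.
by apply/funext => k; rewrite /f /= !mulrDl.
Qed.

Lemma exp_seriesZ a u y x : 0 <= a -> geo_bounded a u ->
  exp_series (fun k => y * u k) x = y * exp_series u x.
Proof.
move=> a0 bu; have := lim_seriesZ y (cvg_exp_series (x := x) a0 bu).
rewrite /exp_series /pseries; set f := y *: _.
rewrite (_ : f = (fun k => y * u k / k`!%:R * x ^+ k))//.
apply/funext => k; transitivity (y * (u k / k`!%:R * x ^+ k)) => //.
by rewrite !mulrA.
Qed.

Lemma exp_series0 u : exp_series u 0 = u 0%N.
Proof.
rewrite /exp_series; apply: lim_near_cst => //; exists 1%N => // n /= n0.
rewrite /pseries /series /= -(prednK n0) big_nat_recl// fact0 divr1 expr0 mulr1.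
by rewrite big1 ?addr0// => i _; rewrite exprS mul0r mulr0.
Qed.

Lemma is_derive_exp_series a u x : 0 <= a -> geo_bounded a u ->
  is_derive x (1 : R) (exp_series u) (exp_series (fun k => u k.+1) x).
Proof.
move=> a0 bu.
have Ed w : pseries_diffs (fun k => w k / k`!%:R : R) =
    (fun k => w k.+1 / k`!%:R).
  apply/funext => k; rewrite /pseries_diffs factS natrM invfM.
  by rewrite mulrCA mulVKf// pnatr_eq0.
rewrite /exp_series -Ed; apply: (@pseries_snd_diffs _ _ (`|x| + 1)).
- exact: cvg_exp_series a0 bu.
- by rewrite Ed; apply: cvg_exp_series a0 (geo_bounded_shift bu).
- rewrite Ed (Ed (fun k => u k.+1)).
  exact: cvg_exp_series a0 (geo_bounded_shift (geo_bounded_shift bu)).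
- by rewrite [ltRHS]ger0_norm ?addr_ge0// ltrDl ltr01.
Qed.

End ExponentialSeries.

Section ComplexCurves.
Variable R : realType.
Local Notation C := R[i].
Local Notation Re := complex.Re.
Local Notation Im := complex.Im.
Implicit Types (f g df dg : R -> C).

(** Time is real and values are complex, so that the connectedness of the line and the constancy of
    curves with zero derivative come from real analysis. *)
Definition cderiv f df := forall t : R,
  is_derive t (1 : R) (fun s => Re (f s)) (Re (df t)) /\
  is_derive t (1 : R) (fun s => Im (f s)) (Im (df t)).

Lemma cderiv_ext f g df dg : f =1 g -> df =1 dg -> cderiv f df -> cderiv g dg.
Proof. by move=> /funext -> /funext ->. Qed.

Lemma cderiv_cst (c : C) : cderiv (fun _ => c) (fun _ => 0).
Proof. by move=> t; split; exact: is_derive_cst. Qed.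

Lemma complexReD (x y : C) : Re (x + y) = Re x + Re y.
Proof. by case: x y => [? ?] [? ?]. Qed.

Lemma complexImD (x y : C) : Im (x + y) = Im x + Im y.
Proof. by case: x y => [? ?] [? ?]. Qed.

Lemma complexReM (x y : C) : Re (x * y) = Re x * Re y - Im x * Im y.
Proof. by case: x y => [? ?] [? ?]. Qed.

Lemma complexImM (x y : C) : Im (x * y) = Re x * Im y + Im x * Re y.
Proof. by case: x y => [? ?] [? ?]. Qed.

Lemma is_derive_ext (h k : R -> R) (t dh dk : R) : h =1 k -> dh = dk ->
  is_derive t (1 : R) h dh -> is_derive t (1 : R) k dk.
Proof. by move=> /funext -> ->. Qed.

Lemma cderivD f g df dg : cderiv f df -> cderiv g dg ->
  cderiv (fun t => f t + g t) (fun t => df t + dg t).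
Proof.
move=> fd gd t; have [f1 f2] := fd t; have [g1 g2] := gd t; split.
  by apply: is_derive_ext (is_deriveD f1 g1) => [s|]; rewrite complexReD.
by apply: is_derive_ext (is_deriveD f2 g2) => [s|]; rewrite complexImD.
Qed.

Lemma cderivM f g df dg : cderiv f df -> cderiv g dg ->
  cderiv (fun t => f t * g t) (fun t => df t * g t + f t * dg t).
Proof.
move=> fd gd t; have [f1 f2] := fd t; have [g1 g2] := gd t; split.
  apply: is_derive_ext (is_deriveB (is_deriveM f1 g1) (is_deriveM f2 g2)).
    by move=> s; rewrite complexReM.
  by rewrite complexReD !complexReM /GRing.scale /=; ring.
apply: is_derive_ext (is_deriveD (is_deriveM f1 g2) (is_deriveM f2 g1)).
  by move=> s; rewrite complexImM.
by rewrite complexImD !complexImM /GRing.scale /=; ring.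
Qed.

Lemma cderivZ (c : C) f df : cderiv f df ->
  cderiv (fun t => c * f t) (fun t => c * df t).
Proof.
move=> /(cderivM (cderiv_cst c)); apply: cderiv_ext => // t.
by rewrite mul0r add0r.
Qed.

Lemma cderiv_sum (I : Type) (r : seq I) (F dF : I -> R -> C) :
  (forall i, cderiv (F i) (dF i)) ->
  cderiv (fun t => \sum_(i <- r) F i t) (fun t => \sum_(i <- r) dF i t).
Proof.
move=> FdF; elim: r => [|i r IHr].
  by apply: cderiv_ext (cderiv_cst 0) => t; rewrite big_nil.
by apply: cderiv_ext (cderivD (FdF i) IHr) => t; rewrite big_cons.
Qed.

Lemma cderiv_uniq f df dg : cderiv f df -> cderiv f dg -> df =1 dg.
Proof.
move=> fd fg t; have [[_ e1] [_ e2]] := fd t; have [[_ f1] [_ f2]] := fg t.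
by apply/eqP; rewrite eq_complex -e1 -e2 f1 f2 !eqxx.
Qed.

Lemma cderiv0_cst f : cderiv f (fun _ => 0) -> forall s t, f s = f t.
Proof.
move=> fd s t; apply/eqP; rewrite eq_complex; apply/andP; split; apply/eqP.
  by apply: (@is_derive_0_is_cst _ (fun s => Re (f s))) => x; have [] := fd x.
by apply: (@is_derive_0_is_cst _ (fun s => Im (f s))) => x; have [] := fd x.
Qed.

Lemma cderiv_closed_zeros f df : cderiv f df -> closed [set t | f t = 0].
Proof.
move=> fd; have -> : [set t | f t = 0] =
    (fun s => Re (f s)) @^-1` [set 0] `&` (fun s => Im (f s)) @^-1` [set 0].
  apply/seteqP; split => t /=; first by move=> ->.
  by case=> f1 f2; apply/eqP; rewrite eq_complex /= f1 f2 !eqxx.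
have cont (h dh : R -> R) : (forall t, is_derive t (1 : R) h (dh t)) ->
    closed (h @^-1` [set 0]).
  move=> hd; apply: closed_comp => [t _|]; last exact: closed_eq.
  by have [d _] := hd t; exact/differentiable_continuous/derivable1_diffP.
apply: closedI.
  by apply: (cont _ (fun t => Re (df t))) => t; have [] := fd t.
by apply: (cont _ (fun t => Im (df t))) => t; have [] := fd t.
Qed.

Lemma real_line_connected (A B : set R) : closed A -> closed B ->
  (forall t, A t \/ B t) -> A `&` B = set0 -> forall s t, A s -> A t.
Proof.
move=> cA cB AB AB0 s t As.
have AE : A = ~` B.
  apply/seteqP; split => x => [Ax Bx|nBx]; last by case: (AB x).
  by have : (A `&` B) x by []; rewrite AB0.
have : connected [set: R] by apply/connected_intervalP.
move=> /(_ A) conn; suff -> : A = [set: R] by [].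
apply: conn; first by exists s.
  exists (~` B); first exact: closed_openC.
  by rewrite setTI.
by exists A; rewrite ?setTI.
Qed.

End ComplexCurves.

(** * Curves of matrices and one-parameter groups *)

Section MatrixCurves.
Variable R : realType.
Local Notation C := R[i].
Local Notation Re := complex.Re.
Local Notation Im := complex.Im.

Definition cgeo_bounded a (u : nat -> C) :=
  geo_bounded a (fun k => Re (u k)) /\ geo_bounded a (fun k => Im (u k)).

Definition cexp_series (u : nat -> C) (t : R) : C :=
  Complex (exp_series (fun k => Re (u k)) t) (exp_series (fun k => Im (u k)) t).

Lemma cgeo_boundedD a u v : cgeo_bounded a u -> cgeo_bounded a v ->
  cgeo_bounded a (fun k => u k + v k).
Proof.
move=> [u1 u2] [v1 v2]; split.
  by rewrite (_ : (fun _ => _) = (fun k => Re (u k) + Re (v k)));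
    [exact: geo_boundedD|apply/funext => k; rewrite complexReD].
by rewrite (_ : (fun _ => _) = (fun k => Im (u k) + Im (v k)));
    [exact: geo_boundedD|apply/funext => k; rewrite complexImD].
Qed.

Lemma cgeo_boundedZ a u c : cgeo_bounded a u ->
  cgeo_bounded a (fun k => c * u k).
Proof.
move=> [u1 u2]; split.
  rewrite (_ : (fun _ => _) = (fun k => Re c * Re (u k) + - Im c * Im (u k))).
    by apply: geo_boundedD; exact: geo_boundedZ.
  by apply/funext => k; rewrite complexReM mulNr.
rewrite (_ : (fun _ => _) = (fun k => Re c * Im (u k) + Im c * Re (u k))).
  by apply: geo_boundedD; exact: geo_boundedZ.
by apply/funext => k; rewrite complexImM.
Qed.

Lemma cexp_seriesD a u v t : 0 <= a -> cgeo_bounded a u -> cgeo_bounded a v ->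
  cexp_series (fun k => u k + v k) t = cexp_series u t + cexp_series v t.
Proof.
move=> a0 [u1 u2] [v1 v2]; rewrite /cexp_series; apply/eqP.
rewrite eq_complex /= -(exp_seriesD t a0 u1 v1) -(exp_seriesD t a0 u2 v2).
by apply/andP; split; apply/eqP; congr exp_series; apply/funext => k;
   rewrite ?complexReD ?complexImD.
Qed.

Lemma cexp_seriesZ a u c t : 0 <= a -> cgeo_bounded a u ->
  cexp_series (fun k => c * u k) t = c * cexp_series u t.
Proof.
move=> a0 [u1 u2]; apply/eqP; rewrite eq_complex complexReM complexImM /=.
rewrite -mulNr -!(exp_seriesZ _ t a0 u1) -!(exp_seriesZ _ t a0 u2).
rewrite -!(exp_seriesD t a0) //; try exact: geo_boundedZ.
by apply/andP; split; apply/eqP; congr (exp_series _ t); apply/funext => k;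
   rewrite ?complexReM ?complexImM ?mulNr.
Qed.

Lemma cexp_series_sum a (I : Type) (r : seq I) (u : I -> nat -> C) t :
  0 <= a -> (forall i, cgeo_bounded a (u i)) ->
  cgeo_bounded a (fun k => \sum_(i <- r) u i k) /\
  cexp_series (fun k => \sum_(i <- r) u i k) t = \sum_(i <- r) cexp_series (u i) t.
Proof.
move=> a0 ub; elim: r => [|i r [IH1 IH2]].
  have -> : (fun k => \sum_(i <- [::]) u i k) = (fun k => 0).
    by apply/funext => k; rewrite big_nil.
  have b0 : cgeo_bounded a (fun=> 0).
    by split; exists 0 => k; rewrite normr0 mul0r.
  split => //; rewrite big_nil; have := cexp_seriesD t a0 b0 b0.
  have -> : (fun k : nat => 0 + 0 : C) = fun=> 0.
    by apply/funext => k; rewrite addr0.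
  by move=> e; apply: (addrI (cexp_series (fun=> 0) t)); rewrite -e addr0.
have -> : (fun k => \sum_(j <- i :: r) u j k) =
    (fun k => u i k + \sum_(j <- r) u j k).
  by apply/funext => k; rewrite big_cons.
by split; [exact: cgeo_boundedD|rewrite (cexp_seriesD _ a0)// IH2 big_cons].
Qed.

Lemma cexp_series0 u : cexp_series u 0 = u 0%N.
Proof. by rewrite /cexp_series !exp_series0; case: (u _). Qed.

Lemma cderiv_cexp_series a u : 0 <= a -> cgeo_bounded a u ->
  cderiv (cexp_series u) (cexp_series (fun k => u k.+1)).
Proof. by move=> a0 [u1 u2] t; split;
  [exact: (is_derive_exp_series t a0 u1)|exact: (is_derive_exp_series t a0
  u2)]. Qed.

Definition mxder p q (H dH : R -> 'M[C]_(p, q)) :=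
  forall i j, cderiv (fun t => H t i j) (fun t => dH t i j).

Section MxDer.
Variables p q : nat.
Implicit Types H G dH dG : R -> 'M[C]_(p, q).

Lemma mxder_ext H G dH dG : H =1 G -> dH =1 dG -> mxder H dH -> mxder G dG.
Proof. by move=> /funext -> /funext ->. Qed.

Lemma mxder_cst (A : 'M[C]_(p, q)) : mxder (fun=> A) (fun=> 0).
Proof.
by move=> i j; apply: cderiv_ext (cderiv_cst (A i j)) => // t; rewrite mxE.
Qed.

Lemma mxderD H G dH dG : mxder H dH -> mxder G dG ->
  mxder (fun t => H t + G t) (fun t => dH t + dG t).
Proof.
by move=> Hd Gd i j; apply: cderiv_ext (cderivD (Hd i j) (Gd i j)) => t;
  rewrite mxE.
Qed.

Lemma mxderN H dH : mxder H dH -> mxder (fun t => - H t) (fun t => - dH t).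
Proof.
move=> Hd i j; apply: cderiv_ext (cderivZ (-1) (Hd i j)) => t;
  by rewrite mxE mulN1r.
Qed.

Lemma mxder_uniq H dH dG : mxder H dH -> mxder H dG -> dH =1 dG.
Proof.
by move=> Hd Hg t; apply/matrixP => i j; exact: (cderiv_uniq (Hd i j) (Hg i j)).
Qed.

Lemma mxder0_cst H : mxder H (fun=> 0) -> forall s t, H s = H t.
Proof.
move=> Hd s t; apply/matrixP => i j.
apply: (@cderiv0_cst _ (fun t => H t i j)).
by apply: cderiv_ext (Hd i j) => // u; rewrite mxE.
Qed.

Lemma mxder_lin p' q' (L : {linear 'M[C]_(p, q) -> 'M[C]_(p', q')}) H dH :
  mxder H dH -> mxder (fun t => L (H t)) (fun t => L (dH t)).
Proof.
move=> Hd i j.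
have E (A : 'M[C]_(p, q)) : L A i j =
    \sum_(k : 'I_p * 'I_q) L (delta_mx k.1 k.2) i j * A k.1 k.2.
  rewrite {1}(matrix_sum_delta A) linear_sum summxE.
  rewrite -(pair_bigA _ (fun k l => L (delta_mx k l) i j * A k l)) /=.
  apply: eq_bigr => k _; rewrite linear_sum summxE.
  by apply: eq_bigr => l _; rewrite linearZ mxE mulrC.
apply: cderiv_ext (cderiv_sum _ (fun k => cderivZ _ (Hd k.1 k.2))) => t;
  by rewrite E.
Qed.

End MxDer.

Lemma mxder_mul p q r (H dH : R -> 'M[C]_(p, q)) (G dG : R -> 'M[C]_(q, r)) :
  mxder H dH -> mxder G dG ->
  mxder (fun t => H t *m G t) (fun t => dH t *m G t + H t *m dG t).
Proof.
move=> Hd Gd i j.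
apply: cderiv_ext (cderiv_sum _ (fun k => cderivM (Hd i k) (Gd k j))) => t.
  by rewrite mxE.
by rewrite big_split !mxE.
Qed.

Lemma mxder_exp_exists n (X : 'M[C]_n) : exists E : R -> 'M[C]_n,
  E 0 = 1%:M /\ mxder E (fun t => E t *m X).
Proof.
(* A submultiplicative real norm. With [a] the sum of the norms of all entries of [X], every entry
   of [X ^+ k] has norm at most [a ^+ k], which gives convergence. *)
pose N (z : C) := `|Re z| + `|Im z|.
have N0 z : 0 <= N z by rewrite addr_ge0.
have ND z w : N (z + w) <= N z + N w.
  rewrite /N complexReD complexImD addrACA lerD// ler_normD//.
have NM z w : N (z * w) <= N z * N w.
  rewrite /N complexReM complexImM (le_trans (lerD (ler_normB _ _) (ler_normD _ _)))//.
  rewrite !normrM; lra.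
have Nsum (I : Type) (r : seq I) (F : I -> C) :
    N (\sum_(i <- r) F i) <= \sum_(i <- r) N (F i).
  elim/big_ind2: _ => // [|x y z w xy zw]; first by rewrite /N normr0 addr0.
  by rewrite (le_trans (ND _ _))// lerD.
pose a := \sum_i \sum_j N (X i j).
have a0 : 0 <= a by rewrite sumr_ge0// => i _; rewrite sumr_ge0.
have Xb k i j : N ((X ^+ k) i j) <= a ^+ k.
  elim: k i j => [|k IHk] i j.
    rewrite !expr0 mxE; case: (_ == _); rewrite /N /= ?normr1 normr0 addr0//.
  rewrite !exprSr mxE (le_trans (Nsum _ _ _))//.
  have -> : a ^+ k * a = \sum_l a ^+ k * (\sum_h N (X l h)).
    by rewrite -mulr_sumr.
  rewrite ler_sum// => l _.
  rewrite (le_trans (NM _ _))// ler_pM//.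
  by rewrite (bigD1 j)//= lerDl sumr_ge0.
have geo i j : cgeo_bounded a (fun k => (X ^+ k) i j).
  split; exists 1 => k; rewrite mul1r (le_trans _ (Xb k i j))// /N.
    by rewrite lerDl.
  by rewrite lerDr.
exists (fun t => \matrix_(i, j) cexp_series (fun k => (X ^+ k) i j) t); split.
  by apply/matrixP => i j; rewrite mxE cexp_series0 expr0.
move=> i j; apply: cderiv_ext (cderiv_cexp_series a0 (geo i j)) => t.
  by rewrite mxE.
rewrite mxE.
have -> : (fun k => (X ^+ k.+1) i j) =
    (fun k => \sum_l (X l j * (X ^+ k) i l)).
  by apply/funext => k; rewrite exprSr mxE; apply: eq_bigr => l _; rewrite mulrC.
have [_ ->] := @cexp_series_sum a _ (index_enum 'I_n)
  (fun l k => X l j * (X ^+ k) i l) t a0 (fun l => cgeo_boundedZ _ (geo i l)).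
by apply: eq_bigr => l _; rewrite (cexp_seriesZ _ _ a0 (geo i l)) mulrC mxE.
Qed.

(* [E t] is exp (tX) and [D t] is exp (-tX). *)
Definition onepar n (X : 'M[C]_n) (E D : R -> 'M[C]_n) :=
  [/\ E 0 = 1%:M, mxder E (fun t => E t *m X), mxder D (fun t => - (X *m D t)),
      forall t, E t *m D t = 1%:M & forall t, D t *m E t = 1%:M].

Lemma onepar_exists n (X : 'M[C]_n) : exists E D, onepar X E D.
Proof.
have [E [E0 Ed]] := mxder_exp_exists X.
(* Transposing the solution for the transpose of [- X] puts the generator on the left, so that the
   derivative of [E t *m D t] cancels. *)
have [F [F0 Fd]] := mxder_exp_exists (- X)^T.
have Dd : mxder (fun t => (F t)^T) (fun t => - (X *m (F t)^T)).
  apply: mxder_ext (mxder_lin (@trmx C n n) Fd) => t //=.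
  by rewrite trmx_mul trmxK mulNmx.
have ED t : E t *m (F t)^T = 1%:M.
  transitivity (E 0 *m (F 0)^T); last by rewrite E0 F0 trmx1 mulmx1.
  apply: (@mxder0_cst n n (fun t => E t *m (F t)^T)).
  apply: mxder_ext (mxder_mul Ed Dd) => // s.
  by rewrite mulmxN -mulmxA subrr.
exists E, (fun t => (F t)^T); split => // t; exact: mulmx1C.
Qed.

Lemma onepar_unit n (X : 'M[C]_n) E D t : onepar X E D ->
  E t \in unitmx /\ invmx (E t) = D t.
Proof.
case=> _ _ _ ED DE; have [Eu _] := mulmx1_unit (ED t).
by split=> //; rewrite -[LHS]mulmx1 -(ED t) mulmxA mulVmx// mul1mx.
Qed.

Lemma onepar_D0 n (X : 'M[C]_n) E D : onepar X E D -> D 0 = 1%:M.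
Proof. by case=> E0 _ _ ED _; rewrite -(ED 0) E0 mul1mx. Qed.

(** Multiplication by the inverse curve [D] turns a solution into a constant. *)
Lemma onepar_uniq n m (X : 'M[C]_n) (H : R -> 'M[C]_(m, n)) :
  mxder H (fun t => H t *m X) -> H 0 = 0 -> forall t, H t = 0.
Proof.
move=> Hd H0 t; have [E [D [E0 Ed Dd ED DE]]] := onepar_exists X.
suff HD : H t *m D t = 0 by rewrite -[LHS]mulmx1 -(DE t) mulmxA HD mul0mx.
have -> : H t *m D t = H 0 *m D 0; last by rewrite H0 mul0mx.
apply: (@mxder0_cst _ _ (fun t => H t *m D t)).
apply: mxder_ext (mxder_mul Hd Dd) => // s.
by rewrite mulmxN -mulmxA subrr.
Qed.

Lemma onepar_comm n (X Y : 'M[C]_n) E D t : onepar X E D ->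
  Y *m X = X *m Y -> Y *m E t = E t *m Y.
Proof.
case=> E0 Ed _ _ _ YX; apply/eqP; rewrite -subr_eq0; apply/eqP.
apply: (@onepar_uniq _ _ X (fun t => Y *m E t - E t *m Y)).
  apply: mxder_ext (mxderD (mxder_lin (mulmx Y) Ed) (mxderN (mxder_lin (mulmxr
    Y) Ed))) => // s /=.
  by rewrite mulmxBl -!mulmxA YX.
by rewrite E0 mulmx1 mul1mx subrr.
Qed.

Lemma mxder_lfun p q p' q' (f : 'Hom('M[C]_(p, q), 'M[C]_(p', q')))
    (H dH : R -> 'M[C]_(p, q)) :
  mxder H dH -> mxder (fun t => f (H t)) (fun t => f (dH t)).
Proof. exact: mxder_lin. Qed.

Lemma memv_projv_eq0 (K : fieldType) (V : vectType K) (U : {vspace V}) (u : V) :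
  (u \in U) = ((\1 - projv U)%VF u == 0).
Proof.
rewrite !lfun_simp subr_eq0; apply/idP/eqP => [uU|]; first by rewrite projv_id.
by rewrite /= => ->; exact: memv_proj.
Qed.

(* The component of a solution transverse to an invariant subspace solves a   *)
(* linear equation with zero initial value. *)
Lemma linear_ode_stable p q (L : {linear 'M[C]_(p, q) -> 'M[C]_(p, q)})
    (U : {vspace 'M[C]_(p, q)}) (H : R -> 'M[C]_(p, q)) :
  mxder H (fun t => L (H t)) -> (forall u, u \in U -> L u \in U) ->
  H 0 \in U -> forall t, H t \in U.
Proof.
move=> Hd LU H0 t.
pose Q := (\1 - projv U)%VF : 'End('M[C]_(p, q)).
have QU u : (u \in U) = (Q u == 0) by exact: memv_projv_eq0.
have QL u : Q (L (Q u)) = Q (L u).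
  apply/esym/eqP; rewrite -subr_eq0 -!linearB /= -QU LU//.
  by rewrite !lfun_simp opprB addrCA subrr addr0 memv_proj.
pose M := lin_mx (Q \o L).
suff : mxvec (Q (H t)) = 0.
  by move=> e; rewrite QU -[Q _]mxvecK e linear0 eqxx.
apply: (@onepar_uniq _ _ M (fun t => mxvec (Q (H t)))).
  apply: mxder_ext (mxder_lin (@mxvec C p q) (mxder_lfun Q Hd)) => // s /=.
  by rewrite /M mul_vec_lin /= QL.
by move: H0; rewrite QU => /eqP ->; rewrite linear0.
Qed.

Lemma mxder_mem p q (U : {vspace 'M[C]_(p, q)}) (H dH : R -> 'M[C]_(p, q)) :
  mxder H dH -> (forall t, H t \in U) -> forall t, dH t \in U.
Proof.
move=> Hd HU t; pose Q := (\1 - projv U)%VF : 'End('M[C]_(p, q)).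
have QU u : (u \in U) = (Q u == 0) by exact: memv_projv_eq0.
rewrite QU; apply/eqP.
apply: (mxder_uniq (mxder_lfun Q Hd)).
apply: mxder_ext (mxder_cst 0) => // s.
by apply/esym/eqP; rewrite -QU.
Qed.

End MatrixCurves.

(** * Zariski topology *)

Lemma mpoly_ring_ind (F : fieldType) (N : nat) (P : {mpoly F[N]} -> Prop) :
  (forall c, P c%:MP) -> (forall i, P 'X_i) ->
  (forall p q, P p -> P q -> P (p + q)) ->
  (forall p q, P p -> P q -> P (p * q)) -> forall p, P p.
Proof.
move=> PC PX PD PM; elim/mpolyind => [|c m p _ _ Pp]; first exact: (PC 0).
apply: PD => //; rewrite -mul_mpolyC; apply: (PM) => //.
rewrite mpolyXE_id; apply: (big_ind P) => [||i _]; [exact: (PC 1)|exact: PM|].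
by elim: (m i) => [|k IHk]; rewrite ?expr0 ?exprS; [exact: (PC 1)|exact: PM].
Qed.

Lemma cderiv_meval (R : realType) (N : nat) (p : {mpoly R[i][N]})
    (c dc : R -> 'I_N -> R[i]) :
  (forall k, cderiv (fun t => c t k) (fun t => dc t k)) ->
  cderiv (fun t => p.@[c t]) (fun t => \sum_k (p^`M(k)).@[c t] * dc t k).
Proof.
move=> cd; elim/mpoly_ring_ind: p => [a|i|p q Pp Pq|p q Pp Pq].
- apply: cderiv_ext (cderiv_cst a) => t; first by rewrite mevalC.
  by rewrite big1 // => k _; rewrite mderivC meval0 mul0r.
- apply: cderiv_ext (cd i) => t; first by rewrite mevalXU.
  rewrite (bigD1 i)//= big1 => [|k ki].
    rewrite mderivX mnmE eqxx scale1r (_ : (U_(i) - U_(i))%MM = 0%MM).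
      by rewrite mpolyX0 meval1 mul1r addr0.
    by apply/mnmP => j; rewrite mnmBE subnn mnmE.
  by rewrite mderivX mnmE eq_sym (negPf ki) scale0r meval0 mul0r.
- apply: cderiv_ext (cderivD Pp Pq) => t; first by rewrite mevalD.
  by rewrite -big_split; apply: eq_bigr => k _; rewrite mderivD mevalD mulrDl.
- apply: cderiv_ext (cderivM Pp Pq) => t; first by rewrite mevalM.
  rewrite mulr_suml mulr_sumr -big_split; apply: eq_bigr => k _ /=.
  by rewrite mderivM mevalD !mevalM; ring.
Qed.

Section RegularFunctions.
Variables (F : fieldType) (n : nat).
Local Notation M := 'M[F]_n.
Implicit Types (f g : M -> F) (A Z : set M).

(** The regular functions on GL_n, regardless of their values at singular matrices: [reg_ext] admits
    identities that hold only for invertible matrices. *)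
Inductive reg : (M -> F) -> Prop :=
| reg_cst c : reg (fun _ => c)
| reg_entry i j : reg (fun x => x i j)
| reg_inv i j : reg (fun x => invmx x i j)
| regD f g : reg f -> reg g -> reg (fun x => f x + g x)
| regM f g : reg f -> reg g -> reg (fun x => f x * g x)
| reg_ext f g : {in unitmx, f =1 g} -> reg f -> reg g.

Definition regmx p q (phi : M -> 'M[F]_(p, q)) :=
  forall i j, reg (fun x => phi x i j).

Lemma reg_sum (I : Type) (r : seq I) (G : I -> M -> F) :
  (forall i, reg (G i)) -> reg (fun x => \sum_(i <- r) G i x).
Proof.
move=> Gr; elim: r => [|i r IHr].
  by apply: reg_ext (reg_cst 0) => x _; rewrite big_nil.
by apply: reg_ext (regD (Gr i) IHr) => x _; rewrite big_cons.
Qed.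

Lemma reg_prod (I : Type) (r : seq I) (G : I -> M -> F) :
  (forall i, reg (G i)) -> reg (fun x => \prod_(i <- r) G i x).
Proof.
move=> Gr; elim: r => [|i r IHr].
  by apply: reg_ext (reg_cst 1) => x _; rewrite big_nil.
by apply: reg_ext (regM (Gr i) IHr) => x _; rewrite big_cons.
Qed.

Lemma regB f g : reg f -> reg g -> reg (fun x => f x - g x).
Proof.
move=> fr gr; apply: reg_ext (regD fr (regM (reg_cst (-1)) gr)) => x _.
by rewrite mulN1r.
Qed.

Lemma regmx_cst p q (B : 'M[F]_(p, q)) : regmx (fun=> B).
Proof. by move=> i j; exact: reg_cst. Qed.

Lemma regmx_mul p q r (phi : M -> 'M[F]_(p, q)) (psi : M -> 'M[F]_(q, r)) :
  regmx phi -> regmx psi -> regmx (fun x => phi x *m psi x).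
Proof.
move=> phir psir i j.
apply: reg_ext (reg_sum _ (fun k => regM (phir i k) (psir k j))) => x _.
by rewrite mxE.
Qed.

Lemma regmx_form p q (L : 'Hom('M[F]_(p, q), F^o))
  (phi : M -> 'M[F]_(p, q)) : regmx phi -> reg (fun x => L (phi x)).
Proof.
move=> phir; apply: reg_ext (reg_sum (index_enum 'I_p) (fun k =>
  reg_sum (index_enum 'I_q) (fun l => regM (phir k l)
    (reg_cst (L (delta_mx k l)))))) => x _.
rewrite [X in _ = L X]matrix_sum_delta linear_sum.
apply: eq_bigr => k _; rewrite linear_sum.
by apply: eq_bigr => l _; rewrite linearZ.
Qed.

Lemma reg_comp f (phi : M -> M) : (forall x, x \in unitmx -> phi x \in unitmx) ->
  regmx phi -> regmx (fun x => invmx (phi x)) -> reg f ->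
  reg (fun x => f (phi x)).
Proof.
move=> phiu phir phiVr; elim=> {f}.
- by move=> c; exact: reg_cst.
- by move=> i j; exact: phir.
- by move=> i j; exact: phiVr.
- by move=> f g _ fr _ gr; exact: regD.
- by move=> f g _ fr _ gr; exact: regM.
- by move=> f g fg _ fr; apply: reg_ext fr => x xu; rewrite fg ?phiu.
Qed.

Lemma reg_meval (p : {mpoly F[n * n]}) : reg (fun x => p.@[mxcoord x]).
Proof.
elim/mpoly_ring_ind: p => [c|k|p q pr qr|p q pr qr].
- by apply: reg_ext (reg_cst c) => x _; rewrite mevalC.
- case/mxvec_indexP: k => i j; apply: reg_ext (reg_entry i j) => x _.
  by rewrite mevalXU /mxcoord mxvecE.
- by apply: reg_ext (regD pr qr) => x _; rewrite mevalD.
- by apply: reg_ext (regM pr qr) => x _; rewrite mevalM.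
Qed.

Definition poly_fun f := exists p : {mpoly F[n * n]},
  forall x : M, f x = p.@[mxcoord x].

Lemma poly_fun_cst c : poly_fun (fun=> c).
Proof. by exists c%:MP => x; rewrite mevalC. Qed.

Lemma poly_fun_entry i j : poly_fun (fun x => x i j).
Proof.
by exists 'X_(mxvec_index i j) => x; rewrite mevalXU /mxcoord mxvecE.
Qed.

Lemma poly_funD f g : poly_fun f -> poly_fun g -> poly_fun (fun x => f x + g x).
Proof. by case=> p pE [q qE]; exists (p + q) => x; rewrite mevalD pE qE. Qed.

Lemma poly_funM f g : poly_fun f -> poly_fun g -> poly_fun (fun x => f x * g x).
Proof. by case=> p pE [q qE]; exists (p * q) => x; rewrite mevalM pE qE. Qed.

Lemma poly_funX f k : poly_fun f -> poly_fun (fun x => f x ^+ k).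
Proof. by case=> p pE; exists (p ^+ k) => x; rewrite rmorphXn pE. Qed.

Lemma poly_fun_ext f g : f =1 g -> poly_fun f -> poly_fun g.
Proof. by move=> /funext ->. Qed.

Lemma poly_fun_sum (I : Type) (r : seq I) (G : I -> M -> F) :
  (forall i, poly_fun (G i)) -> poly_fun (fun x => \sum_(i <- r) G i x).
Proof.
move=> Gr; elim: r => [|i r IHr].
  by apply: poly_fun_ext (poly_fun_cst 0) => x; rewrite big_nil.
by apply: poly_fun_ext (poly_funD (Gr i) IHr) => x; rewrite big_cons.
Qed.

Lemma poly_fun_prod (I : Type) (r : seq I) (G : I -> M -> F) :
  (forall i, poly_fun (G i)) -> poly_fun (fun x => \prod_(i <- r) G i x).
Proof.
move=> Gr; elim: r => [|i r IHr].
  by apply: poly_fun_ext (poly_fun_cst 1) => x; rewrite big_nil.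
by apply: poly_fun_ext (poly_funM (Gr i) IHr) => x; rewrite big_cons.
Qed.

Lemma poly_fun_det m (phi : M -> 'M[F]_m) :
  (forall i j, poly_fun (fun x => phi x i j)) -> poly_fun (fun x => \det (phi x)).
Proof.
move=> phip; rewrite /determinant; apply: poly_fun_sum => s.
by apply: poly_funM; [exact: poly_fun_cst|exact: poly_fun_prod].
Qed.

(** Entries of the inverse are cofactors over the determinant, so a power of the determinant clears
    denominators. Zero sets of regular functions thus fit [zclosed], which speaks of polynomials
    only. *)
Lemma reg_numerator f : reg f -> exists N, exists p : {mpoly F[n * n]},
  {in unitmx, forall x : M, f x * \det x ^+ N = p.@[mxcoord x]}.
Proof.
have detp k : poly_fun (fun x : M => \det x ^+ k).
  by apply: poly_funX; apply: (poly_fun_det (phi := id)); exact: poly_fun_entry.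
elim=> {f}.
- move=> c; have [p pE] := poly_fun_cst c.
  by exists 0%N, p => x _; rewrite expr0 mulr1 -(pE x).
- move=> i j; have [p pE] := poly_fun_entry i j.
  by exists 0%N, p => x _; rewrite expr0 mulr1 pE.
- move=> i j; have [p pE] : poly_fun (fun x : M => (\adj x) i j).
    apply: (@poly_fun_ext (fun x => cofactor x j i)) => [x|]; first by rewrite mxE.
    apply: poly_funM; first exact: poly_fun_cst.
    apply: poly_fun_det => k l; apply: poly_fun_ext (poly_fun_entry (lift j k)
      (lift i l)) => x.
    by rewrite !mxE.
  exists 1%N, p => x xu; rewrite /invmx xu mxE -pE expr1.
  by rewrite mulrC mulrA divff ?mul1r// -unitfE -unitmxE.
- move=> f g _ [N [p pE]] _ [K [q qE]].
  have [dN dNE] := detp N; have [dK dKE] := detp K.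
  exists (N + K)%N, (p * dK + q * dN) => x xu.
  by rewrite mevalD !mevalM -pE// -qE// -dNE -dKE exprD; ring.
- move=> f g _ [N [p pE]] _ [K [q qE]].
  exists (N + K)%N, (p * q) => x xu.
  by rewrite mevalM -pE// -qE// exprD; ring.
- move=> f g fg _ [N [p pE]]; exists N, p => x xu.
  by rewrite -fg// pE.
Qed.

Lemma zclosed_reg (S : set (M -> F)) : (forall f, S f -> reg f) ->
  zclosed [set x : M | x \in unitmx /\ forall f, S f -> f x = 0].
Proof.
move=> Sr; exists [set p | exists f N, S f /\
  {in unitmx, forall x : M, f x * \det x ^+ N = p.@[mxcoord x]}].
apply/seteqP; split => x /= [xu xS]; split => //.
  by move=> p [f [N [Sf fE]]]; rewrite -fE// xS ?mul0r.
move=> f Sf; have [N [p pE]] := reg_numerator (Sr f Sf).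
have /eqP := pE x xu; rewrite xS; last by exists f, N.
rewrite mulf_eq0 expf_eq0 => /orP[/eqP//|/andP[_ /eqP dx0]].
by move: xu; rewrite unitmxE dx0 unitr0.
Qed.

Lemma zclosed_regP Z : zclosed Z -> exists S : set (M -> F),
  (forall f, S f -> reg f) /\
  Z = [set x : M | x \in unitmx /\ forall f, S f -> f x = 0].
Proof.
case=> S ->; exists [set f | exists2 p, S p & f = fun x => p.@[mxcoord x]].
split; first by move=> f [p _ ->]; exact: reg_meval.
apply/seteqP; split => x /= [xu xS]; split => //.
  by move=> f [p Sp ->]; exact: xS.
by move=> p Sp; apply: (xS (fun x => p.@[mxcoord x])); exists p.
Qed.

Lemma zclosed_unit Z x : zclosed Z -> Z x -> x \in unitmx.
Proof. by case=> S -> []. Qed.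

Lemma zclosed_zero f : reg f -> zclosed [set x : M | x \in unitmx /\ f x = 0].
Proof.
move=> fr; have -> : [set x : M | x \in unitmx /\ f x = 0] =
    [set x : M | x \in unitmx /\ forall g, [set f] g -> g x = 0].
  apply/seteqP; split => x [xu fx]; split => //; last exact: fx.
  by move=> g ->.
by apply: zclosed_reg => g ->.
Qed.

Lemma zclosed_preim Z (phi : M -> M) :
  (forall x, x \in unitmx -> phi x \in unitmx) ->
  regmx phi -> regmx (fun x => invmx (phi x)) -> zclosed Z ->
  zclosed [set x : M | x \in unitmx /\ Z (phi x)].
Proof.
move=> phiu phir phiVr /zclosed_regP[S [Sr ->]].
have -> : [set x : M | x \in unitmx /\
     [set x | x \in unitmx /\ (forall f, S f -> f x = 0)] (phi x)] =
   [set x : M | x \in unitmx /\ forall g,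
     [set g | exists2 f, S f & g = fun x => f (phi x)] g -> g x = 0].
  apply/seteqP; split => x /= [xu].
    by case=> _ xS; split => // g [f Sf ->]; exact: xS.
  move=> xS; split => //; split; first exact: phiu.
  by move=> f Sf; apply: (xS (fun x => f (phi x))); exists f.
apply: zclosed_reg => g [f Sf ->]; apply: reg_comp => //; exact: Sr.
Qed.

Lemma zclosed_bigI (I : Type) (P : I -> Prop) (Z : I -> set M) :
  (forall i, P i -> zclosed (Z i)) ->
  zclosed [set x : M | x \in unitmx /\ forall i, P i -> Z i x].
Proof.
move=> Zc.
exists [set p | exists2 i, P i & forall x, Z i x -> p.@[mxcoord x] = 0].
apply/seteqP; split => x /= [xu xZ]; split => //.
  by move=> p [i Pi ip]; exact/ip/xZ.
move=> i Pi; have [S ZE] := Zc i Pi; rewrite ZE; split => // p Sp.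
by apply: xZ; exists i => // y; rewrite ZE => -[_]; apply.
Qed.

Lemma zclosedI Z1 Z2 : zclosed Z1 -> zclosed Z2 -> zclosed (Z1 `&` Z2).
Proof.
move=> c1 c2; have := @zclosed_bigI bool setT (fun b => if b then Z1 else Z2).
set Y := [set x | _]; have -> : Y = Z1 `&` Z2; last by apply=> -[].
apply/seteqP; split => x.
  by case=> _ xZ; split; [exact: (xZ true)|exact: (xZ false)].
by case=> x1 x2; split; [exact: zclosed_unit x1|case].
Qed.

(* A regular function with finitely many values has closed level sets, which  *)
(* partition its domain. *)
Lemma zconnected_finite_const A f (rs : seq F) :
  zconnected A -> (forall x, A x -> x \in unitmx) -> reg f ->
  (forall x, A x -> f x \in rs) -> forall x y, A x -> A y -> f x = f y.
Proof.
move=> [_ cA] Au fr frs x y Ax Ay.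
pose g z := \prod_(a <- rs | a != f x) (f z - a).
have gr : reg g.
  apply: (@reg_ext (fun z => \prod_(a <- [seq a <- rs | a != f x]) (f z - a))).
    by move=> z _; rewrite big_filter.
  by apply: reg_prod => a; apply: regB => //; exact: reg_cst.
pose Z1 := [set z : M | z \in unitmx /\ f z - f x = 0].
pose Z2 := [set z : M | z \in unitmx /\ g z = 0].
have [||||A1|A2] := cA Z1 Z2.
- by apply: zclosed_zero; apply: regB => //; exact: reg_cst.
- exact: zclosed_zero.
- move=> z Az; case: (eqVneq (f z) (f x)) => [fzx|fzx].
    by left; split; [exact: Au|rewrite fzx subrr].
  right; split; first exact: Au.
  by rewrite /g (big_rem (f z)) ?frs//= fzx subrr mul0r.
- apply/seteqP; split => // z [Az [[_ fz] [_ /eqP]]].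
  rewrite /g prodf_seq_eq0 => /hasP[a _ /andP[ax]].
  by rewrite subr_eq0 => /eqP fza; rewrite -fza -subr_eq0 fz eqxx in ax.
- by have [_ /subr0_eq] := A1 y Ay.
- have [_ /eqP] := A2 x Ax; rewrite /g prodf_seq_eq0 => /hasP[a _ /andP[ax]].
  by rewrite subr_eq0 eq_sym (negPf ax).
Qed.

Lemma zconnected_split A Z1 Z2 x : zconnected A -> zclosed Z1 -> zclosed Z2 ->
  A `<=` Z1 `|` Z2 -> A `&` (Z1 `&` Z2) = set0 -> A x -> Z1 x -> A `<=` Z1.
Proof.
move=> [_ cA] c1 c2 AZ AZ0 Ax Zx; have [//|A2] := cA Z1 Z2 c1 c2 AZ AZ0.
have : (A `&` (Z1 `&` Z2)) x by split => //; split => //; exact: A2.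
by rewrite AZ0.
Qed.

Lemma zconnected_image A (phi : M -> M) :
  (forall x, x \in unitmx -> phi x \in unitmx) ->
  regmx phi -> regmx (fun x => invmx (phi x)) ->
  (forall x, A x -> x \in unitmx) -> zconnected A -> zconnected (phi @` A).
Proof.
move=> phiu phir phiVr Au [[a Aa] cA]; split; first by exists (phi a), a.
move=> Z1 Z2 c1 c2 AZ AZ0.
have [||A1|A2] := cA _ _ (zclosed_preim phiu phir phiVr c1)
                          (zclosed_preim phiu phir phiVr c2).
- move=> x Ax; have [|Z1x|Z2x] := AZ (phi x); first by exists x.
    by left; split; [exact: Au|].
  by right; split; [exact: Au|].
- apply/seteqP; split => // x [Ax [[_ Z1x] [_ Z2x]]].
  by rewrite -[set0 x]/(set0 (phi x)) -AZ0; split; [exists x|].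
- by left => _ [x Ax <-]; have [] := A1 x Ax.
- by right => _ [x Ax <-]; have [] := A2 x Ax.
Qed.

End RegularFunctions.

(** * Algebraic groups generated by connected sets *)

Section MatrixGroups.
Variables (F : fieldType) (n : nat).
Local Notation M := 'M[F]_n.
Implicit Types (A K E Z : set M).

Lemma invmx_mulmx (x y : M) : x \in unitmx -> y \in unitmx ->
  invmx (x *m y) = invmx y *m invmx x.
Proof.
move=> xu yu; have xyu : x *m y \in unitmx by rewrite unitmx_mul xu.
rewrite -[RHS]mul1mx -(mulVmx xyu) -!mulmxA.
by rewrite (mulmxA y) mulmxV// mul1mx mulmxV// mulmx1.
Qed.

(** Word maps with constants. They preserve GL_n and, with their pointwise inverses, are regular;
    hence they are continuous for the Zariski topology. *)
Inductive regword : (M -> M) -> Prop :=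
| regword_cst a : a \in unitmx -> regword (fun=> a)
| regword_id : regword id
| regword_inv phi : regword phi -> regword (fun x => invmx (phi x))
| regword_mul phi psi : regword phi -> regword psi ->
    regword (fun x => phi x *m psi x).

Lemma regword_unit phi x : regword phi -> x \in unitmx -> phi x \in unitmx.
Proof.
move=> phiw xu; elim: phiw => //= [f _ fu|f g _ fu _ gu].
  by rewrite unitmx_inv.
by rewrite unitmx_mul fu.
Qed.

Lemma regword_reg phi : regword phi ->
  regmx phi /\ regmx (fun x => invmx (phi x)).
Proof.
elim=> {phi}.
- by move=> a _; split; exact: regmx_cst.
- by split=> i j; [exact: reg_entry|exact: reg_inv].
- by move=> f _ [f1 f2]; split => // i j; apply: reg_ext (f1 i j) => x _;
    rewrite invmxK.
- move=> f g fw [f1 f2] gw [g1 g2]; split; first exact: regmx_mul.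
  move=> i j; apply: reg_ext (regmx_mul g2 f2 i j) => x xu.
  by rewrite invmx_mulmx ?(regword_unit _ xu).
Qed.

Lemma zclosed_word_preim Z phi : regword phi -> zclosed Z ->
  zclosed [set x : M | x \in unitmx /\ Z (phi x)].
Proof.
move=> phiw; have [r1 r2] := regword_reg phiw.
by apply: zclosed_preim => // x; exact: regword_unit.
Qed.

Lemma zconnected_word_image A phi : regword phi ->
  (forall x, A x -> x \in unitmx) -> zconnected A -> zconnected (phi @` A).
Proof.
move=> phiw; have [r1 r2] := regword_reg phiw.
by apply: zconnected_image => // x; exact: regword_unit.
Qed.

Lemma commutator_subgroup_sub A : subgroup A -> commutator_subgroup A `<=` A.
Proof.
move=> gA z; apply => // x y Ax Ay; have [_ _ AM AV] := gA.
by apply: (AM); [apply: (AM); [exact: AM|exact: AV]|exact: AV].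
Qed.

Lemma commutator_mem A x y : A x -> A y ->
  commutator_subgroup A (x *m y *m invmx x *m invmx y).
Proof. by move=> Ax Ay H _; exact. Qed.

Lemma subgroup_commutator A : subgroup A -> subgroup (commutator_subgroup A).
Proof.
move=> gA; split.
- by move=> x /(commutator_subgroup_sub gA); have [Au _ _ _] := gA; exact: Au.
- by move=> H [].
- move=> x y xA yA H gH Hc; have [_ _ HM _] := gH.
  by apply: HM; [exact: xA|exact: yA].
- move=> x xA H gH Hc; have [_ _ _ HV] := gH.
  by apply: HV; exact: xA.
Qed.

Lemma iter_commutator_subgroup k A : subgroup A ->
  subgroup (iter k (@commutator_subgroup F n) A).
Proof. by move=> gA; elim: k => //= k; exact: subgroup_commutator. Qed.

Lemma commutator_subgroup_conj A x y : subgroup A -> commutator_subgroup A x ->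
  A y -> commutator_subgroup A (invmx y *m x *m y).
Proof.
move=> gA Ax Ay; have [Au A1 AM AV] := gA.
have Ax' := commutator_subgroup_sub gA Ax.
have [_ _ cM _] := subgroup_commutator gA.
have -> : invmx y *m x *m y =
    x *m (invmx x *m invmx y *m invmx (invmx x) *m invmx (invmx y)).
  by rewrite !invmxK !mulmxA mulmxV ?mul1mx ?Au.
by apply: cM => //; apply: commutator_mem; exact: AV.
Qed.

(** The intersection of the parts of [K] that contain 1 and are both open and closed in [K]. It is
    closed when [K] is, and [K] is connected as soon as it is contained in it; this reduces the
    connectedness of a generated group to that of its generators. *)
Definition quasi_component K : set M :=
  [set x | K x /\ forall Z1 Z2, zclosed Z1 -> zclosed Z2 -> K `<=` Z1 `|` Z2 ->
     K `&` (Z1 `&` Z2) = set0 -> Z1 1%:M -> Z1 x].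

(** A separation of [K] by two closed sets pulls back, along a translation or the inversion of [K],
    to another separation. *)
Lemma quasi_component_subgroup K : subgroup K -> subgroup (quasi_component K).
Proof.
move=> [Ku K1 KM KV].
have pull phi x Z1 Z2 : regword phi -> (forall z, K z -> K (phi z)) ->
    zclosed Z1 -> zclosed Z2 -> K `<=` Z1 `|` Z2 ->
    K `&` (Z1 `&` Z2) = set0 -> Z1 (phi 1%:M) -> quasi_component K x ->
    Z1 (phi x).
  move=> phiw phiK c1 c2 KZ KZ0 Z11 [Kx Qx].
  have [|||_ zx //] := Qx _ _ (zclosed_word_preim phiw c1)
    (zclosed_word_preim phiw c2).
  - move=> z Kz; have [Z1z|Z2z] := KZ _ (phiK z Kz); [left|right].
      by split => //; exact: Ku.
    by split => //; exact: Ku.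
  - apply/seteqP; split => // z [Kz [[_ z1] [_ z2]]].
    by rewrite -[set0 z]/(set0 (phi z)) -KZ0; split => //; exact: phiK.
  - by split => //; exact: unitmx1.
split.
- by move=> x [/Ku].
- by split.
- move=> x y [Kx Qx] Qy; split; first by apply: KM => //; case: Qy.
  move=> Z1 Z2 c1 c2 KZ KZ0 Z11.
  apply: (@pull (fun z => x *m z) y Z1 Z2) => //.
  + by apply: regword_mul; [apply: regword_cst; exact: Ku|exact: regword_id].
  + by move=> z; exact: KM.
  + by rewrite mulmx1; exact: (Qx Z1 Z2).
- move=> x Qx; split; first by apply: KV; case: Qx.
  move=> Z1 Z2 c1 c2 KZ KZ0 Z11; apply: (@pull invmx x Z1 Z2) => //.
  + exact: (regword_inv regword_id).
  + by rewrite invmx1.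
Qed.

Lemma zconnected_sub_quasi_component K (D : set M) : zconnected D -> D `<=` K ->
  D 1%:M -> D `<=` quasi_component K.
Proof.
move=> cD DK D1 x Dx; split; first exact: DK.
move=> Z1 Z2 c1 c2 KZ KZ0 Z11.
apply: (zconnected_split cD c1 c2) D1 Z11 _ Dx => [y /DK/KZ//|].
apply/seteqP; split => // y [Dy Zy].
by rewrite -KZ0; split => //; exact: DK.
Qed.

Lemma zconnected_quasi_component K : K 1%:M -> K `<=` quasi_component K ->
  zconnected K.
Proof.
move=> K1 KQ; split; first by exists 1%:M.
move=> Z1 Z2 c1 c2 KZ KZ0; have [Z11|Z21] := KZ _ K1.
  by left => x /KQ[_]; apply; eassumption.
right => x /KQ[_ Qx]; apply: (Qx Z2 Z1) => //; first by rewrite setUC.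
by rewrite [Z2 `&` Z1]setIC.
Qed.

Lemma zclosed_quasi_component K : zclosed K -> zclosed (quasi_component K).
Proof.
move=> cK; pose P (Z : set M * set M) := [/\ zclosed Z.1, zclosed Z.2,
  K `<=` Z.1 `|` Z.2, K `&` (Z.1 `&` Z.2) = set0 & Z.1 1%:M].
have -> : quasi_component K =
    K `&` [set x | x \in unitmx /\ forall Z : set M * set M, P Z -> Z.1 x].
  apply/seteqP; split => x.
    move=> [Kx Qx]; split => //; split; first exact: zclosed_unit Kx.
    by move=> [Z1 Z2] [/= *]; apply: (Qx Z1 Z2).
  move=> [Kx [_ Px]]; split => // Z1 Z2 *.
  by apply: (Px (Z1, Z2)); split.
by apply: zclosedI => //; apply: zclosed_bigI => Z [].
Qed.

(** For a fixed [y], the commutators of elements of [A] with [y] are the image of [A] under a word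
    map and include 1. They therefore lie in the quasi-component, which is a group and so contains
    everything they generate. *)
Lemma zconnected_commutator A : subgroup A -> zconnected A ->
  zconnected (commutator_subgroup A).
Proof.
move=> gA cA; have [Au A1 AM AV] := gA.
have gC := subgroup_commutator gA; have [_ C1 _ _] := gC.
apply: zconnected_quasi_component => // z; apply.
  exact: quasi_component_subgroup.
move=> x y Ax Ay.
pose phi x := x *m y *m invmx x *m invmx y.
have phiw : regword phi.
  have yw : regword (fun=> y) by apply: regword_cst; exact: Au.
  apply: regword_mul; last exact: regword_inv.
  apply: regword_mul; last exact: (regword_inv regword_id).
  by apply: regword_mul => //; exact: regword_id.
apply: (zconnected_sub_quasi_component (zconnected_word_image phiw Au cA)).
- by move=> _ [t At <-]; exact: commutator_mem.
- by exists 1%:M; rewrite // /phi mul1mx invmx1 mulmx1 mulmxV ?Au.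
- by exists x.
Qed.

Lemma algebraic_group_GL : algebraic_group [set x : M | x \in unitmx].
Proof.
split; first split => //=.
- exact: unitmx1.
- by move=> x y xu yu; rewrite unitmx_mul xu.
- by move=> x xu; rewrite unitmx_inv.
- by exists set0; apply/seteqP; split => x /=; [|case].
Qed.

Definition alggen E : set M :=
  [set x | forall A, algebraic_group A -> E `<=` A -> A x].

Lemma alggen_sub E : E `<=` alggen E.
Proof. by move=> x Ex A _; exact. Qed.

Lemma alggen_min E A : algebraic_group A -> E `<=` A -> alggen E `<=` A.
Proof. by move=> gA EA x; exact. Qed.

Lemma algebraic_group_alggen E : (forall x, E x -> x \in unitmx) ->
  algebraic_group (alggen E).
Proof.
move=> Eu; split; first split.
- move=> x xE; apply: (xE [set x | x \in unitmx]) => //; exact: algebraic_group_GL.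
- by move=> A [[]].
- move=> x y xE yE A gA EA; have [[_ _ AM _] _] := gA.
  by apply: AM; [exact: xE|exact: yE].
- move=> x xE A gA EA; have [[_ _ _ AV] _] := gA.
  by apply: AV; exact: xE.
have -> : alggen E = [set x | x \in unitmx /\ forall A,
    algebraic_group A /\ E `<=` A -> A x].
  apply/seteqP; split => x; last by case=> _ xE A gA EA; apply: xE.
  move=> xE; split; last by move=> A [gA EA]; exact: xE.
  by apply: (xE [set x | x \in unitmx]) => //; exact: algebraic_group_GL.
by apply: (@zclosed_bigI _ _ (set M) _ id) => A [[]].
Qed.

Lemma zconnected_alggen E : (forall x, E x -> x \in unitmx) ->
  (forall x, E x -> exists D, [/\ zconnected D, D `<=` E, D 1%:M & D x]) ->
  zconnected (alggen E).
Proof.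
move=> Eu Ec; have [gE cE] := algebraic_group_alggen Eu.
apply: zconnected_quasi_component; first by have [] := gE.
apply: alggen_min.
  split; [exact: quasi_component_subgroup|exact: zclosed_quasi_component].
move=> x /Ec[D [cD DE D1 Dx]].
apply: zconnected_sub_quasi_component Dx => // y /DE; exact: alggen_sub.
Qed.

Lemma subgroup_conj_preim A y : y \in unitmx -> subgroup A ->
  subgroup [set x : M | x \in unitmx /\ A (y *m x *m invmx y)].
Proof.
move=> yu [Au A1 AM AV]; split => /=.
- by move=> x [].
- by split; [exact: unitmx1|rewrite mulmx1 mulmxV].
- move=> x z [xu Ax] [zu Az]; split; first by rewrite unitmx_mul xu.
  have := AM _ _ Ax Az; rewrite !mulmxA -[_ *m invmx y *m y]mulmxA.
  by rewrite mulVmx// mulmx1.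
- move=> x [xu Ax]; split; first by rewrite unitmx_inv.
  have := AV _ Ax; rewrite !invmx_mulmx ?unitmx_mul ?unitmx_inv ?yu//.
  by rewrite invmxK mulmxA.
Qed.

Lemma regword_conj y : y \in unitmx -> regword (fun x => y *m x *m invmx y).
Proof.
move=> yu; apply: regword_mul; last first.
  by apply: regword_cst; rewrite unitmx_inv.
by apply: regword_mul; [exact: regword_cst|exact: regword_id].
Qed.

Lemma alggen_conj E y x : (forall x, E x -> x \in unitmx) -> y \in unitmx ->
  (forall e, E e -> E (y *m e *m invmx y)) ->
  alggen E x -> alggen E (y *m x *m invmx y).
Proof.
move=> Eu yu Ey Ex; have [gE cE] := algebraic_group_alggen Eu.
suff : [set x | x \in unitmx /\ alggen E (y *m x *m invmx y)] x by case.
apply: Ex.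
  split; first exact: subgroup_conj_preim.
  exact: zclosed_word_preim (regword_conj yu) cE.
by move=> e Ee; split; [exact: Eu|apply: alggen_sub; exact: Ey].
Qed.

End MatrixGroups.

(** * One-parameter subgroups and tangent vectors *)

Section BoundedDegree.
Variables (F : fieldType) (N : nat).
Implicit Types p q : {mpoly F[N]}.

Definition deg_lt d p := forall m : 'X_{1..N}, (d <= mdeg m)%N -> p@_m = 0.

Lemma deg_lt_msize p : deg_lt (msize p) p.
Proof. by move=> m /msize_mdeg_ge; rewrite -mcoeff_eq0 => /eqP. Qed.

Lemma deg_lt_sum d (I : eqType) (r : seq I) (G : I -> {mpoly F[N]}) :
  (forall i, i \in r -> deg_lt d (G i)) -> deg_lt d (\sum_(i <- r) G i).
Proof.
move=> Gd m dm; rewrite raddf_sum /= big_seq big1// => i ir; exact: Gd.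
Qed.

Lemma deg_ltZ d c p : deg_lt d p -> deg_lt d (c *: p).
Proof. by move=> pd m dm; rewrite mcoeffZ pd ?mulr0. Qed.

Lemma deg_lt_linear_derivation d (a : 'M[F]_N) p : deg_lt d p ->
  deg_lt d (\sum_(k < N) p^`M(k) * \sum_(l < N) a l k *: 'X_l).
Proof.
move=> pd; apply: deg_lt_sum => k _; rewrite mulr_sumr; apply: deg_lt_sum => l _.
rewrite -scalerAr; apply: deg_ltZ; rewrite /mderiv mulr_suml.
apply: deg_lt_sum => m mp; rewrite -scalerAl -mpolyXD.
case: (posnP (m k)) => [->|mk]; first by rewrite mul0r scale0r => ?; rewrite mcoeff0.
apply: deg_ltZ => m' dm'; rewrite mcoeffX; case: eqP => // mE.
have Um : (U_(k) <= m)%MM.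
  by apply/mnm_lepP => j; rewrite mnmE; case: eqP => // <-.
have : p@_m = 0.
  apply: pd; rewrite (leq_trans dm')// -mE mdegD mdeg1.
  by rewrite -{2}(submK Um) mdegD mdeg1.
by move: mp; rewrite mcoeff_msupp => /eqP.
Qed.

(** Polynomials of bounded degree form a finite-dimensional space. Applied to iterated derivatives
    of a polynomial, this yields a finite linear differential system. *)
Lemma deg_lt_dependent d (q : nat -> {mpoly F[N]}) :
  (forall k, deg_lt d (q k)) ->
  exists K, exists a : 'I_K -> F, q K = \sum_(i < K) a i *: q i.
Proof.
move=> qd; pose T : finType := 'X_{1..N < d}.
pose v (p : {mpoly F[N]}) : 'rV[F]_#|T| :=
  \row_(j < #|T|) p@_(bmnm (enum_val j : 'X_{1..N < d})).
pose S k := <<[tuple v (q i) | i < k]>>%VS.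
have [K SK] : exists K, v (q K) \in S K.
  apply: contrapT => noK.
  have dimS k : (k <= \dim (S k))%N.
    elim: k => // k IHk.
    have vk : v (q k) \notin S k by apply/negP => vk; apply: noK; exists k.
    have SS : (<[v (q k)]> + S k <= S k.+1)%VS.
      rewrite subv_add -memvE; apply/andP; split.
        apply: memv_span; apply/tnthP; exists ord_max; by rewrite tnth_mktuple.
      apply/span_subvP => _ /tnthP[i ->]; rewrite tnth_mktuple.
      apply: memv_span; apply/tnthP; exists (widen_ord (leqnSn k) i).
      by rewrite tnth_mktuple.
    apply: leq_trans (dimvS SS); rewrite dimv_disjoint_sum; last first.
      apply/eqP; rewrite -subv0; apply/subvP => w /memv_capP[/vlineP[c ->]].
      case: (eqVneq c 0) => [->|c0]; first by rewrite scale0r => _; exact: mem0v.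
      by move=> /(memvZ c^-1); rewrite scalerA mulVf// scale1r (negPf vk).
    have -> : \dim <[v (q k)]> = 1%N.
      by rewrite dim_vline; case: eqP vk => // ->; rewrite mem0v.
    by rewrite add1n ltnS.
  have := dimS (#|T|.+1); rewrite leqNgt => /negP; apply.
  by rewrite ltnS (leq_trans (dimvS (subvf _)))// dimvf /dim /= mul1n.
exists K, (fun i => coord [tuple v (q i) | i < K] i (v (q K))).
apply/mpolyP => m; case: (ltnP (mdeg m) d) => dm; last first.
  by rewrite qd//; symmetry; apply: (deg_lt_sum _ dm) => i _; apply: deg_ltZ.
pose m' : T := BMultinom dm.
have := coord_span SK => /rowP/(_ (enum_rank m')).
rewrite mxE enum_rankK /= => ->; rewrite summxE raddf_sum /=.
apply: eq_bigr => i _; rewrite mcoeffZ mxE; congr (_ * _).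
rewrite (nth_map i) ?size_enum_ord ?ltn_ord// nth_ord_enum mxE.
by rewrite enum_rankK.
Qed.

End BoundedDegree.

Section OneParameter.
Variable R : realType.
Local Notation C := R[i].
Variable n : nat.
Local Notation M := 'M[C]_n.
Implicit Types (A : set M) (X : M) (L : {vspace M}).

(* The action of the left invariant vector field [X] on polynomials. *)
Definition vfield X (p : {mpoly C[n * n]}) : {mpoly C[n * n]} :=
  \sum_(k < n * n) p^`M(k) * \sum_(l < n * n) (lin_mulmxr X) l k *: 'X_l.

Lemma meval_vfield X p (x : M) : (vfield X p).@[mxcoord x] =
  \sum_(k < n * n) (p^`M(k)).@[mxcoord x] * mxcoord (x *m X) k.
Proof.
rewrite /vfield raddf_sum /=; apply: eq_bigr => k _; rewrite mevalM.
congr (_ * _); rewrite /mxcoord.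
have -> : mxvec (x *m X) = mxvec x *m lin_mulmxr X by rewrite mul_vec_lin.
rewrite mxE raddf_sum /=.
by apply: eq_bigr => l _ /=; rewrite mevalZ mevalXU mulrC.
Qed.

Lemma cderiv_meval_mx (p : {mpoly C[n * n]}) (H dH : R -> M) : mxder H dH ->
  cderiv (fun t => p.@[mxcoord (H t)])
    (fun t => \sum_(k < n * n) (p^`M(k)).@[mxcoord (H t)] * mxcoord (dH t) k).
Proof.
move=> Hd; apply: cderiv_meval => k; exact: (mxder_lin (@mxvec C n n) Hd).
Qed.

Lemma mxder_line (X Y : M) :
  mxder (fun t => Y + Complex t 0 *: X) (fun=> X).
Proof.
have lin : cderiv (fun t : R => Complex t 0) (fun=> 1).
  by move=> t; split; [exact: is_derive_id|exact: is_derive_cst].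
move=> i j; apply: cderiv_ext (cderivD (cderiv_cst (Y i j))
  (cderivZ (X i j) lin)) => t; first by rewrite !mxE mulrC.
by rewrite add0r mulr1.
Qed.

Lemma poly_fun_mulmxl (p : {mpoly C[n * n]}) (y : M) :
  poly_fun (fun x : M => p.@[mxcoord (y *m x)]).
Proof.
elim/mpoly_ring_ind: p => [c|k|p q pr qr|p q pr qr].
- by apply: poly_fun_ext (poly_fun_cst n c) => x; rewrite mevalC.
- case/mxvec_indexP: k => i j.
  apply: poly_fun_ext (poly_fun_sum (index_enum 'I_n) (fun k =>
    poly_funM (poly_fun_cst n (y i k)) (poly_fun_entry C k j))) => x.
  by rewrite mevalXU /mxcoord mxvecE mxE.
- by apply: poly_fun_ext (poly_funD pr qr) => x; rewrite mevalD.
- by apply: poly_fun_ext (poly_funM pr qr) => x; rewrite mevalM.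
Qed.

(** Left translation by [y] preserves [A]. The derivative of [p] at [y] along [y *m X] is that of
    p(yx) at x = 1 along [X], where tangency applies; the two are compared along straight lines. *)
Lemma vfield_vanish A L X p : subgroup A -> lie_algebra_of A L -> X \in L ->
  (forall x, A x -> p.@[mxcoord x] = 0) ->
  forall x, A x -> (vfield X p).@[mxcoord x] = 0.
Proof.
move=> [Au A1 AM AV] lieA XL pA y Ay.
have [q qE] := poly_fun_mulmxl p y.
have qA x : A x -> q.@[mxcoord x] = 0 by move=> Ax; rewrite -qE pA//; exact: AM.
have q1 := (lieA X).1 XL q qA.
have d1 := cderiv_meval_mx q (mxder_line X 1%:M).
have d2 := cderiv_meval_mx p (mxder_line (y *m X) y).
have := cderiv_uniq (cderiv_ext _ _ d2) d1.
move=> /(_ (fun t => \sum_(k < n * n) (p^`M(k)).@[mxcoord (y + Complex t 0 *: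
  (y *m X))] *
    mxcoord (y *m X) k)).
move=> /(_ _ (fun=> erefl) 0); rewrite !scale0r !addr0 q1 -meval_vfield; apply.
by move=> t; rewrite -qE mulmxDr mulmx1 scalemxAr.
Qed.

Lemma onepar_mem A L X E D : algebraic_group A -> lie_algebra_of A L ->
  X \in L -> onepar X E D -> forall t, A (E t).
Proof.
move=> [gA [S AE]] lieA XL XED t; have [E0 Ed _ _ _] := XED.
suff IA p : (forall x, A x -> p.@[mxcoord x] = 0) -> p.@[mxcoord (E t)] = 0.
  rewrite AE; split; first by have [] := onepar_unit t XED.
  by move=> p Sp; apply: IA => x; rewrite AE => -[_]; apply.
move=> pA; pose q k := iter k (vfield X) p.
have qA k : forall x, A x -> (q k).@[mxcoord x] = 0.
  by elim: k => [//|k IHk]; exact: (vfield_vanish gA lieA XL).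
have qdeg k : deg_lt (msize p) (q k).
  by elim: k => [|k IHk]; [exact: deg_lt_msize|exact: deg_lt_linear_derivation].
have [K [a qK]] := deg_lt_dependent qdeg.
have qd k : cderiv (fun t => (q k).@[mxcoord (E t)])
                   (fun t => (q k.+1).@[mxcoord (E t)]).
  apply: cderiv_ext (cderiv_meval_mx (q k) Ed) => // s.
  by rewrite [RHS]meval_vfield.
(* The derivatives of [p] along the curve satisfy a companion linear system. *)
pose u s : 'rV[C]_K := \row_i (q i).@[mxcoord (E s)].
pose B : 'M[C]_K := \matrix_(i, j) (if j.+1 == K then a i else (i == j.+1 :> nat)%:R).
have ud : mxder u (fun s => u s *m B).
  move=> i j; apply: cderiv_ext (qd j) => s; rewrite !mxE //.
  case: (eqVneq j.+1 K) => jK.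
    rewrite jK qK raddf_sum /=; apply: eq_bigr => k _.
    by rewrite mevalZ !mxE jK eqxx mulrC.
  have jK' : (j.+1 < K)%N by rewrite ltn_neqAle jK ltn_ord.
  rewrite (bigD1 (Ordinal jK'))//= !mxE (negPf jK) eqxx mulr1 big1 ?addr0//.
  move=> k kj; rewrite !mxE (negPf jK).
  by move: kj; rewrite -val_eqE /= => /negPf ->; rewrite mulr0.
have u0 : u 0 = 0.
  by apply/rowP => i; rewrite !mxE E0 qA//; have [] := gA.
have /rowP ut := onepar_uniq ud u0 t.
(* For [K = 0] the relation expresses [q 0], which is [p], as an empty combination. *)
have [K0|K0] := posnP K.
  have -> : p = q 0%N by [].
  have -> : q 0%N = q K by rewrite K0.
  rewrite qK big1 ?meval0// => i _.
  by have := ltn_ord i; rewrite [X in (_ < X)%N]K0.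
by have := ut (Ordinal K0); rewrite !mxE.
Qed.

Lemma onepar_lie A L X E D : lie_algebra_of A L -> onepar X E D ->
  (forall t, A (E t)) -> X \in L.
Proof.
move=> lieA [E0 Ed _ _ _] AE; apply/lieA => p pA.
have := cderiv_uniq (cderiv_meval_mx p Ed) (cderiv_ext _ (fun=> erefl) (cderiv_cst 0)).
move=> /(_ _ 0); rewrite E0 mul1mx; apply => t.
by rewrite pA.
Qed.

(** Polynomials are continuous along the curve, so a Zariski separation of its range would
    disconnect the real line. *)
Lemma zconnected_onepar X E D : onepar X E D -> zconnected (range E).
Proof.
move=> XED; have [E0 Ed _ _ _] := XED; split; first by exists (E 0), 0.
have cl Z : zclosed Z -> closed [set t | Z (E t)].
  case=> S ->; rewrite [X in closed X](_ : _ =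
      \bigcap_(p in S) [set t | p.@[mxcoord (E t)] = 0]).
    apply: closed_bigI => p _; exact: cderiv_closed_zeros (cderiv_meval_mx p Ed).
  apply/seteqP; split => t /=; first by case=> _ tS p Sp; exact: tS.
  move=> tS; split; first by have [] := onepar_unit t XED.
  by move=> p Sp; exact: tS.
move=> Z1 Z2 c1 c2 EZ EZ0.
have cov t : Z1 (E t) \/ Z2 (E t) by apply: EZ; exists t.
have dis : [set t | Z1 (E t)] `&` [set t | Z2 (E t)] = set0.
  apply/seteqP; split => // t [Z1t Z2t].
  by rewrite -[set0 t]/(set0 (E t)) -EZ0; split => //; exists t.
have conn := real_line_connected (cl _ c1) (cl _ c2) cov dis.
have [Z10|Z20] := cov 0.
  by left => _ [t _ <-]; exact: (conn 0 t).
right => _ [t _ <-].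
apply: (real_line_connected (cl _ c2) (cl _ c1) _ _ (s := 0)) => //.
  by move=> s; case: (cov s) => ?; [right|left].
by rewrite setIC.
Qed.

Definition exp_set (L : {vspace M}) : set M :=
  [set x | exists X E D t, [/\ X \in L, onepar X E D & x = E t]].

Lemma exp_set_unit L x : exp_set L x -> x \in unitmx.
Proof. by case=> X [E [D [t [_ XED ->]]]]; have [] := onepar_unit t XED. Qed.

Lemma exp_set_connected L x : exp_set L x ->
  exists D, [/\ zconnected D, D `<=` exp_set L, D 1%:M & D x].
Proof.
case=> X [E [D [t [XL XED ->]]]]; exists (range E); split.
- exact: zconnected_onepar XED.
- by move=> _ [s _ <-]; exists X, E, D, s.
- by exists 0; have [] := XED.
- by exists t.
Qed.

Lemma onepar_conj X E D y : y \in unitmx -> onepar X E D ->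
  onepar (y *m X *m invmx y) (fun t => y *m E t *m invmx y)
    (fun t => y *m D t *m invmx y).
Proof.
move=> yu [E0 Ed Dd ED DE].
have cc (a b : M) : y *m a *m invmx y *m (y *m b *m invmx y) = y *m (a *m b) *m invmx y.
  by rewrite !mulmxA -[_ *m invmx y *m y]mulmxA mulVmx// mulmx1.
split.
- by rewrite E0 mulmx1 mulmxV.
- apply: mxder_ext (mxder_lin (mulmxr (invmx y)) (mxder_lin (mulmx y) Ed)) => t //=.

- apply: mxder_ext (mxder_lin (mulmxr (invmx y)) (mxder_lin (mulmx y) Dd)) => // t /=.
  by rewrite !mulmxA mulmxN mulNmx -[_ *m invmx y *m y]mulmxA mulVmx// mulmx1 !mulmxA.
- by move=> t; rewrite cc ED mulmx1 mulmxV.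
- by move=> t; rewrite cc DE mulmx1 mulmxV.
Qed.

Lemma exp_set_conj L y x : y \in unitmx ->
  (forall X, X \in L -> y *m X *m invmx y \in L) ->
  exp_set L x -> exp_set L (y *m x *m invmx y).
Proof.
move=> yu Ly [X [E [D [t [XL XED ->]]]]].
exists (y *m X *m invmx y), (fun t => y *m E t *m invmx y),
  (fun t => y *m D t *m invmx y), t; split => //; first exact: Ly.
exact: onepar_conj.
Qed.

Definition mxbr (X Y : M) : M := X *m Y - Y *m X.

Lemma mxder_conj X E D u : onepar X E D ->
  mxder (fun t => E t *m u *m D t) (fun t => mxbr X (E t *m u *m D t)).
Proof.
move=> XED; have [E0 Ed Dd ED DE] := XED.
apply: mxder_ext (mxder_mul (mxder_lin (mulmxr u) Ed) Dd) => // t /=.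
have XD : X *m D t = D t *m X.
  rewrite -[X *m D t]mul1mx -(DE t) -mulmxA; congr (_ *m _).
  by rewrite mulmxA -(onepar_comm t XED erefl) -mulmxA ED mulmx1.
by rewrite /mxbr XD mulmxN !mulmxA (onepar_comm t XED erefl).
Qed.

Lemma onepar_conj_stable X E D (U : {vspace M}) : onepar X E D ->
  (forall u, u \in U -> mxbr X u \in U) ->
  forall t u, u \in U -> E t *m u *m D t \in U.
Proof.
move=> XED XU t u uU.
pose L : {linear M -> M} := (mulmx X \- mulmxr X)%R.
apply: (@linear_ode_stable _ _ _ L U (fun t => E t *m u *m D t)) => //.
  exact: mxder_conj.
by have [E0 _ _ _ _] := XED; rewrite E0 (onepar_D0 XED) mul1mx mulmx1.
Qed.

Lemma onepar_conj_bracket X E D (U : {vspace M}) u : onepar X E D ->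
  (forall t, E t *m u *m D t \in U) -> mxbr X u \in U.
Proof.
move=> XED EU; have := mxder_mem (mxder_conj u XED) EU 0.
by have [E0 _ _ _ _] := XED; rewrite E0 (onepar_D0 XED) mul1mx mulmx1.
Qed.

End OneParameter.

(** * Spectra and traces of endomorphisms *)

Section TriangularTrace.
Variable F : numClosedFieldType.

Lemma trig_mx_mul n (A B : 'M[F]_n) : is_trig_mx A -> is_trig_mx B ->
  is_trig_mx (A *m B) /\ forall i, (A *m B) i i = A i i * B i i.
Proof.
move=> /is_trig_mxP At /is_trig_mxP Bt; split.
  apply/is_trig_mxP => i j ij; rewrite mxE big1// => k _.
  have [ik|ki] := ltnP i k; first by rewrite At ?mul0r.
  by rewrite Bt ?mulr0// (leq_ltn_trans ki).
move=> i; rewrite mxE (bigD1 i)//= big1 ?addr0// => k ki.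
have [ik|ik|ik] := ltngtP i k; first by rewrite At ?mul0r.
  by rewrite Bt ?mulr0.
by move: ki; rewrite -val_eqE /= ik eqxx.
Qed.

Lemma trig_mx_exp n (B : 'M[F]_n) k : is_trig_mx B ->
  is_trig_mx (B ^+ k) /\ forall i, (B ^+ k) i i = B i i ^+ k.
Proof.
move=> Bt; elim: k => [|k [IH1 IH2]].
  by rewrite expr0; split=> [|i]; [exact: scalar_mx_is_trig|rewrite mxE eqxx].
have [t d] := trig_mx_mul Bt IH1; rewrite exprS; split => // i.
by rewrite [LHS]d IH2 exprS.
Qed.

(** The list [rs] is the diagonal of a Schur triangularization, that is, the eigenvalues with
    multiplicity; the second clause is Cayley-Hamilton. *)
Lemma mxtrace_exp_spectrum n (A : 'M[F]_n) : exists rs : seq F,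
  [/\ forall k, \tr (A ^+ k) = \sum_(r <- rs) r ^+ k,
    let p := \prod_(r <- rs) ('X - r%:P) in \sum_(i < size p) p`_i *: A ^+ i = 0 &
    forall q : {poly F}, \sum_(i < size q) q`_i *: A ^+ i = 0 -> all (root q) rs].
Proof.
case: n A => [|n] A.
  exists [::]; split => //; first by move=> k; rewrite /mxtrace big_nil big_ord0.
  by rewrite /=; apply/matrixP => -[].
have [P Pu Pt] := Schur A (ltn0Sn n).
have Pun := unitarymx_unit Pu.
move: Pt; rewrite /similar_to conjumx//; set B := P *m A *m _ => Bt.
have AE : A = invmx P *m B *m P.
  by rewrite /B !mulmxA mulVmx// mul1mx -mulmxA mulVmx// mulmx1.
have Ak k : A ^+ k = invmx P *m B ^+ k *m P.
  elim: k => [|k IHk]; first by rewrite !expr0 mulmx1 mulVmx.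
  rewrite !exprS IHk {1}AE.
  by rewrite -!mulmxE !mulmxA -[_ *m P *m invmx P]mulmxA mulmxV// mulmx1 //.
have AkB k : B ^+ k = P *m A ^+ k *m invmx P.
  by rewrite Ak !mulmxA mulmxV// mul1mx -mulmxA mulmxV// mulmx1.
exists [seq B i i | i <- enum 'I_n.+1]; split; last first.
  move=> q qA; apply/allP => _ /mapP[j _ ->]; apply/eqP; rewrite horner_coef.
  transitivity ((\sum_(i < size q) q`_i *: B ^+ i) j j).
    rewrite summxE; apply: eq_bigr => i _; rewrite [RHS]mxE.
    by congr (_ * _); symmetry; exact: (proj2 (trig_mx_exp i Bt) j).
  suff -> : \sum_(i < size q) q`_i *: B ^+ i = 0 by rewrite mxE.
  transitivity (P *m (\sum_(i < size q) q`_i *: A ^+ i) *m invmx P).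
    rewrite mulmx_sumr mulmx_suml; apply: eq_bigr => i _.
    by rewrite AkB -scalemxAr -scalemxAl.
  by rewrite qA mulmx0 mul0mx.
set p := \prod_(r <- _) _.
have pE : p = char_poly B by rewrite (char_poly_trig Bt) /p big_map enumT.
have pB : \sum_(i < size p) p`_i *: B ^+ i = 0.
  have := Cayley_Hamilton B; rewrite -pE => pB0.
  rewrite -[RHS]pB0 /horner_mx /= /horner_morph.
  rewrite (horner_coef_wide _ (size_poly _ _)).
  apply: eq_bigr => i _; rewrite coef_map /=.
  by rewrite -mulmxE mul_scalar_mx.
rewrite /=; under eq_bigr do rewrite Ak.
transitivity (invmx P *m (\sum_(i < size p) p`_i *: B ^+ i) *m P).
  rewrite mulmx_sumr mulmx_suml; apply: eq_bigr => i _.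
  by rewrite -scalemxAr -scalemxAl.
by rewrite pB mulmx0 mul0mx.
  move=> k; rewrite Ak mxtrace_mulC mulmxA mulmxV// mul1mx /mxtrace big_map enumT.
  by apply: eq_bigr => i _; have [_ ->] := trig_mx_exp k Bt.
Qed.

End TriangularTrace.

(** * Polynomials in an endomorphism and eigenvectors modulo a subspace *)

Section LinearTools.
Variables (F : fieldType) (V : vectType F).
Implicit Types (U W : {vspace V}) (T S : 'End(V)) (p q : {poly F}).

(** Take a subspace of maximal dimension inside [P]: the line of a missing vector could be added to
    it. *)
Lemma vspace_comprehension (P : V -> Prop) : P 0 ->
  (forall a u v, P u -> P v -> P (a *: u + v)) ->
  exists U : {vspace V}, forall v, v \in U <-> P v.
Proof.
move=> P0 Plin; pose ok k := `[< exists U : {vspace V},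
  (forall v, v \in U -> P v) /\ \dim U = k >].
have ok0 : exists k, ok k.
  exists 0%N; apply/asboolP; exists 0%VS; split; last exact: dimv0.
  by move=> v; rewrite memv0 => /eqP ->.
have okb k : ok k -> (k <= \dim {:V})%N.
  by move=> /asboolP[U [_ <-]]; exact: dimvS (subvf U).
case: (ex_maxnP ok0 okb) => k /asboolP[U [UP dU]] kmax.
exists U => v; split; first exact: UP.
move=> Pv; apply: contrapT => /negP vU.
have : (\dim (<[v]> + U) <= k)%N.
  apply: kmax; apply/asboolP; exists (<[v]> + U)%VS; split => // w.
  move=> /memv_addP[_ /vlineP[c ->] [u uU ->]]; apply: Plin => //; exact: UP.
rewrite -dU => dle.
have /eqP UE : U == (<[v]> + U)%VS by rewrite eqEdim addvSr dle.
by move: vU; rewrite UE memvE addvSl.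
Qed.

Lemma vspace_separation W v : v \notin W ->
  exists phi : 'Hom(V, F^o), (forall w, w \in W -> phi w = 0) /\ phi v = 1.
Proof.
move=> vW; pose u := (\1 - projv W)%VF v.
have u0 : u != 0 by rewrite -(memv_projv_eq0 W v).
have [j uj] : exists j, coord (vbasis {:V}) j u != 0.
  apply: contrapT => noj; move: u0 => /eqP; apply.
  rewrite (coord_vbasis (memvf u)) big1// => j _.
  have [->|uj] := eqVneq (coord (vbasis {:V}) j u) 0; first by rewrite scale0r.
  by case: noj; exists j.
pose f : 'Hom(V, F^o) := linfun (coord (vbasis {:V}) j : V -> F^o).
exists ((coord (vbasis {:V}) j u)^-1 *: (f \o (\1 - projv W))%VF).
split=> [w wW|]; rewrite scale_lfunE comp_lfunE lfunE /=.
  by move: wW; rewrite (memv_projv_eq0 W w) => /eqP ->; rewrite linear0 scaler0.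
by rewrite /GRing.scale /= mulVf.
Qed.

Lemma linear_hom (U' W' : vectType F) (f : U' -> W') : linear f ->
  exists g : 'Hom(U', W'), forall x, g x = f x.
Proof.
move=> lf; pose g : {linear U' -> W'} :=
  HB.pack f (GRing.isLinear.Build _ _ _ _ f lf).
by exists (linfun g) => x; rewrite lfunE.
Qed.

Definition lpow T i : 'End(V) := iter i (comp_lfun T) \1%VF.

Lemma lpowE T k v : lpow T k v = iter k T v.
Proof.
by elim: k v => [|k IHk] v /=; [rewrite lfunE|rewrite comp_lfunE IHk].
Qed.

Definition papp T p : 'End(V) := \sum_(i < size p) p`_i *: lpow T i.

Lemma papp_wide T p k : (size p <= k)%N ->
  papp T p = \sum_(i < k) p`_i *: lpow T i.
Proof.
move=> pk; rewrite [LHS](big_ord_widen k (fun i => p`_i *: lpow T i) pk) big_mkcond.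
by apply: eq_bigr => i _; case: ltnP => // ip; rewrite nth_default// scale0r.
Qed.

Lemma pappD T p q : papp T (p + q) = papp T p + papp T q.
Proof.
pose k := maxn (size p) (size q).
rewrite !(@papp_wide _ _ k) ?leq_maxl ?leq_maxr ?size_polyD//.
by rewrite -big_split; apply: eq_bigr => i _; rewrite coefD scalerDl.
Qed.

Lemma pappZ T c p : papp T (c *: p) = c *: papp T p.
Proof.
rewrite !(@papp_wide _ _ (size p)) ?size_scale_leq// scaler_sumr.
by apply: eq_bigr => i _; rewrite coefZ scalerA.
Qed.

Lemma pappB T p q : papp T (p - q) = papp T p - papp T q.
Proof. by rewrite pappD -scaleN1r pappZ scaleN1r. Qed.

Lemma papp0 T : papp T 0 = 0.
Proof. by rewrite /papp size_poly0 big_ord0. Qed.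

Lemma pappC T c : papp T c%:P = c *: \1%VF.
Proof.
by rewrite (papp_wide _ (size_polyC_leq1 c)) big_ord1 coefC.
Qed.

Lemma papp1 T : papp T 1 = \1%VF.
Proof. by rewrite pappC scale1r. Qed.

Lemma pappMX T p : papp T (p * 'X) = (T \o papp T p)%VF.
Proof.
rewrite (@papp_wide _ _ (size p).+1) ?(leq_trans (size_polyMleq _ _))//; last first.
  by rewrite size_polyX addn2.
rewrite big_ord_recl coefMX eqxx scale0r add0r /papp.
apply/lfunP => v; rewrite comp_lfunE !sum_lfunE linear_sum.
by apply: eq_bigr => i _; rewrite coefMX /= !scale_lfunE linearZ /= comp_lfunE.
Qed.

Lemma pappM T p q v : papp T (p * q) v = papp T p (papp T q v).
Proof.
elim/poly_ind: p v => [|p c IHp] v.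
  by rewrite mul0r papp0 !lfunE.
have TC r w : papp T r (T w) = T (papp T r w).
  rewrite /papp !sum_lfunE linear_sum; apply: eq_bigr => i _.
  rewrite !scale_lfunE linearZ; congr (_ *: _).
  elim: (nat_of_ord i) => [|k IHk] /=; first by rewrite !lfunE.
  by rewrite !comp_lfunE IHk.
rewrite mulrDl !pappD !add_lfunE [p * 'X * q]mulrAC [papp T (p * q * 'X)]pappMX.
rewrite comp_lfunE IHp [papp T (p * 'X)]pappMX comp_lfunE.
by rewrite mul_polyC pappZ pappC !scale_lfunE lfunE.
Qed.

Lemma papp_XsubC T c v : papp T ('X - c%:P) v = T v - c *: v.
Proof.
rewrite pappB -['X]mul1r pappMX papp1 pappC.
by rewrite comp_lfun1r !lfun_simp.
Qed.

Lemma papp_dvdp T p q v : p %| q -> papp T p v = 0 -> papp T q v = 0.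
Proof. by move=> /dvdpP[r ->] pv; rewrite pappM pv linear0. Qed.

Lemma papp_stable T U p : (forall u, u \in U -> T u \in U) ->
  forall u, u \in U -> papp T p u \in U.
Proof.
move=> TU u uU; rewrite /papp sum_lfunE; apply: memv_suml => i _.
rewrite scale_lfunE memvZ//; elim: (nat_of_ord i) => [|k IHk] /=.
  by rewrite lfunE.
by rewrite comp_lfunE TU.
Qed.

Lemma papp_eigen_mod T W p c v : (forall w, w \in W -> T w \in W) ->
  T v - c *: v \in W -> papp T p v - p.[c] *: v \in W.
Proof.
move=> TW Tv; have /factor_theorem[r rE] : root (p - p.[c]%:P) c.
  by rewrite /root !hornerE subrr.
have : papp T (p - p.[c]%:P) v \in W.
  by rewrite rE pappM papp_XsubC; exact: papp_stable.
by rewrite pappB pappC !lfun_simp.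
Qed.

Lemma papp_eigenvalue T W p c v : (forall w, w \in W -> T w \in W) ->
  papp T p = 0 -> v \notin W -> T v - c *: v \in W -> root p c.
Proof.
move=> TW p0 vW /(papp_eigen_mod p TW); rewrite p0 lfunE /= sub0r memvN.
apply: contraLR => pc; apply: contra vW => /(memvZ p.[c]^-1).
by rewrite scalerA mulVf// scale1r.
Qed.

(** Apply the factors to [v] one at a time: the last vector before entering [W] is an eigenvector
    modulo [W]. *)
Lemma relative_eigenvector_prod T U W (rs : seq F) v :
  (forall u, u \in U -> T u \in U) -> v \in U -> v \notin W ->
  papp T (\prod_(r <- rs) ('X - r%:P)) v \in W ->
  exists c w, [/\ w \in U, w \notin W & T w - c *: w \in W].
Proof.
move=> TU; elim: rs v => [|r rs IHrs] v vU vW.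
  by rewrite big_nil papp1 lfunE /= (negPf vW).
rewrite big_cons mulrC pappM papp_XsubC => vP.
case: (boolP (T v - r *: v \in W)) => [TvW|TvW]; first by exists r, v.
by apply: (IHrs (T v - r *: v)) => //; rewrite memvB ?TU ?memvZ.
Qed.

(* [U'] is an invariant subspace not contained in [W], of minimal dimension.  *)
Lemma commuting_eigenvector (Ops : 'End(V) -> Prop) U W :
  (forall T, Ops T -> exists rs : seq F, papp T (\prod_(r <- rs) ('X - r%:P)) = 0) ->
  (forall T u, Ops T -> u \in U -> T u \in U) ->
  (forall T w, Ops T -> w \in W -> T w \in W) ->
  (forall S T u, Ops S -> Ops T -> u \in U -> S (T u) - T (S u) \in W) ->
  (W <= U)%VS -> ~~ (U <= W)%VS ->
  exists U' : {vspace V}, [/\ (W <= U' <= U)%VS, ~~ (U' <= W)%VS &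
    forall T, Ops T -> exists c, forall u, u \in U' -> T u - c *: u \in W].
Proof.
move=> Osplit OU OW Oc WU UW.
pose ok k := `[< exists X : {vspace V}, [/\ (W <= X <= U)%VS, ~~ (X <= W)%VS,
   forall T u, Ops T -> u \in X -> T u \in X & \dim X = k] >].
have okU : exists k, ok k.
  by exists (\dim U); apply/asboolP; exists U; rewrite WU subvv.
case: (ex_minnP okU) => k /asboolP[X [/andP[WX XU] XW OX dX]] kmin.
exists X; split; rewrite ?WX// => T OT.
have [v vX vW] : exists2 v, v \in X & v \notin W by exact/subvPn.
have [rs rs0] := Osplit T OT.
have [||c [w [wX wW Tw]]] := @relative_eigenvector_prod T X W rs v _ vX vW.
- by move=> u; exact: OX.
- by rewrite rs0 lfunE mem0v.
(* The eigenspace of [T] modulo [W] is stable under all operators, since they commute modulo [W];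
   minimality of [X] makes it all of [X]. *)
have [Y YE] : exists Y : {vspace V}, forall u, u \in Y <-> u \in X /\ T u - c
  *: u \in W.
  apply: vspace_comprehension => [|a u u' [uX uW] [u'X u'W]].
    by rewrite !mem0v linear0 scaler0 subr0 mem0v.
  split; first by rewrite memvD ?memvZ.
  rewrite linearP scalerDr opprD addrACA scalerA mulrC -scalerA -scalerBr.
  by rewrite memvD ?memvZ.
exists c => u uX.
have YX : (Y <= X)%VS by apply/subvP => y /YE[].
have dYX : (\dim X <= \dim Y)%N.
  rewrite dX; apply: kmin; apply/asboolP; exists Y; split => //.
  - rewrite (subv_trans YX XU) andbT; apply/subvP => y yW; apply/YE.
    by rewrite (subvP WX)// memvB ?memvZ// OW.
  - by apply/subvPn; exists w => //; apply/YE.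
  - move=> S y OS /YE[yX yW]; apply/YE; split; first exact: OX.
    have -> : T (S y) - c *: S y = (T (S y) - S (T y)) + S (T y - c *: y).
      by rewrite [S (_ - _)]linearB /= [S (c *: y)]linearZ /= addrA subrK.
    by rewrite memvD// ?OW// Oc// (subvP XU).
have /eqP YXE : Y == X by rewrite eqEdim YX.
by move: uX; rewrite -YXE => /YE[].
Qed.

End LinearTools.

Section Trace.
Variable F : fieldType.

Lemma mxof_id_comp (V W : vectType F) (f : 'Hom(V, W)) (g : 'Hom(W, V)) :
  lftrace (g \o f)%VF = lftrace (f \o g)%VF.
Proof.
rewrite /lftrace (mxof_comp _ (f := vbasis {:W})) ?vbasisP//.
rewrite (mxof_comp _ (f := vbasis {:V})) ?vbasisP//.
exact: mxtrace_mulC.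
Qed.

Lemma lftraceP (V : vectType F) : linear (fun f : 'End(V) => lftrace f : F^o).
Proof. by move=> a f g /=; rewrite /lftrace mxof_linear mxtraceD mxtraceZ. Qed.

End Trace.

Section Spectrum.
Variable F : numClosedFieldType.
Variable V : vectType F.
Implicit Types T : 'End(V).

Lemma lftrace_papp T : exists rs : seq F,
  [/\ forall p, lftrace (papp T p) = \sum_(r <- rs) p.[r],
    papp T (\prod_(r <- rs) ('X - r%:P)) = 0 &
    forall q, papp T q = 0 -> all (root q) rs].
Proof.
pose e := vbasis {:V}; have be : basis_of {:V} e := vbasisP _.
have fe := basis_free be.
pose A := mxof e e T.
have Tk k : mxof e e (lpow T k) = A ^+ k.
  elim: k => [|k IHk]; first by rewrite expr0 mxof1.
  by rewrite exprSr -IHk /= (mxof_comp e e be).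
have mxp q : mxof e e (papp T q) = \sum_(i < size q) q`_i *: A ^+ i.
  by rewrite /papp linear_sum /=; apply: eq_bigr => i _; rewrite linearZ /= Tk.
have [rs [trA A0 Aroot]] := mxtrace_exp_spectrum A; exists rs; split; last first.
- by move=> q q0; apply: Aroot; rewrite -mxp q0 linear0.
- by apply/eqP; rewrite -(mxof_eq0 be be) mxp; apply/eqP.
- move=> p; rewrite /lftrace /papp !linear_sum /=.
  under eq_bigr do rewrite linearZ linearZ /= Tk trA mulr_sumr.
  rewrite exchange_big /=; apply: eq_bigr => r _.
  by rewrite horner_coef.
Qed.

Lemma split_annihilator T : exists rs : seq F,
  papp T (\prod_(r <- rs) ('X - r%:P)) = 0.
Proof. by have [rs [_ rs0 _]] := lftrace_papp T; exists rs. Qed.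

Definition nilpotent T := exists k, lpow T k = 0.

Lemma lpow_papp T k : lpow T k = papp T 'X^k.
Proof.
elim: k => [|k IHk]; first by rewrite expr0 papp1.
by rewrite exprSr pappMX /= IHk.
Qed.

Lemma lftrace_nilpotent T : nilpotent T -> lftrace T = 0.
Proof.
case=> k; rewrite lpow_papp => Tk0.
have [rs [trT _ /(_ _ Tk0)/allP rootk]] := lftrace_papp T.
have <- : papp T 'X = T by rewrite -['X]mul1r pappMX papp1 comp_lfun1r.
rewrite trT big_seq big1// => r /rootk; rewrite /root hornerXn hornerX.
by rewrite expf_eq0 => /andP[_ /eqP].
Qed.

End Spectrum.

(** * Lie algebras and the Killing form *)

Section GeneralizedEigenspaces.
Variables (F : fieldType) (V : vectType F).
Implicit Types (T : 'End(V)) (L : seq F).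

Lemma coprimep_XsubC_prod (a : F) N k L : a \notin L ->
  coprimep (('X - a%:P) ^+ k) (\prod_(r <- L) ('X - r%:P) ^+ N).
Proof.
move=> aL; apply: coprimep_expl; rewrite coprimep_sym coprimep_XsubC /root.
rewrite horner_prod prodf_seq_neq0; apply/allP => r rL; apply/implyP => _.
rewrite !hornerE expf_neq0// subr_eq0.
by apply: contra aL => /eqP ->.
Qed.

Lemma chinese_remainder_roots (g : F -> F) N L : uniq L -> exists q : {poly F},
  forall r, r \in L -> ('X - r%:P) ^+ N %| q - (g r)%:P.
Proof.
elim: L => [|a L IHL] /=; first by exists 0.
case/andP=> aL /IHL[q qL]; set P := \prod_(r <- L) ('X - r%:P) ^+ N.
have /Bezout_eq1_coprimepP[[u v] /= uv] : coprimep (('X - a%:P) ^+ N) P.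
  exact: coprimep_XsubC_prod.
exists (q + v * P * ((g a)%:P - q)) => r; rewrite inE => /orP[/eqP ->|rL].
  have -> : q + v * P * ((g a)%:P - q) - (g a)%:P =
      (q - (g a)%:P) * (1 - v * P) by ring.
  by rewrite -uv addrK dvdp_mull// dvdp_mull.
have rP : ('X - r%:P) ^+ N %| P by rewrite /P (big_rem r)//= dvdp_mulr.
by rewrite addrAC dvdp_add ?qL// -mulrA dvdp_mull// dvdp_mulr.
Qed.

Lemma generalized_decomposition T N L v : uniq L ->
  papp T (\prod_(r <- L) ('X - r%:P) ^+ N) v = 0 ->
  exists f : F -> V, v = \sum_(r <- L) f r /\
    forall r, r \in L -> papp T (('X - r%:P) ^+ N) (f r) = 0.
Proof.
elim: L v => [|a L IHL] v /=.
  by rewrite big_nil papp1 lfunE /= => _ ->; exists (fun=> 0); rewrite big_nil.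
case/andP=> aL uL; rewrite big_cons; set P := \prod_(r <- L) _ => vP.
have /Bezout_eq1_coprimepP[[x y] /= xy] : coprimep (('X - a%:P) ^+ N) P.
  exact: coprimep_XsubC_prod.
have [|f [fE f0]] := IHL (papp T (x * ('X - a%:P) ^+ N) v) uL.
  by rewrite -/P -pappM mulrCA [P * _]mulrC pappM vP linear0.
exists (fun r => if r == a then papp T (y * P) v else f r); split.
  rewrite big_cons eqxx (eq_big_seq f) => [|r rL]; last first.
    by case: eqP => // ra; rewrite ra (negPf aL) in rL.
  by rewrite -fE -add_lfunE -pappD addrC xy papp1 lfunE.
move=> r; rewrite inE; case: eqP => [-> _|_ /= rL]; last exact: f0.
by rewrite -pappM mulrCA pappM vP linear0.
Qed.

Lemma papp_coprime_eq0 T p q v : coprimep p q ->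
  papp T p v = 0 -> papp T q v = 0 -> v = 0.
Proof.
move=> /Bezout_eq1_coprimepP[[x y] /= xy] pv qv.
have : papp T 1 v = v by rewrite papp1 lfunE.
by rewrite -xy pappD add_lfunE !pappM pv qv !linear0 addr0.
Qed.

End GeneralizedEigenspaces.

Section LieAlgebra.
Variables (F : numClosedFieldType) (V : vectType F) (ad : V -> 'End(V)).
Hypothesis ad_linear : forall a x y, ad (a *: x + y) = a *: ad x + ad y.
Hypothesis adxx : forall x, ad x x = 0.
Hypothesis ad_jacobi : forall x y, ad (ad x y) = (ad x \o ad y)%VF - (ad y \o ad x)%VF.
Implicit Types (x y z : V) (s m U W : {vspace V}) (D T : 'End(V)).

Lemma ad0 : ad 0 = 0.
Proof.
by have := ad_linear (-1) 0 0; rewrite !scaleN1r !addNr.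
Qed.

Lemma adD x y : ad (x + y) = ad x + ad y.
Proof. by rewrite -[x]scale1r ad_linear !scale1r. Qed.

Lemma adZ a x : ad (a *: x) = a *: ad x.
Proof. by rewrite -[a *: x]addr0 ad_linear ad0 addr0. Qed.

Lemma adB x y : ad (x - y) = ad x - ad y.
Proof. by rewrite -scaleN1r adD adZ scaleN1r. Qed.

Lemma ad_sum (I : Type) (r : seq I) (f : I -> V) :
  ad (\sum_(i <- r) f i) = \sum_(i <- r) ad (f i).
Proof. by elim/big_rec2: _ => [|i x y _ <-]; rewrite ?ad0 ?adD. Qed.

Lemma adC x y : ad x y = - ad y x.
Proof.
apply/eqP; rewrite -addr_eq0; apply/eqP.
have := adxx (x + y); rewrite adD add_lfunE !linearD /= !adxx.
by rewrite add0r addr0 addrC.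
Qed.

Lemma adJ x y z : ad (ad x y) z = ad x (ad y z) - ad y (ad x z).
Proof. by rewrite ad_jacobi add_lfunE opp_lfunE !comp_lfunE. Qed.

Lemma ad_adjoin x y z a b :
  ad (x + a *: z) (y + b *: z) = ad x y + (b *: ad x z - a *: ad y z).
Proof.
rewrite adD adZ add_lfunE scale_lfunE [ad x _]linearD [ad z _]linearD /=.
rewrite [ad x (b *: z)]linearZ [ad z (b *: z)]linearZ /= adxx scaler0 addr0.
by rewrite (adC z y) scalerN addrA.
Qed.

Definition derivation D := forall x y, D (ad x y) = ad (D x) y + ad x (D y).

Lemma derivation_ad x : derivation (ad x).
Proof. by move=> y z; rewrite adJ subrK. Qed.

(** By the Leibniz rule, D - (a + b) acts on a bracket as D - a on the first factor plus D - b on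
    the second; induction on the total exponent concludes. *)
Lemma generalized_bracket D a b i j x y : derivation D ->
  papp D (('X - a%:P) ^+ i) x = 0 -> papp D (('X - b%:P) ^+ j) y = 0 ->
  papp D (('X - (a + b)%:P) ^+ (i + j)) (ad x y) = 0.
Proof.
move=> Dd; have [k] := ubnP (i + j)%N; elim: k i j x y => // k IHk i j x y ijk.
case: i ijk => [|i] ijk.
  by rewrite expr0 papp1 lfunE /= => -> _; rewrite ad0 lfunE linear0.
case: j ijk => [|j] ijk.
  by rewrite expr0 papp1 lfunE /= => _ ->; rewrite !linear0.
move=> xi yj; rewrite addnS exprSr pappM papp_XsubC.
have -> : D (ad x y) - (a + b) *: ad x y =
    ad (D x - a *: x) y + ad x (D y - b *: y).
  rewrite Dd adB adZ !lfun_simp [ad x (_ - _)]linearB /= [ad x (b *: y)]linearZ /=.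
  by rewrite scalerDl opprD addrACA.
have e1 : papp D (('X - (a + b)%:P) ^+ (i + j.+1)) (ad (D x - a *: x) y) = 0.
  apply: (IHk) => //.
  by rewrite -papp_XsubC -pappM -exprSr.
have e2 : papp D (('X - (a + b)%:P) ^+ (i.+1 + j)) (ad x (D y - b *: y)) = 0.
  apply: (IHk) => //; first by move: ijk; rewrite addnS ltnS.
  by rewrite -papp_XsubC -pappM -exprSr.
by rewrite linearD /= e2 addSnnS e1 addr0.
Qed.

(* Dunford's semisimple part with conjugated eigenvalues: a polynomial in [D] *)
(* acting by the conjugate of [r] on the generalized eigenspace of [r].       *)
Lemma conjugate_derivation D : derivation D -> exists q : {poly F},
  [/\ 'X %| q, derivation (papp D q) &
      lftrace (D \o papp D q)%VF = 0 -> nilpotent D].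
Proof.
move=> Dd; have [rs [trD rs0 _]] := lftrace_papp D.
(* Including 0 makes [q] divisible by ['X]. The congruences are taken modulo powers [N + N] because
   the bracket of two vectors killed by N-th powers is killed by such a power only. *)
pose L := undup (0 :: rs); pose N := (size rs).+1.
have uL : uniq L := undup_uniq _.
have [q qL] := chinese_remainder_roots (fun r => r^*) (N + N) uL.
have kill v : papp D (\prod_(r <- L) ('X - r%:P) ^+ N) v = 0.
  apply: (papp_dvdp (p := \prod_(r <- rs) ('X - r%:P))); last by rewrite rs0 lfunE.
  rewrite prodrXl /N exprS dvdp_mull//.
  have : {subset rs <= L} by move=> r rrs; rewrite mem_undup inE rrs orbT.
  elim: (rs) => [|r t IHt] tL /=; first by rewrite big_nil dvd1p.
  rewrite big_cons exprS dvdp_mul ?IHt//.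
    by rewrite (big_rem r) ?tL ?mem_head//= dvdp_mulr.
  by move=> r' r't; rewrite tL// inE r't orbT.
have eig r v : r \in L -> papp D (('X - r%:P) ^+ (N + N)) v = 0 ->
    papp D q v = r^* *: v.
  move=> rL /(papp_dvdp (qL r rL)); rewrite pappB pappC !lfun_simp.
  by move/subr0_eq.
have weak r v k : papp D (('X - r%:P) ^+ k) v = 0 -> (k <= N + N)%N ->
    papp D (('X - r%:P) ^+ (N + N)) v = 0.
  by move=> v0 kN; apply: papp_dvdp v0; rewrite dvdp_exp2l.
exists q; split.
- have /qL : 0 \in L by rewrite mem_undup mem_head.
  rewrite conjC0 subr0 subr0; apply: dvdp_trans.
  by rewrite -{1}['X]expr1 dvdp_exp2l.
- have hom a b u w : a \in L -> b \in L -> papp D (('X - a%:P) ^+ N) u = 0 ->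
      papp D (('X - b%:P) ^+ N) w = 0 ->
      papp D q (ad u w) = ad (papp D q u) w + ad u (papp D q w).
    move=> aL bL u0 w0.
    rewrite (eig a u) ?(weak _ _ _ u0) ?leq_addr//.
    rewrite (eig b w) ?(weak _ _ _ w0) ?leq_addr//.
    rewrite adZ scale_lfunE linearZ -scalerDl -rmorphD.
    have uw0 := generalized_bracket Dd u0 w0.
    (* If [a + b] is not in the list, the bracket is killed by two coprime polynomials and
       vanishes. *)
    have [abL|abL] := boolP (a + b \in L); first exact: eig.
    have -> : ad u w = 0.
      by apply: papp_coprime_eq0 uw0 (kill _); exact: coprimep_XsubC_prod.
    by rewrite linear0 scaler0.
  have hom1 a u w : a \in L -> papp D (('X - a%:P) ^+ N) u = 0 ->
      papp D q (ad u w) = ad (papp D q u) w + ad u (papp D q w).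
    move=> aL u0; have [h [-> h0]] := generalized_decomposition uL (kill w).
    rewrite !linear_sum /= -big_split; apply: eq_big_seq => b bL.
    exact: (hom a b) (h0 b bL).
  move=> x y; have [f [-> f0]] := generalized_decomposition uL (kill x).
  move: (papp D q) hom1 => Q hom1.
  rewrite ad_sum sum_lfunE [Q (\sum_(r <- L) f r)]linear_sum ad_sum.
  rewrite !sum_lfunE linear_sum /= -big_split; apply: eq_big_seq => a aL.
  exact: (hom1 a) (f0 a aL).
(* The trace of D q(D) is the sum of the squared moduli of the eigenvalues, so it vanishes only if
   all of them do. *)
- have qr r : r \in rs -> q.[r] = r^*.
    move=> rrs; have /qL : r \in L by rewrite mem_undup inE rrs orbT.
    have d1 : 'X - r%:P %| ('X - r%:P) ^+ (N + N).
      by rewrite -{1}['X - _]expr1 dvdp_exp2l.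
    move=> /(dvdp_trans d1); rewrite dvdp_XsubCl /root !hornerE subr_eq0.
    by move=> /eqP.
  rewrite -pappMX trD big_seq => /eqP.
  rewrite psumr_eq0 => [/allP r0|r rrs]; last first.
    by rewrite hornerMX qr// mulrC mul_conjC_ge0.
  have rsE : \prod_(r <- rs) ('X - r%:P) = 'X^(size rs).
    have : forall r, r \in rs -> r = 0.
      move=> r rrs; have := r0 r rrs; rewrite rrs hornerMX qr//.
      by rewrite mulrC mul_conjC_eq0 => /eqP.
    elim: (rs) => [|r t IHt] t0 /=; first by rewrite big_nil expr0.
    rewrite big_cons (t0 r) ?mem_head// subr0 IHt ?exprS// => r' r't.
    by apply: t0; rewrite inE r't orbT.
  by exists (size rs); rewrite lpow_papp -rsE.
Qed.

Definition stable s U := forall x u, x \in s -> u \in U -> ad x u \in U.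

Definition derived s s' := (forall x y, x \in s -> y \in s -> ad x y \in s') /\
  forall U, (forall x y, x \in s -> y \in s -> ad x y \in U) -> (s' <= U)%VS.

Lemma derived_exists s : exists s', derived s s'.
Proof.
have [s' s'E] : exists s' : {vspace V}, forall v, v \in s' <-> forall U : {vspace V},
    (forall x y, x \in s -> y \in s -> ad x y \in U) -> v \in U.
  apply: vspace_comprehension => [U _|a u v uP vP U UP]; first exact: mem0v.
  by rewrite memvD ?memvZ ?uP ?vP.
exists s'; split; first by move=> x y xs ys; apply/s'E => U; exact.
by move=> U UP; apply/subvP => v /s'E; exact.
Qed.

Lemma subset_comprehension s U W :
  exists X : {vspace V}, forall u, u \in X <-> u \in U /\ forall x, x \in s ->
    ad x u \in W.
Proof.
apply: vspace_comprehension => [|a u v [uU uW] [vU vW]].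
  by split => [|x _]; rewrite ?linear0 mem0v.
split=> [|x xs]; first by rewrite memvD ?memvZ.
by rewrite linearP memvD ?memvZ ?uW ?vW.
Qed.

(** Engel's theorem on U / W. Let m' be a maximal proper subalgebra. Induction for m' acting on m /
    m' gives a [z] normalizing m', and m is spanned by m' and [z] by maximality. Induction on U / W
    gives a [v] killed by m', and its last iterate under [ad z] outside [W] is killed by all of
    m. *)
Lemma engel m U W : stable m m -> (forall x, x \in m -> nilpotent (ad x)) ->
  stable m U -> stable m W -> (W <= U)%VS -> ~~ (U <= W)%VS ->
  exists v, [/\ v \in U, v \notin W & forall x, x \in m -> ad x v \in W].
Proof.
have [k] := ubnP (\dim m); elim: k m U W => // k IHk m U W mk mm nil mU mW WU UW.
have [/eqP m0|m0] := boolP (m == 0%VS).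
  have [v vU vW] := subvPn UW; exists v; split => // x.
  by rewrite m0 memv0 => /eqP ->; rewrite ad0 lfunE mem0v.
pose ok d := `[< exists m' : {vspace V}, [/\ (m' <= m)%VS, ~~ (m <= m')%VS,
  stable m' m' & \dim m' = d] >].
have ok0 : exists d, ok d.
  exists 0%N; apply/asboolP; exists 0%VS; split; rewrite ?sub0v ?dimv0//.
    by rewrite subv0.
  by move=> x u; rewrite !memv0 => /eqP -> _; rewrite ad0 lfunE.
have okb d : ok d -> (d <= \dim m)%N by move=> /asboolP[m' [m'm _ _ <-]]; exact: dimvS.
case: (ex_maxnP ok0 okb) => d /asboolP[m' [m'm mm' m'm' dm']] dmax.
have m'k : (\dim m' < k)%N.
  rewrite -ltnS (leq_trans _ mk)// !ltnS ltn_neqAle dimvS// andbT.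
  by apply: contra mm' => /eqP e; rewrite -(eqP (_ : m' == m)) // eqEdim m'm e leqnn.
have nil' x : x \in m' -> nilpotent (ad x) by move=> /(subvP m'm); exact: nil.
have [|z [zm zm' m'z]] := IHk m' m m' m'k m'm' nil' _ m'm' m'm mm'.
  by move=> x u /(subvP m'm); exact: mm.
have mE : (m <= m' + <[z]>)%VS.
  apply: contrapT => /negP mz.
  have : (\dim (m' + <[z]>) <= d)%N.
    apply: dmax; apply/asboolP; exists (m' + <[z]>)%VS; split => //.
      by rewrite subv_add m'm -memvE.
    move=> _ _ /memv_addP[x xm' [_ /vlineP[a ->] ->]] /memv_addP[y ym' [_
      /vlineP[b ->] ->]].
    apply: (subvP (addvSl m' <[z]>)).
    by rewrite ad_adjoin memvD ?m'm'// memvB ?memvZ ?m'z.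
  rewrite -dm' => dle; have /eqP e : m' == (m' + <[z]>)%VS by rewrite eqEdim addvSl dle.
  by move: zm'; rewrite e memvE addvSr.
have [||v [vU vW m'v]] := IHk m' U W m'k m'm' nil' _ _ WU UW.
- by move=> x u /(subvP m'm); exact: mU.
- by move=> x u /(subvP m'm); exact: mW.
(* Iterate [ad z] on [v] until it enters [W]. *)
have iterP j : iter j (ad z) v \in U /\ forall x, x \in m' ->
  ad x (iter j (ad z) v) \in W.
  elim: j => [//|j [IH1 IH2]]; split; first exact: mU.
  move=> x xm' /=; have -> : ad x (ad z (iter j (ad z) v)) =
      ad (ad x z) (iter j (ad z) v) + ad z (ad x (iter j (ad z) v)).
    by rewrite adJ subrK.
  by rewrite memvD ?IH2 ?m'z// mW ?IH2.
have [j0 zj0] : exists j, iter j (ad z) v \in W.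
  by have [j zj] := nil z zm; exists j; rewrite -lpowE zj lfunE mem0v.
case: (ex_minnP (ex_intro (fun j => iter j (ad z) v \in W) j0 zj0)) => -[|j] jW jmin.
  by rewrite (negPf vW) in jW.
exists (iter j (ad z) v); have [jU jm'] := iterP j; split => //.
  by apply/negP => /jmin; rewrite ltnn.
move=> x /(subvP mE)/memv_addP[y ym' [_ /vlineP[a ->] ->]].
by rewrite adD adZ !lfun_simp; apply: memvD; [exact: jm'|exact: memvZ].
Qed.

(** Lie's theorem on U / W for an algebra whose derived algebra acts nilpotently. By Engel, the
    vectors killed by s' modulo [W] are not all in [W]; they form an s-stable subspace, on which s
    acts by operators commuting modulo [W]. *)
Lemma weight_space s s' U W : stable s s -> derived s s' ->
  (forall x, x \in s' -> nilpotent (ad x)) ->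
  stable s U -> stable s W -> (W <= U)%VS -> ~~ (U <= W)%VS ->
  exists U', [/\ (W <= U' <= U)%VS, ~~ (U' <= W)%VS &
    forall x, x \in s -> exists c, forall u, u \in U' -> ad x u - c *: u \in W].
Proof.
move=> ss [ss' s'min] nil sU sW WU UW.
have s's : (s' <= s)%VS by apply: s'min.
have s's' : stable s' s'.
  by move=> x y /(subvP s's) xs /(subvP s's) ys; exact: ss'.
have [||v [vU vW s'v]] := engel s's' nil _ _ WU UW.
- by move=> x u /(subvP s's); exact: sU.
- by move=> x u /(subvP s's); exact: sW.
have [X XE] := subset_comprehension s' U W.
have WX : (W <= X)%VS.
  apply/subvP => w wW; apply/XE; split; first exact: (subvP WU).
  by move=> x /(subvP s's) xs; exact: sW.
have XU : (X <= U)%VS by apply/subvP => u /XE[].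
have sX : stable s X.
  move=> x u xs /XE[uU uW]; apply/XE; split; first exact: sU.
  move=> y ys'; have -> : ad y (ad x u) = ad (ad y x) u + ad x (ad y u).
    by rewrite adJ subrK.
  rewrite memvD//; last by apply: sW => //; exact: uW.
  by apply: uW; apply: ss' => //; exact: (subvP s's).
have [|||||U' [/andP[WU' U'X] U'W U'c]] := @commuting_eigenvector _ _
  (fun T => exists2 x, x \in s & T = ad x) X W _ _ _ _ WX.
- by move=> T _; exact: split_annihilator.
- by move=> _ u [x xs ->]; exact: sX.
- by move=> _ u [x xs ->]; exact: sW.
- move=> _ _ u [x xs ->] [y ys ->] uX; rewrite -adJ.
  by have [_] := (XE u).1 uX; apply; exact: ss'.
- by apply/subvPn; exists v => //; apply/XE.
exists U'; split => //; first by rewrite WU' (subv_trans U'X).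
by move=> x xs; apply: U'c; exists x.
Qed.

Definition kappa x y := lftrace (ad x \o ad y)%VF.

Lemma lftraceD (f g : 'End(V)) : lftrace (f + g) = lftrace f + lftrace g.
Proof. by rewrite -[f]scale1r [LHS](@lftraceP F V) !scale1r. Qed.

Lemma lftraceZ a (f : 'End(V)) : lftrace (a *: f) = a * lftrace f.
Proof.
rewrite -[a *: f]addr0 [LHS](@lftraceP F V); set z := lftrace 0.
suff -> : z = 0 by rewrite addr0.
by apply: (addrI z); rewrite /z -lftraceD !addr0.
Qed.

Lemma lftraceB (f g : 'End(V)) : lftrace (f - g) = lftrace f - lftrace g.
Proof. by rewrite -scaleN1r lftraceD lftraceZ mulN1r. Qed.

Lemma comp_lfunBl (f g h : 'End(V)) : ((f - g) \o h = (f \o h) - (g \o h))%VF.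
Proof. by apply/lfunP => v; rewrite !lfun_simp. Qed.

Lemma comp_lfunBr (f g h : 'End(V)) : (h \o (f - g) = (h \o f) - (h \o g))%VF.
Proof. by apply/lfunP => v; rewrite !lfun_simp linearB. Qed.

Lemma kappaC x y : kappa x y = kappa y x.
Proof. exact: mxof_id_comp. Qed.

Lemma kappa_linear a x y z : kappa (a *: x + y) z = a * kappa x z + kappa y z.
Proof.
by rewrite /kappa ad_linear comp_lfunDl -comp_lfunZl lftraceD lftraceZ.
Qed.

Lemma kappa_linearr a x y z : kappa z (a *: x + y) = a * kappa z x + kappa z y.
Proof. by rewrite kappaC kappa_linear !(kappaC z). Qed.

Lemma kappa_inv x y z : kappa (ad x y) z = kappa x (ad y z).
Proof.
rewrite /kappa !ad_jacobi comp_lfunBl comp_lfunBr !lftraceB !comp_lfunA.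
congr (_ - _); rewrite -!comp_lfunA.
by rewrite (mxof_id_comp (ad x \o ad z)%VF (ad y)) -comp_lfunA.
Qed.

(** Let D be the conjugate derivation of [ad y]; it suffices that tr (ad y D) = 0. As [y] is a
    combination of brackets [a, b], this follows from tr (ad [a, b] D) = - kappa a (D b), where D b
    lies in s' because [q] has no constant term. *)
Lemma cartan_criterion s s' : stable s s -> derived s s' ->
  (forall x y, x \in s -> y \in s' -> kappa x y = 0) ->
  forall y, y \in s' -> nilpotent (ad y).
Proof.
move=> ss [ss' s'min] k0 y ys'.
have s's : (s' <= s)%VS by apply: s'min.
have [q [/dvdpP[r qE] Dd]] := conjugate_derivation (derivation_ad y); apply.
set D := papp _ q in Dd *.
have Ds b : b \in s -> D b \in s'.
  move=> bs; rewrite /D qE pappMX comp_lfunE ss' ?(subvP s's y)//.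
  by apply: papp_stable => // u us; apply: ss => //; exact: (subvP s's).
have [Z ZE] : exists Z : {vspace V}, forall z, z \in Z <-> lftrace (ad z \o D)%VF = 0.
  apply: vspace_comprehension => [|a u v u0 v0].
    by rewrite ad0 comp_lfun0l -(scale0r (\1%VF : 'End(V))) lftraceZ mul0r.
  by rewrite ad_linear comp_lfunDl -comp_lfunZl lftraceD lftraceZ u0 v0 mulr0 addr0.
apply/ZE; apply: (subvP (s'min Z _)) => // a b as_ bs; apply/ZE.
have adD_ : ad (D b) = (D \o ad b)%VF - (ad b \o D)%VF.
  by apply/lfunP => v; rewrite add_lfunE opp_lfunE !comp_lfunE Dd addrK.
have <- : - kappa a (D b) = lftrace (ad (ad a b) \o D)%VF.
  rewrite /kappa adD_ ad_jacobi comp_lfunBr comp_lfunBl !lftraceB opprB.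
  rewrite !comp_lfunA; congr (_ - _); rewrite -!comp_lfunA.
  by rewrite [in RHS]mxof_id_comp -comp_lfunA.
by rewrite k0 ?oppr0// Ds.
Qed.

Section Nondegenerate.
Hypothesis kappa_nondeg : forall x, (forall y, kappa x y = 0) -> x = 0.

Lemma kappa_riesz (phi : 'Hom(V, F^o)) : exists w, forall y, kappa w y = phi y.
Proof.
have kw w : exists g : 'Hom(V, F^o), forall y, g y = kappa w y.
  by apply: linear_hom => a x y; rewrite kappa_linearr.
have [G GE] := choice kw.
have [Phi PhiE] : exists Phi : 'Hom(V, 'Hom(V, F^o)), forall w, Phi w = G w.
  apply: linear_hom => a x y; apply/lfunP => z.
  by rewrite !lfun_simp !GE kappa_linear.
have ker0 : lker Phi == 0%VS.
  rewrite -subv0; apply/subvP => w; rewrite memv_ker memv0 PhiE => /eqP w0.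
  by apply/eqP; apply: kappa_nondeg => y; rewrite -GE w0 lfunE.
have img : limg Phi = fullv.
  apply/eqP; rewrite eqEdim subvf limg_dim_eq ?(eqP ker0) ?capv0// !dimvf.
  by rewrite /dim /= muln1.
have : phi \in limg Phi by rewrite img memvf.
by case/memv_imgP => w _ ->; exists w => y; rewrite PhiE GE.
Qed.

(** Represent the form y -> tr (D ad y) by some kappa w. Then E = D - ad w satisfies tr (E ad y) = 0
    for all y, hence kappa (E x) y = tr (E ad [x, y]) = 0. *)
Lemma derivation_inner D : derivation D -> exists h, D = ad h.
Proof.
move=> Dd.
have [g gE] : exists g : 'Hom(V, F^o), forall y, g y = lftrace (D \o ad y)%VF.
  apply: linear_hom => a x y.
  by rewrite ad_linear comp_lfunDr -comp_lfunZr lftraceD lftraceZ.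
have [w wE] := kappa_riesz g.
exists w; apply/eqP; rewrite -subr_eq0; apply/eqP; set E := D - ad w.
have E0 y : lftrace (E \o ad y)%VF = 0.
  by rewrite comp_lfunBl lftraceB -gE -wE subrr.
have Ed x : ad (E x) = (E \o ad x)%VF - (ad x \o E)%VF.
  apply/lfunP => v; rewrite !(add_lfunE, opp_lfunE, comp_lfunE) linearB /=.
  rewrite Dd adB !(add_lfunE, opp_lfunE) adJ !opprB -!addrA; congr (_ + _).
  by rewrite [RHS]addrA [RHS]addrC subrKA.
apply/lfunP => x; rewrite [RHS]lfunE; apply: kappa_nondeg => y.
rewrite /kappa Ed comp_lfunBl lftraceB -(E0 (ad x y)) ad_jacobi comp_lfunBr lftraceB.
rewrite !comp_lfunA; congr (_ - _).
by rewrite -!comp_lfunA mxof_id_comp -comp_lfunA.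
Qed.

End Nondegenerate.
End LieAlgebra.

(** * Flags and the operators preserving or lowering them *)

Section Flags.
Variables (F : fieldType) (V : vectType F).
Implicit Types (T S : 'End(V)) (fl : nat -> {vspace V}).

(** Consecutive terms may coincide, since [e] may lie in [fl i]. *)
Definition flag fl d := [/\ fl 0%N = 0%VS, fl d = fullv &
  forall i, exists e, fl i.+1 = (fl i + <[e]>)%VS].

Definition flag_stable fl T := forall i u, u \in fl i -> T u \in fl i.
Definition flag_lower fl T := forall i u, u \in fl i.+1 -> T u \in fl i.

(** Adjoin repeatedly a common eigenvector modulo the last term. The dimension grows while the term
    is proper, so [\dim {:V}] steps suffice. *)
Lemma flag_exists (Ops : 'End(V) -> Prop) :
  (forall U W : {vspace V}, (forall T u, Ops T -> u \in U -> T u \in U) ->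
     (forall T w, Ops T -> w \in W -> T w \in W) ->
     (W <= U)%VS -> ~~ (U <= W)%VS ->
     exists v, [/\ v \in U, v \notin W &
       forall T, Ops T -> exists c, T v - c *: v \in W]) ->
  exists fl d, flag fl d /\ forall T, Ops T -> flag_stable fl T.
Proof.
move=> Oeig.
have next (W : {vspace V}) : exists e : V, (forall T w, Ops T -> w \in W ->
  T w \in W) ->
   (W != fullv -> e \notin W) /\
   forall T w, Ops T -> w \in (W + <[e]>)%VS -> T w \in (W + <[e]>)%VS.
  have [[OW WV]|noW] := pselect ((forall T w, Ops T -> w \in W -> T w \in W) /\
      W != fullv); last first.
    exists 0 => OW; have WV : W = fullv.
      by apply/eqP/negPn/negP => WV; apply: noW.
    split; first by rewrite WV eqxx.
    by rewrite WV addvC addvf => T w _ _; exact: memvf.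
  have [||||v [_ vW vT]] := Oeig fullv W.
  - by move=> *; exact: memvf.
  - exact: OW.
  - exact: subvf.
  - by apply: contra WV => VW; rewrite eqEsubv subvf.
  exists v => _; split => // T _ OT /memv_addP[w wW [_ /vlineP[a ->] ->]].
  have [c Tv] := vT T OT; rewrite linearD linearZ /=.
  rewrite memvD//; first by apply: (subvP (addvSl W <[v]>)); exact: OW.
  rewrite memvZ// -[T v](subrK (c *: v)) memv_add// memvZ// memv_line //.
have [e eP] := choice next.
pose fl := fix f i := if i is j.+1 then (f j + <[e (f j)]>)%VS else 0%VS.
have flO i : forall T w, Ops T -> w \in fl i -> T w \in fl i.
  elim: i => [|i IHi] T w OT; last by move=> wi; apply: (eP _ IHi).2.
  by rewrite /= !memv0 => /eqP ->; rewrite linear0.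
have dimfl i : fl i = fullv \/ (i <= \dim (fl i))%N.
  elim: i => [|i IHi]; first by right.
  have [fi|fi] := eqVneq (fl i) fullv; first by left; rewrite /= fi addvC addvf.
  case: IHi => [fi'|IHi]; first by rewrite fi' eqxx in fi.
  right; have ei := (eP _ (flO i)).1 fi.
  rewrite (leq_ltn_trans IHi)// ltnNge; apply: contra ei => dle.
  have /eqP fE : fl i == fl i.+1 by rewrite eqEdim /= addvSl.
  by rewrite memvE [X in (_ <= X)%VS]fE addvSr.
exists fl, (\dim {:V}); split; last by move=> T OT i u; exact: flO.
split => //; last by move=> i; exists (e (fl i)).
case: (dimfl (\dim {:V})) => // dle.
by apply/eqP; rewrite eqEdim subvf.
Qed.

Lemma flag_lower_nilpotent fl d T : flag fl d -> flag_lower fl T ->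
  exists k, lpow T k = 0.
Proof.
case=> f0 fd _ lowT; exists d; apply/lfunP => v; rewrite lpowE lfunE /=.
have : v \in fl d by rewrite fd memvf.
elim: d {fd} v => [|d IHd] v; first by rewrite f0 memv0 => /eqP.
by move=> /lowT /IHd; rewrite iterSr.
Qed.

(** Both operators act by scalars on each successive quotient, which has dimension at most one, and
    hence commute there. *)
Lemma flag_stable_comm fl d S T : flag fl d -> flag_stable fl S ->
  flag_stable fl T -> flag_lower fl ((S \o T) - (T \o S))%VF.
Proof.
case=> _ _ fle Sf Tf i u.
have [e fe] := fle i; rewrite fe => /memv_addP[w wi [_ /vlineP[a ->] ->]].
have ei : e \in fl i.+1 by rewrite fe memvE addvSr.
have := Sf _ _ ei; have := Tf _ _ ei; rewrite fe.
move=> /memv_addP[t ti [_ /vlineP[c ->] Te]] /memv_addP[s si [_ /vlineP[b ->] Se]].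
have TE : T (s + b *: e) = T s + b *: (t + c *: e) by rewrite linearD linearZ /= Te.
have SE : S (t + c *: e) = S t + c *: (s + b *: e) by rewrite linearD linearZ /= Se.
rewrite linearD linearZ /=; apply: memvD; last apply: memvZ;
  rewrite add_lfunE opp_lfunE !comp_lfunE.
  by apply: memvB; [apply/Sf/Tf|apply/Tf/Sf].
rewrite Te Se TE SE opprD addrACA; apply: memvD.
  by apply: memvB; [apply/Sf|apply/Tf].
rewrite !scalerDr !scalerA [b * c]mulrC opprD addrACA subrr addr0.
by rewrite memvB ?memvZ.
Qed.

Lemma flag_lower_comp fl d S T : flag fl d -> flag_stable fl S ->
  flag_lower fl T -> flag_lower fl (S \o T)%VF.
Proof. by move=> _ Sf Tl i u ui; rewrite comp_lfunE; apply/Sf/Tl. Qed.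

End Flags.

(** * Adjoints, traces and orthogonals for the Killing form *)

Section KillingForm.
Variables (F : numClosedFieldType) (V : vectType F) (ad : V -> 'End(V)).
Hypothesis ad_linear : forall a x y, ad (a *: x + y) = a *: ad x + ad y.
Hypothesis adxx : forall x, ad x x = 0.
Hypothesis ad_jacobi : forall x y, ad (ad x y) = (ad x \o ad y)%VF - (ad y \o ad x)%VF.
Local Notation kappa := (kappa ad).
Hypothesis kappa_nondeg : forall x, (forall y, kappa x y = 0) -> x = 0.
Implicit Types (x y z : V) (T S P : 'End(V)).

Lemma kappaDl x y z : kappa (x + y) z = kappa x z + kappa y z.
Proof. by rewrite -[x]scale1r (kappa_linear ad_linear) mul1r scale1r. Qed.

Lemma kappa0l y : kappa 0 y = 0.
Proof. by apply: (addrI (kappa 0 y)); rewrite -kappaDl !addr0. Qed.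

Lemma kappaZl a x y : kappa (a *: x) y = a * kappa x y.
Proof. by rewrite -[a *: x]addr0 (kappa_linear ad_linear) kappa0l addr0. Qed.

Lemma kappaBl x y z : kappa (x - y) z = kappa x z - kappa y z.
Proof. by rewrite kappaDl -scaleN1r kappaZl mulN1r. Qed.

Lemma kappa_suml (I : Type) (r : seq I) (c : I -> F) (f : I -> V) y :
  kappa (\sum_(i <- r) c i *: f i) y = \sum_(i <- r) c i * kappa (f i) y.
Proof.
elim: r => [|i r IHr]; rewrite ?big_nil ?big_cons ?kappa0l//.
by rewrite (kappa_linear ad_linear) IHr.
Qed.

(** With [K] the Gram matrix of a basis, adjointness reads A K = K B^T. As [K] is invertible, A is
    similar to the transpose of B. *)
Lemma lftrace_adjoint T S : (forall x y, kappa (T x) y = kappa x (S y)) ->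
  lftrace T = lftrace S.
Proof.
move=> TS; pose e := vbasis {:V}; have be : basis_of {:V} e := vbasisP _.
pose A := mxof e e T; pose B := mxof e e S.
pose K : 'M[F]_(\dim {:V}) := \matrix_(i, j) kappa e`_i e`_j.
have expand (f : 'End(V)) (i : 'I_(\dim {:V})) :
    f e`_i = \sum_j mxof e e f i j *: e`_j.
  rewrite -[LHS](rVofK be) (rVof_app e be) (rVofE be) -rowE /vecof.
  by apply: eq_bigr => j _; rewrite mxE.
have AK : A *m K = K *m B^T.
  apply/matrixP => i j; rewrite !mxE.
  transitivity (kappa (T e`_i) e`_j).
    by rewrite expand kappa_suml; apply: eq_bigr => k _; rewrite !mxE.
  rewrite TS kappaC expand kappa_suml; apply: eq_bigr => k _.
  by rewrite !mxE mulrC kappaC.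
have Ku : K \in unitmx.
  rewrite -row_free_unit -kermx_eq0; apply/eqP/row_matrixP => i; rewrite row0.
  apply/eqP; rewrite -(vecof_eq0 be); apply/eqP; set u := row i _.
  have uK : u *m K = 0 by apply/sub_kermxP; exact: row_sub.
  apply: kappa_nondeg => y; rewrite kappaC (coord_vbasis (memvf y)) kappa_suml.
  apply: big1 => j _; rewrite kappaC /vecof kappa_suml.
  suff -> : \sum_i0 u 0 i0 * kappa e`_i0 e`_j = (u *m K) 0 j.
    by rewrite uK mxE mulr0.
  by rewrite [RHS]mxE; apply: eq_bigr => k _; congr (_ * _); rewrite [RHS]mxE.
rewrite /lftrace -/e -/A -/B -[A]mulmx1 -(mulmxV Ku) mulmxA AK mxtrace_mulC.
by rewrite mulmxA mulVmx// mul1mx mxtrace_tr.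
Qed.

Lemma adjoint_exists T : exists S, forall x y, kappa (T x) y = kappa x (S y).
Proof.
have adj y : exists w, forall x, kappa x w = kappa (T x) y.
  have [g gE] : exists g : 'Hom(V, F^o), forall x, g x = kappa (T x) y.
    by apply: linear_hom => a u v; rewrite linearP (kappa_linear ad_linear).
  have [w wE] := kappa_riesz ad_linear kappa_nondeg g.
  by exists w => x; rewrite kappaC wE gE.
have [f fE] := choice adj.
have [S SE] : exists S : 'End(V), forall y, S y = f y.
  apply: linear_hom => a u v; apply/eqP; rewrite -subr_eq0; apply/eqP.
  apply: kappa_nondeg => x; rewrite kappaBl (kappa_linear ad_linear).
  by rewrite !(kappaC _ _ x) !fE (kappa_linearr ad_linear) subrr.
by exists S => x y; rewrite SE fE.
Qed.

(* The orthogonal [n] of [b] is dual to the quotient by [b], and [ad x ad y]  *)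
(* is zero on b / n: the trace over [b] is half of the trace over the whole.  *)
Lemma half_killing (b n : {vspace V}) P x y :
  (forall v, P v \in b) -> (forall v, v \in b -> P v = v) ->
  stable ad b b -> (forall v, v \in n <-> forall u, u \in b -> kappa u v = 0) ->
  (n <= b)%VS -> (forall u v, u \in b -> v \in b -> ad u v \in n) ->
  x \in b -> y \in b ->
  lftrace (ad x \o ad y \o P)%VF = 2%:R^-1 * kappa x y.
Proof.
move=> Pb bP bb nP nb bbn xb yb.
have [P' P'E] := adjoint_exists P.
(* The kernel of the adjoint of a projection onto [b] is the orthogonal of [b], so [Q] is a
   projection onto [n]. *)
pose Q := (\1 - P')%VF : 'End(V).
have Qn v : Q v \in n.
  apply/nP => u ub; rewrite !lfun_simp /=.
  by rewrite kappaC kappaBl !(kappaC _ _ u) -P'E bP ?subrr.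
have nQ v : v \in n -> Q v = v.
  move=> vn; rewrite !lfun_simp /= (_ : P' v = 0) ?subr0//.
  apply: kappa_nondeg => u; rewrite kappaC -P'E.
  by move/nP: vn; apply.
have bn u v : u \in b -> v \in n -> ad u v \in n.
  move=> ub /(subvP nb); exact: bbn.
(* As [n] is stable under [b], cyclicity of the trace exchanges [ad x] and [ad y] on [n]. *)
have tQ : lftrace (Q \o (ad y \o ad x))%VF = lftrace (ad x \o ad y \o Q)%VF.
  transitivity (lftrace ((ad y \o ad x) \o Q)%VF); first exact: mxof_id_comp.
  transitivity (lftrace ((ad y \o Q) \o (ad x \o Q))%VF).
    by congr lftrace; apply/lfunP => v; rewrite !comp_lfunE (nQ (ad x _))// bn.
  transitivity (lftrace ((ad x \o Q) \o (ad y \o Q))%VF); first exact: mxof_id_comp.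
  by congr lftrace; apply/lfunP => v; rewrite !comp_lfunE (nQ (ad y _))// bn.
(* [ad x \o ad y] sends [b] into [n], so its trace over [b] is its trace over [n]. *)
have t1 : lftrace (ad x \o ad y \o P)%VF = lftrace (ad x \o ad y \o Q)%VF.
  have <- : (Q \o (ad x \o ad y \o P) = ad x \o ad y \o P)%VF.
    by apply/lfunP => v; rewrite !comp_lfunE nQ// bbn// bb.
  transitivity (lftrace ((ad x \o ad y \o P) \o Q)%VF); first exact: mxof_id_comp.
  congr lftrace; apply/lfunP => v.
  by rewrite !comp_lfunE bP// (subvP nb).
(* The adjoint of the operator on the left is [P' \o (ad y \o ad x)]: the trace over [b] is also the
   full trace minus the trace over [n]. *)
have t2 : lftrace (ad x \o ad y \o P)%VF =
    kappa x y - lftrace (Q \o (ad y \o ad x))%VF.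
  rewrite (@lftrace_adjoint _ (P' \o (ad y \o ad x))%VF).
    by rewrite comp_lfunBl comp_lfun1l lftraceB -/(kappa y x) (kappaC _ y) subKr.
  move=> u v; rewrite !comp_lfunE -P'E (adC ad_linear adxx).
  have adN a c d : kappa (ad a c) d = - kappa c (ad a d).
    by rewrite (adC ad_linear adxx) -scaleN1r kappaZl mulN1r (kappa_inv ad_jacobi).
  by rewrite -(adC ad_linear adxx) !adN opprK.
apply: (@mulfI _ (2%:R)); first by rewrite pnatr_eq0.
rewrite mulrA mulfV ?pnatr_eq0// mul1r mulr_natl mulr2n {2}t1 -tQ t2.
by rewrite subrK.
Qed.

End KillingForm.

Section KillingOrthogonal.
Variables (F : numClosedFieldType) (V : vectType F) (ad : V -> 'End(V)).
Hypothesis adl : forall a x y, ad (a *: x + y) = a *: ad x + ad y.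
Hypothesis adA : forall x, ad x x = 0.
Hypothesis adJ : forall x y, ad (ad x y) = (ad x \o ad y)%VF - (ad y \o ad x)%VF.
Local Notation kappa := (kappa ad).
Hypothesis nondeg : forall x, (forall y, kappa x y = 0) -> x = 0.
Implicit Types (b s N : {vspace V}) (v w x y z p q : V).

Lemma kappa_orthogonal (P : V -> Prop) :
  exists N, forall w, w \in N <-> forall u, P u -> kappa u w = 0.
Proof.
apply: vspace_comprehension => [u _|a x y x0 y0 u Pu].
  by rewrite kappaC (kappa0l adl).
by rewrite (kappa_linearr adl) x0// y0// mulr0 addr0.
Qed.

Lemma kappa_adjoin v x p q a c e :
  kappa (x + a *: v) (ad (p + c *: v) (q + e *: v)) =
  kappa x (ad p q) + e * kappa (ad x p) v - c * kappa (ad x q) v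
  + a * kappa (ad p q) v.
Proof.
have kDr u y z : kappa u (y + z) = kappa u y + kappa u z.
  by rewrite kappaC (kappaDl adl) !(kappaC _ _ u).
have kZr u k y : kappa u (k *: y) = k * kappa u y.
  by rewrite kappaC (kappaZl adl) kappaC.
have kv y : kappa v (ad y v) = 0.
  rewrite (adC adl adA) -scaleN1r kZr -(kappa_inv adJ) adA (kappa0l adl).
  by rewrite mulr0.
rewrite (ad_adjoin adl adA) (kappaDl adl) (kappaZl adl) -scaleNr !kDr !kZr !kv.
by rewrite !mulr0 !addr0 !(kappa_inv adJ) (kappaC _ v) (kappa_inv adJ) mulNr addrA.
Qed.

(** By invariance, each new term in the expansion pairs [v] with an element of [b], or is kappa v
    [y, v] = 0. This is the hypothesis of Cartan's criterion for b + C v. *)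
Lemma kappa_adjoin_derived b v s' : stable ad b b ->
  (forall x y z, x \in b -> y \in b -> z \in b -> kappa x (ad y z) = 0) ->
  (forall u, u \in b -> kappa u v = 0) -> derived ad (b + <[v]>)%VS s' ->
  forall x y, x \in (b + <[v]>)%VS -> y \in s' -> kappa x y = 0.
Proof.
move=> bb b0 v0 [_ s'min] x y xs ys'.
have [Z ZE] := kappa_orthogonal (eq^~ x).
suff /ZE : y \in Z by apply.
apply: (subvP (s'min Z _)) => // p q ps qs; apply/ZE => _ ->.
move: xs ps qs => /memv_addP[x1 x1b [_ /vlineP[a ->] ->]]
  /memv_addP[p1 p1b [_ /vlineP[c ->] ->]] /memv_addP[q1 q1b [_ /vlineP[e ->] ->]].
by rewrite kappa_adjoin b0// !v0 ?bb// !mulr0 subr0 !addr0.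
Qed.

Lemma invariant_form_operator (f : V -> V -> F) :
  (forall a x y z, f (a *: x + y) z = a * f x z + f y z) ->
  (forall a x y z, f z (a *: x + y) = a * f z x + f z y) ->
  (forall x y z, f (ad x y) z = f x (ad y z)) ->
  exists T : 'End(V), (forall x y, f x y = kappa (T x) y) /\
    forall x y, T (ad x y) = ad x (T y).
Proof.
move=> fl fr finv.
have Tx x : exists w, forall y, kappa w y = f x y.
  have [phi phiE] : exists phi : 'Hom(V, F^o), forall y, phi y = f x y.
    by apply: linear_hom => a y z; rewrite fr.
  have [w wE] := kappa_riesz adl nondeg phi.
  by exists w => y; rewrite wE phiE.
have [h hE] := choice Tx.
have [T TE] : exists T : 'End(V), forall x, T x = h x.
  apply: linear_hom => a x y; apply/eqP; rewrite -subr_eq0; apply/eqP.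
  by apply: nondeg => z; rewrite (kappaBl adl) (kappa_linear adl) !hE fl subrr.
have kT x y : kappa (T x) y = f x y by rewrite TE hE.
have f0 y : f 0 y = 0.
  by have := fl (-1) 0 0 y; rewrite scaler0 addr0 mulN1r addNr.
have fN x y : f (- x) y = - f x y.
  by have := fl (-1) x 0 y; rewrite scaleN1r mulN1r f0 !addr0.
have kN x y : kappa (- x) y = - kappa x y.
  by rewrite -scaleN1r (kappaZl adl) mulN1r.
exists T; split=> // x y; apply/eqP; rewrite -subr_eq0; apply/eqP.
apply: nondeg => z; rewrite (kappaBl adl) kT (adC adl adA x y) fN finv.
by rewrite (adC adl adA x (T y)) kN (kappa_inv adJ) kT opprK addNr.
Qed.

End KillingOrthogonal.

(** * The adjoint representation *)

Section LieSubalgebra.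
Variables (F : fieldType) (n : nat) (L : {vspace 'M[F]_n}).
Hypothesis L_closed : forall X Y, X \in L -> Y \in L -> X *m Y - Y *m X \in L.
Local Notation V := (subvs_of L).
Implicit Types x y : V.

Lemma lie_linear x : linear (lie x).
Proof.
move=> a y z; have vP : vsval (a *: y + z) = a *: vsval y + vsval z by rewrite linearP.
rewrite /lie -linearP; congr (vsproj L _); rewrite vP mulmxDl mulmxDr.
by rewrite -scalemxAl -scalemxAr scalerBr opprD addrACA.
Qed.

Lemma adE x y : ad x y = lie x y.
Proof.
pose g : {linear V -> V} := HB.pack (lie x) (GRing.isLinear.Build _ _ _ _ _
  (lie_linear x)).
exact: (lfunE g y).
Qed.

Lemma vsval_ad x y : vsval (ad x y) = vsval x *m vsval y - vsval y *m vsval x.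
Proof. by rewrite adE /lie vsprojK// L_closed ?subvsP. Qed.

Lemma ad_is_linear a x y : ad (a *: x + y) = a *: ad x + ad y.
Proof.
have vP (u v : V) b : vsval (b *: u + v) = b *: vsval u + vsval v by rewrite linearP.
apply/lfunP => z; apply: val_inj; rewrite /= add_lfunE scale_lfunE vP.
rewrite !vsval_ad vP mulmxDl mulmxDr -scalemxAl -scalemxAr scalerBr.
by rewrite opprD addrACA.
Qed.

Lemma ad_alternating x : ad x x = 0.
Proof. by apply: val_inj; rewrite /= vsval_ad subrr. Qed.

Lemma ad_is_jacobi x y : ad (ad x y) = (ad x \o ad y)%VF - (ad y \o ad x)%VF.
Proof.
apply/lfunP => z; apply: val_inj.
rewrite /= add_lfunE opp_lfunE !comp_lfunE linearB /= !vsval_ad.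
rewrite !(mulmxBl, mulmxBr) !mulmxA.
set a := _ *m _ *m _; set b := _ *m _ *m _; set c := _ *m _ *m _.
set d := _ *m _ *m _; set e := _ *m _ *m _; set f := _ *m _ *m _.
rewrite !opprB [RHS]addrACA ![_ - _ + (_ - _)]addrA !subrK.
by rewrite -!addrA; congr (_ + _); rewrite addrCA [RHS]addrCA [- a + _]addrC.
Qed.

End LieSubalgebra.

Section LieAlgebraOfGroup.
Variable R : realType.
Local Notation C := R[i].
Variable n : nat.
Local Notation M := 'M[C]_n.

Lemma lie_algebra_conj (A : set M) L y X : algebraic_group A ->
  lie_algebra_of A L -> A y -> X \in L -> y *m X *m invmx y \in L.
Proof.
move=> gA lieA Ay XL; have [[Au _ AM AV] _] := gA.
have [E [D XED]] := onepar_exists X.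
apply: (onepar_lie lieA (onepar_conj (Au _ Ay) XED)) => t.
by apply: (AM); [apply: (AM) => //; exact: (onepar_mem gA lieA XL XED t)|exact: AV].
Qed.

Lemma lie_algebra_bracket (A : set M) L : algebraic_group A ->
  lie_algebra_of A L -> forall X Y, X \in L -> Y \in L -> X *m Y - Y *m X \in L.
Proof.
move=> gA lieA X Y XL YL; have [E [D XED]] := onepar_exists X.
apply: (onepar_conj_bracket XED) => t.
have [_ <-] := onepar_unit t XED; apply: (lie_algebra_conj gA lieA _ YL).
exact: (onepar_mem gA lieA XL XED t).
Qed.

End LieAlgebraOfGroup.

Section AdjointRepresentation.
Variable R : realType.
Local Notation C := R[i].
Variable n : nat.
Local Notation M := 'M[C]_n.
Variables (G : set M) (g : {vspace M}).
Hypotheses (algG : algebraic_group G) (lieG : lie_algebra_of G g).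
Local Notation V := (subvs_of g).
Implicit Types (x y z : M) (u v w : V) (U W : {vspace V}) (A : set M).

Let gclosed := lie_algebra_bracket algG lieG.

(** Defined for every matrix [y] through a projection onto g; for [y] in G it is conjugation, by
    [vsval_Ad]. *)
Definition Ad y : 'End(V) :=
  locked (linfun (vsproj g) \o (linfun (mulmxr (invmx y)) \o
    (linfun (mulmx y) \o linfun (@vsval _ _ g))))%VF.

Lemma AdE y v : Ad y v = vsproj g (y *m vsval v *m invmx y).
Proof. by rewrite /Ad -lock !comp_lfunE !lfunE. Qed.

Lemma G_unit y : G y -> y \in unitmx.
Proof. by case: algG => -[Gu _ _ _] _; exact: Gu. Qed.

Lemma vsval_Ad y v : G y -> vsval (Ad y v) = y *m vsval v *m invmx y.
Proof.
by move=> Gy; rewrite AdE vsprojK// (lie_algebra_conj algG lieG)// subvsP.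
Qed.

Lemma AdM x y v : G x -> G y -> Ad (x *m y) v = Ad x (Ad y v).
Proof.
move=> Gx Gy; have [[_ _ GM _] _] := algG.
apply: val_inj; rewrite /= (vsval_Ad v (GM _ _ Gx Gy)) (vsval_Ad _ Gx) (vsval_Ad v Gy).
rewrite invmx_mulmx ?G_unit//.
by rewrite !mulmxA.
Qed.

Lemma Ad1 v : Ad 1%:M v = v.
Proof. by rewrite AdE invmx1 mulmx1 mul1mx vsvalK. Qed.

Lemma AdVK y v : G y -> Ad (invmx y) (Ad y v) = v.
Proof.
move=> Gy; have [[_ _ _ GV] _] := algG.
by rewrite -(AdM v (GV _ Gy) Gy) mulVmx ?G_unit// Ad1.
Qed.

Lemma AdKV y v : G y -> Ad y (Ad (invmx y) v) = v.
Proof.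
move=> Gy; have [[_ _ _ GV] _] := algG.
by rewrite -(AdM v Gy (GV _ Gy)) mulmxV ?G_unit// Ad1.
Qed.

Lemma Ad_conj x y v : G x -> G y ->
  Ad x (Ad y v) = Ad y (Ad (invmx y *m x *m y) v).
Proof.
move=> Gx Gy; have [[_ _ GM GV] _] := algG.
have Gz : G (invmx y *m x *m y) by apply: (GM) => //; apply: (GM) => //; exact: GV.
rewrite -(AdM _ Gx Gy) -(AdM _ Gy Gz); congr (Ad _ v).
by rewrite !mulmxA mulmxV ?mul1mx ?G_unit.
Qed.

Lemma Ad_commutator x y v : G x -> G y ->
  Ad x (Ad y v) = Ad (x *m y *m invmx x *m invmx y) (Ad y (Ad x v)).
Proof.
move=> Gx Gy; have [[_ _ GM GV] _] := algG.
have Gz : G (x *m y *m invmx x *m invmx y).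
  by apply: (GM); [apply: (GM); [exact: GM|exact: GV]|exact: GV].
rewrite -(AdM _ Gx Gy) -(AdM _ Gy Gx) -(AdM _ Gz (GM _ _ Gy Gx)); congr (Ad _ v).
by rewrite mulmxA !mulmxKV ?G_unit.
Qed.

Lemma Ad_bracket y u v : G y -> Ad y (ad u v) = ad (Ad y u) (Ad y v).
Proof.
move=> Gy; apply: val_inj; rewrite /= vsval_Ad// !(vsval_ad gclosed) !vsval_Ad//.
have cc (a b : M) : y *m a *m invmx y *m (y *m b *m invmx y) = y *m (a *m b) *m invmx y.
  by rewrite !mulmxA mulmxKV ?G_unit.
by rewrite !cc mulmxBr mulmxBl.
Qed.

Lemma Ad_reg (phi : 'Hom(V, C^o)) v (f : M -> M) : regword f ->
  reg (fun y => phi (Ad (f y) v)).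
Proof.
move=> fw; have [fr fVr] := regword_reg fw.
apply: (@reg_comp _ _ (fun y => phi (Ad y v))) => // [x|].
  exact: regword_unit.
have r : regmx (fun y : M => y *m vsval v *m invmx y).
  apply: regmx_mul; last by move=> i j; exact: reg_inv.
  by apply: regmx_mul; [move=> i j; exact: reg_entry|exact: regmx_cst].
apply: reg_ext (regmx_form (phi \o linfun (vsproj g))%VF r) => y _.
by rewrite comp_lfunE lfunE AdE.
Qed.

Definition Ad_stable A U := forall y u, A y -> u \in U -> Ad y u \in U.

(** The Lie-Kolchin theorem on U / W, by induction on the derived length. The derived group has an
    eigenvector, with character [chi]. A regular function on the connected group A with values among
    finitely many eigenvalues is constant. This makes [chi] invariant under conjugation by A, so
    that its weight space [X] is A-stable; it then makes [chi] trivial on commutators, so that A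
    acts commutatively on [X] modulo [W]. *)
Lemma lie_kolchin k A U W : A `<=` G -> subgroup A -> zconnected A ->
  iter k (@commutator_subgroup C n) A = [set 1%:M] ->
  Ad_stable A U -> Ad_stable A W -> (W <= U)%VS -> ~~ (U <= W)%VS ->
  exists v, [/\ v \in U, v \notin W &
    forall y, A y -> exists c, Ad y v - c *: v \in W].
Proof.
elim: k A U => [|k IHk] A U AG gA cA Ak AU AW WU UW.
  have [v vU vW] := subvPn UW; exists v; split => // y.
  rewrite -[A]/(iter 0 (@commutator_subgroup C n) A) Ak => ->.
  by exists 1; rewrite Ad1 scale1r subrr mem0v.
pose A' := commutator_subgroup A.
have A'A : A' `<=` A by exact: commutator_subgroup_sub.
have [Au A1 AM AV] := gA.
have [||||v [vU vW vA']] := IHk A' U _ (subgroup_commutator gA)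
    (zconnected_commutator gA cA) _ _ _ WU UW.
- by move=> x /A'A/AG.
- by rewrite -iterSr.
- by move=> y u /A'A; exact: AU.
- by move=> y u /A'A; exact: AW.
have [phi [phiW phiv]] := vspace_separation vW.
(* Reading the eigenvalue through a linear form makes [chi] a regular function on the whole
   group. *)
pose chi x := phi (Ad x v).
have chiE x : A' x -> Ad x v - chi x *: v \in W.
  move=> /vA'[c xc]; have := phiW _ xc.
  by rewrite linearB linearZ /= phiv /GRing.scale /= mulr1 /chi => /subr0_eq ->.
have [X XE] : exists X : {vspace V}, forall u,
    u \in X <-> u \in U /\ forall x, A' x -> Ad x u - chi x *: u \in W.
  apply: vspace_comprehension => [|a u w [uU uW] [wU wW]].
    split => [|x _]; first exact: mem0v.
    by rewrite [Ad x 0]linear0 scaler0 subr0 mem0v.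
  split=> [|x A'x]; first by rewrite memvD ?memvZ.
  rewrite linearP scalerDr opprD addrACA scalerA mulrC -scalerA -scalerBr.
  by rewrite memvD ?memvZ ?uW ?wW.
have WX : (W <= X)%VS.
  apply/subvP => w wW; apply/XE; split; first exact: (subvP WU).
  by move=> x /A'A Ax; rewrite memvB ?memvZ// AW.
have vX : v \in X by apply/XE.
have XW : ~~ (X <= W)%VS by apply/subvPn; exists v.
have eigen_list x : A x -> exists rs : seq C, forall c u, u \notin W ->
    Ad x u - c *: u \in W -> c \in rs.
  move=> Ax; have [rs rs0] := split_annihilator (Ad x); exists rs => c u uW.
  move=> /(papp_eigenvalue _ rs0 uW); rewrite root_prod_XsubC; apply.
  by move=> w; exact: AW.
have AdW y u : A y -> Ad y u \in W -> u \in W.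
  by move=> Ay yu; rewrite -(AdVK u (AG _ Ay)) AW//; exact: AV.
have chi_conj x y : A' x -> A y -> chi (invmx y *m x *m y) = chi x.
  move=> A'x Ay; have Ax := A'A _ A'x; have [rs rsE] := eigen_list x Ax.
  have wordc : regword (fun y : M => invmx y *m x *m y).
    apply: regword_mul; last exact: regword_id.
    by apply: regword_mul; [exact: (regword_inv (@regword_id _ _))|
      apply: regword_cst; exact: Au].
  have := zconnected_finite_const cA Au (Ad_reg phi v wordc) (rs := rs).
  move=> /(_ _ y 1%:M Ay A1); rewrite invmx1 mul1mx mulmx1; apply => z Az.
  have A'z : A' (invmx z *m x *m z) by exact: commutator_subgroup_conj.
  apply: (rsE _ (Ad z v)); first by apply: contra vW; exact: AdW.
  rewrite (Ad_conj v (AG _ Ax) (AG _ Az)) -linearZ -linearB /=;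
    apply: AW => //; exact: chiE.
have AX : Ad_stable A X.
  move=> y u Ay /XE[uU uW]; apply/XE; split; first exact: AU.
  move=> x A'x; have A'z : A' (invmx y *m x *m y) by exact: commutator_subgroup_conj.
  rewrite (Ad_conj u (AG _ (A'A _ A'x)) (AG _ Ay)).
  rewrite -(chi_conj _ _ A'x Ay) -linearZ -linearB /=; apply: AW => //.
  exact: uW.
(* If [Ad x] has eigenvalue [c] then it also has eigenvalue [c * chi [x, y]]. *)
have chi_comm x y : A x -> A y -> chi (x *m y *m invmx x *m invmx y) = 1.
  move=> Ax Ay; have [rs rsE] := eigen_list x Ax.
  have [rs' rs'0] := split_annihilator (Ad x).
  have [||c [u [uX uW uc]]] := @relative_eigenvector_prod _ _ (Ad x) X W rs' v _ vX vW.
  - by move=> w; exact: AX.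
  - by rewrite rs'0 lfunE mem0v.
  have c0 : c != 0.
    apply: contra uW => /eqP c0; move: uc; rewrite c0 scale0r subr0.
    exact: AdW.
  have wordc : regword (fun y : M => x *m y *m invmx x *m invmx y).
    apply: regword_mul; last exact: (regword_inv (@regword_id _ _)).
    apply: regword_mul; last by apply: regword_cst; rewrite unitmx_inv Au.
    by apply: regword_mul; [apply: regword_cst; exact: Au|exact: regword_id].
  have := zconnected_finite_const cA Au
     (regM (reg_cst n c) (Ad_reg phi v wordc)) (rs := rs).
  have w1 : x *m 1%:M *m invmx x *m invmx 1%:M = 1%:M.
    by rewrite mulmx1 mulmxV ?Au// mul1mx invmx1.
  move=> /(_ _ y 1%:M Ay A1); rewrite w1 Ad1 phiv => e; apply: (mulfI c0);
    apply: e => z Az.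
  apply: (rsE _ (Ad z u)); first by apply: contra uW; exact: AdW.
  set h := x *m z *m invmx x *m invmx z.
  have A'h : A' h by exact: commutator_mem.
  rewrite (Ad_commutator u (AG _ Ax) (AG _ Az)) -/h.
  have -> : Ad h (Ad z (Ad x u)) = Ad h (Ad z (Ad x u - c *: u)) + c *: Ad h (Ad z u).
    rewrite [Ad z (_ - _)]linearB /= [Ad h (_ - _)]linearB /=.
    by rewrite [Ad z (c *: u)]linearZ /= [Ad h (c *: _)]linearZ /= subrK.
  rewrite -addrA memvD//; first by apply: (AW); [exact: A'A|exact: AW].
  rewrite -scalerA -scalerBr.
  by rewrite memvZ//; have [_] := (XE (Ad z u)).1 (AX _ _ Az uX); apply.
have [|||||X' [/andP[WX' X'X] X'W X'c]] := @commuting_eigenvector _ _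
  (fun T => exists2 y, A y & T = Ad y) X W _ _ _ _ WX.
- by move=> T _; exact: split_annihilator.
- by move=> _ u [y Ay ->]; exact: AX.
- by move=> _ u [y Ay ->]; exact: AW.
- move=> _ _ u [x Ax ->] [y Ay ->] uX.
  set h := x *m y *m invmx x *m invmx y.
  have A'h : A' h by exact: commutator_mem.
  rewrite (Ad_commutator u (AG _ Ax) (AG _ Ay)) -/h.
  have [_ /(_ h A'h)] := (XE (Ad y (Ad x u))).1 (AX _ _ Ay (AX _ _ Ax uX)).
  by rewrite chi_comm// scale1r.
- exact: XW.
have [w wX' wW] := subvPn X'W; exists w; split => //.
  by have [] := (XE w).1 (subvP X'X _ wX').
by move=> y Ay; have [|c cE] := X'c (Ad y); [exists y|exists c; exact: cE].
Qed.

End AdjointRepresentation.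

(** * Eigenvectors common to a group and a Lie algebra; stabilizers *)

Section AdjointActions.
Variable R : realType.
Local Notation C := R[i].
Variable n : nat.
Local Notation M := 'M[C]_n.
Variables (G : set M) (g : {vspace M}).
Hypotheses (algG : algebraic_group G) (lieG : lie_algebra_of G g).
Local Notation V := (subvs_of g).
Local Notation Ad := (@Ad R n g).
Local Notation Ad_stable := (@Ad_stable R n g).
Implicit Types (x y z : M) (u v w : V) (U W s : {vspace V}) (A K : set M).

Let gclosed := lie_algebra_bracket algG lieG.
Let adl := ad_is_linear gclosed.
Let adA := ad_alternating gclosed.
Let adJ' := ad_is_jacobi gclosed.

(** Lie's theorem gives a weight [lam] of s on U / W. Its conjugates by A take, at each [x], values
    among the eigenvalues of [ad x], hence are constant by connectedness. The weight space is
    therefore A-stable and [lie_kolchin] applies to it. *)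
Lemma joint_eigenvector k A s s' U W : A `<=` G -> subgroup A -> zconnected A ->
  iter k (@commutator_subgroup C n) A = [set 1%:M] ->
  Ad_stable A s -> stable (@ad _ _ g) s s -> derived (@ad _ _ g) s s' ->
  (forall x : V, x \in s' -> nilpotent (ad x)) ->
  Ad_stable A U -> Ad_stable A W ->
  stable (@ad _ _ g) s U -> stable (@ad _ _ g) s W ->
  (W <= U)%VS -> ~~ (U <= W)%VS ->
  exists v, [/\ v \in U, v \notin W,
    forall y, A y -> exists c, Ad y v - c *: v \in W &
    forall x : V, x \in s -> exists c, ad x v - c *: v \in W].
Proof.
move=> AG gA cA Ak As ss ds nil AU AW sU sW WU UW.
have [Au A1 AM AV] := gA.
have [X [/andP[WX XU] XW Xc]] := weight_space adl adA adJ' ss ds nil sU sW WU UW.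
have [v vX vW] := subvPn XW.
have [phi [phiW phiv]] := vspace_separation vW.
pose lam (x : V) := phi (ad x v).
have lamE (x u : V) : x \in s -> u \in X -> ad x u - lam x *: u \in W.
  move=> xs uX; have [c xc] := Xc x xs; have := phiW _ (xc v vX).
  by rewrite linearB linearZ /= phiv /GRing.scale /= mulr1 /lam => /subr0_eq
    ->; exact: xc.
have [Y YE] : exists Y : {vspace V}, forall u,
    u \in Y <-> u \in U /\ forall x : V, x \in s -> ad x u - lam x *: u \in W.
  apply: vspace_comprehension => [|a u w [uU uW] [wU wW]].
    split => [|x _]; first exact: mem0v.
    by rewrite [ad x 0]linear0 scaler0 subr0 mem0v.
  split=> [|x A'x]; first by rewrite memvD ?memvZ.
  rewrite linearP scalerDr opprD addrACA scalerA mulrC -scalerA -scalerBr.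
  by rewrite memvD ?memvZ ?uW ?wW.
have vY : v \in Y.
  by apply/YE; split; [exact: (subvP XU)|move=> x xs; exact: lamE].
have WY : (W <= Y)%VS.
  apply/subvP => w wW; apply/YE; split; first exact: (subvP WU).
  by move=> x xs; rewrite memvB ?memvZ// sW.
have AdW y u : A y -> Ad y u \in W -> u \in W.
  by move=> Ay yu; rewrite -(AdVK algG lieG u (AG _ Ay)) AW//; exact: AV.
have lam_inv (x : V) y : x \in s -> A y -> lam (Ad (invmx y) x) = lam x.
  move=> xs Ay; have [rs rs0] := split_annihilator (ad x).
  have [psi psiE] : exists psi : 'Hom(V, C^o), forall z : V, psi z = phi (ad z v).
    by apply: linear_hom => a z z'; rewrite adl add_lfunE scale_lfunE linearP.
  have wV : regword (fun y : M => invmx y) by exact: (regword_inv (@regword_id _ _)).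
  have := zconnected_finite_const cA Au (Ad_reg psi x wV) (rs := rs).
  move=> /(_ _ y 1%:M Ay A1); rewrite invmx1 Ad1 !psiE; apply => z Az.
  rewrite psiE -root_prod_XsubC.
  apply: (papp_eigenvalue (v := Ad z v) _ rs0); first by move=> w; exact: sW.
    by apply: contra vW; exact: AdW.
  have e : ad x (Ad z v) = Ad z (ad (Ad (invmx z) x) v).
    by rewrite (Ad_bracket algG lieG (Ad (invmx z) x) v (AG _ Az)) (AdKV algG
      lieG x (AG _ Az)).
  rewrite [X in X - _]e -linearZ -linearB /=; apply: AW => //; apply: lamE => //.
  by apply: As => //; exact: AV.
have AY : Ad_stable A Y.
  move=> y u Ay /YE[uU uW]; apply/YE; split; first exact: AU.
  move=> x xs; have e : ad x (Ad y u) = Ad y (ad (Ad (invmx y) x) u).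
    by rewrite (Ad_bracket algG lieG (Ad (invmx y) x) u (AG _ Ay)) (AdKV algG
      lieG x (AG _ Ay)).
  rewrite [X in X - _]e -(lam_inv x y xs Ay) -linearZ -linearB /=;
    apply: AW => //; apply: uW.
  by apply: As => //; exact: AV.
have YW : ~~ (Y <= W)%VS by apply/subvPn; exists v.
have [w [wY wW wA]] := lie_kolchin algG lieG AG gA cA Ak AY AW WY YW.
have [wU wl] := (YE w).1 wY.
by exists w; split => // x xs; exists (lam x); exact: wl.
Qed.

Definition matspace U : {vspace M} := (linfun (@vsval _ _ g) @: U)%VS.

Lemma mem_matspace U u : (vsval u \in matspace U) = (u \in U).
Proof.
apply/idP/idP => [/memv_imgP[v vU]|uU]; last first.
  by apply/memv_imgP; exists u => //; rewrite lfunE.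
by rewrite lfunE => /val_inj ->.
Qed.

Lemma matspaceP U X : X \in matspace U -> exists2 u, u \in U & X = vsval u.
Proof. by case/memv_imgP => u uU ->; exists u => //; rewrite lfunE. Qed.

Lemma ad_exp_stable v E D U : onepar (vsval v) E D ->
  (forall u, u \in U -> ad v u \in U) -> forall t u, u \in U -> Ad (E t) u \in U.
Proof.
move=> XED vU t u uU; have EG : G (E t).
  by apply: (onepar_mem algG lieG _ XED); exact: subvsP.
rewrite -mem_matspace (vsval_Ad algG lieG _ EG).
have [_ ->] := onepar_unit t XED.
apply: (onepar_conj_stable XED); last by rewrite mem_matspace.
move=> _ /matspaceP[w wU ->].
by rewrite -[mxbr _ _](vsval_ad gclosed) mem_matspace vU.
Qed.

Lemma exp_ad_stable v E D U u : onepar (vsval v) E D ->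
  (forall t, Ad (E t) u \in U) -> ad v u \in U.
Proof.
move=> XED EU; rewrite -mem_matspace (vsval_ad gclosed).
apply: (onepar_conj_bracket XED) => t; have [_ <-] := onepar_unit t XED.
rewrite -(vsval_Ad algG lieG); first by rewrite mem_matspace EU.
by apply: (onepar_mem algG lieG _ XED); exact: subvsP.
Qed.

Lemma exp_set_sub U : exp_set (matspace U) `<=` G.
Proof.
move=> _ [X [E [D [t [/matspaceP[u uU ->] XED ->]]]]].
by apply: (onepar_mem algG lieG _ XED); exact: subvsP.
Qed.

Lemma Ad_stableV y U : G y -> (forall u, u \in U -> Ad y u \in U) ->
  forall u, u \in U -> Ad (invmx y) u \in U.
Proof.
move=> Gy yU u uU.
have yUU : (Ad y @: U <= U)%VS by apply/subvP => _ /memv_imgP[v vU ->]; exact: yU.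
have ker0 : (U :&: lker (Ad y))%VS = 0%VS.
  apply/eqP; rewrite -subv0; apply/subvP => v /memv_capP[_].
  rewrite memv_ker memv0 => /eqP yv.
  by rewrite -(AdVK algG lieG v Gy) yv linear0.
have /eqP UE : (Ad y @: U)%VS == U by rewrite eqEdim yUU limg_dim_eq// leqnn.
move: uU; rewrite -{1}UE => /memv_imgP[v vU ->].
by rewrite (AdVK algG lieG).
Qed.

Lemma algebraic_group_stab U :
  algebraic_group [set y : M | G y /\ forall u, u \in U -> Ad y u \in U].
Proof.
have [gG cG] := algG; have [Gu G1 GM GV] := gG.
split; first split.
- by move=> y [/Gu].
- by split=> // u uU; rewrite Ad1.
- move=> x y [Gx xU] [Gy yU]; split; first exact: GM.
  by move=> u uU; rewrite (AdM algG lieG)//; exact/xU/yU.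
- by move=> y [Gy yU]; split; [exact: GV|exact: Ad_stableV].
pose S := [set f : M -> C | exists phi : 'Hom(V, C^o), exists u,
  [/\ forall w, w \in U -> phi w = 0, u \in U & f = fun y => phi (Ad y u)]].
rewrite (_ : [set y | _] = G `&` [set y | y \in unitmx /\ forall f, S f -> f y = 0]).
  apply: zclosedI => //; apply: zclosed_reg => _ [phi [u [_ _ ->]]].
  exact: (Ad_reg phi u (@regword_id _ _)).
apply/seteqP; split => y.
  move=> [Gy yU]; split => //; split; first exact: Gu.
  by move=> _ [phi [u [phiU uU ->]]]; apply/phiU/yU.
move=> [Gy [_ yS]]; split => // u uU; apply: contrapT => /negP yu.
have [phi [phiU phi1]] := vspace_separation yu.
have : phi (Ad y u) = 0 by apply: (yS (fun y => phi (Ad y u))); exists phi, u.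
by rewrite phi1 => /eqP; rewrite oner_eq0.
Qed.

Lemma commutator_subgroup_min A K : subgroup K ->
  (forall x y, A x -> A y -> K (x *m y *m invmx x *m invmx y)) ->
  commutator_subgroup A `<=` K.
Proof. by move=> gK KC z; apply. Qed.

(** K acts on the class of [e] modulo [U] by a character, trivial on the derived group. There the
    vectors Ad y e - e lie in [U], are fixed by K and add up under products, so commutators fix
    [e]. *)
Lemma commutators_trivial_step K U e : subgroup K -> K `<=` G ->
  (forall y u, K y -> u \in U -> Ad y u = u) ->
  (forall y, K y -> Ad y e \in (U + <[e]>)%VS) ->
  forall y u, commutator_subgroup (commutator_subgroup K) y ->
    u \in (U + <[e]>)%VS -> Ad y u = u.
Proof.
move=> gK KG KU Ke.
have [Ku K1 KM KV] := gK; have gK' := subgroup_commutator gK.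
have K'K := commutator_subgroup_sub gK; have K''K' := commutator_subgroup_sub gK'.
suff fix_e : forall y, commutator_subgroup (commutator_subgroup K) y -> Ad y e = e.
  move=> y u Ky /memv_addP[w wU [_ /vlineP[a ->] ->]].
  by rewrite linearD linearZ /= fix_e// (KU y w (K'K _ (K''K' _ Ky))).
have [eU|eU] := boolP (e \in U).
  by move=> y Ky; rewrite (KU y e (K'K _ (K''K' _ Ky))).
have [phi [phiU phie]] := vspace_separation eU.
pose chi y := phi (Ad y e).
have chiE y : K y -> Ad y e - chi y *: e \in U.
  move=> /Ke/memv_addP[w wU [_ /vlineP[a ->] yE]].
  have -> : chi y = a.
    rewrite /chi yE [phi _]linearD /= [phi (a *: e)]linearZ /= phie phiU// add0r.
    exact: mulr1.
  by rewrite yE addrK.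
have chiM x y : K x -> K y -> chi (x *m y) = chi y * chi x.
  move=> Kx Ky; rewrite {1}/chi (AdM algG lieG _ (KG _ Kx) (KG _ Ky)).
  rewrite -(subrK (chi y *: e) (Ad y e)) [Ad x _]linearD /= (KU _ _ Kx (chiE _ Ky)).
  rewrite [Ad x (_ *: _)]linearZ /= [phi _]linearD /= [phi (_ *: _)]linearZ /=.
  by rewrite phiU ?chiE// add0r.
have chi1 : chi 1%:M = 1 by rewrite /chi Ad1.
have chiV y : K y -> chi y * chi (invmx y) = 1.
  by move=> Ky; rewrite -(chiM _ _ (KV _ Ky) Ky) mulVmx ?Ku.
have K'chi y : commutator_subgroup K y -> Ad y e - e \in U.
  suff : commutator_subgroup K `<=` [set y | K y /\ chi y = 1].
    by move=> /(_ y) yP /yP[Ky cy]; have := chiE _ Ky; rewrite cy scale1r.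
  apply: commutator_subgroup_min; first split.
  - by move=> z [/Ku].
  - by [].
  - by move=> x z [Kx cx] [Kz cz]; split; [exact: KM|rewrite chiM// cx cz mulr1].
  - move=> x [Kx cx]; split; first exact: KV.
    by have := chiV x Kx; rewrite cx mul1r.
  move=> x z Kx Kz; split.
    by apply: (KM); [apply: (KM); [exact: KM|exact: KV]|exact: KV].
  have Kxz := KM _ _ Kx Kz.
  rewrite (chiM _ _ (KM _ _ Kxz (KV _ Kx)) (KV _ Kz)) (chiM _ _ Kxz (KV _ Kx)).
  rewrite (chiM _ _ Kx Kz) mulrA mulrACA [_ * chi z]mulrC chiV// mul1r.
  by rewrite mulrC chiV.
suff : commutator_subgroup (commutator_subgroup K) `<=`
    [set y | commutator_subgroup K y /\ Ad y e = e].
  by move=> K2 y /K2[].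
have [_ K'1 K'M K'V] := gK'.
apply: commutator_subgroup_min; first split.
- by move=> z [/K'K/Ku].
- by split => //; rewrite Ad1.
- move=> x z [Kx ex] [Kz ez]; split; first exact: K'M.
  by rewrite (AdM algG lieG) ?ez ?ex//; apply/KG/K'K.
- move=> x [Kx ex]; split; first exact: K'V.
  by rewrite -{1}ex (AdVK algG lieG)//; apply/KG/K'K.
move=> x z Kx Kz; set h := x *m z *m invmx x *m invmx z.
have Kh : commutator_subgroup K h.
  by apply: (K'M); [apply: (K'M); [exact: K'M|exact: K'V]|exact: K'V].
split => //.
have nu a b : commutator_subgroup K a -> commutator_subgroup K b ->
    Ad a (Ad b e) = e + ((Ad a e - e) + (Ad b e - e)).
  move=> Ka Kb; rewrite -{1}(subrK e (Ad b e)) [Ad a (_ + _)]linearD /=.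
  rewrite (KU _ _ (K'K _ Ka) (K'chi _ Kb)) addrC.
  by rewrite [RHS]addrA [e + (_ - e)]addrC subrK.
have := Ad_commutator algG lieG e (KG _ (K'K _ Kx)) (KG _ (K'K _ Kz)).
rewrite -/h (nu x z)// (nu z x)// [Ad h (_ + _)]linearD /=.
have tU : (Ad z e - e) + (Ad x e - e) \in U by rewrite memvD ?K'chi.
rewrite (KU h _ (K'K _ Kh) tU).
by rewrite [Ad z e - e + _]addrC => /addIr/esym.
Qed.

End AdjointActions.

(** * Simple algebraic groups *)

Section Centralizers.
Variables (F : fieldType) (n : nat).
Local Notation M := 'M[F]_n.
Implicit Types A T : set M.

Definition mx_centralizer T : set M :=
  [set x | x \in unitmx /\ forall y, T y -> x *m y = y *m x].

(** Centralizers being closed, what commutes with a generating set commutes with the closed group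
    [alggen] generated by it. *)
Lemma algebraic_group_centralizer T : algebraic_group (mx_centralizer T).
Proof.
split; first split.
- by move=> x [].
- by split=> [|y _]; rewrite ?unitmx1// mul1mx mulmx1.
- move=> x y [xu xT] [yu yT]; split=> [|z Tz]; first by rewrite unitmx_mul xu.
  by rewrite -mulmxA yT// !mulmxA xT.
- move=> x [xu xT]; split=> [|z Tz]; first by rewrite unitmx_inv.
  rewrite -[RHS]mul1mx -(mulVmx xu) -!mulmxA; congr (_ *m _).
  by rewrite !mulmxA xT// mulmxK.
pose S := [set f : M -> F | exists y i j, T y /\ f = fun x => (x *m y) i j - (y
  *m x) i j].
rewrite (_ : mx_centralizer T = [set x | x \in unitmx /\ forall f, S f -> f x = 0]).
  apply: zclosed_reg => _ [y [i [j [_ ->]]]].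
  have idr : regmx (fun x : M => x) by move=> k l; exact: reg_entry.
  apply: regB; first exact: (regmx_mul idr (@regmx_cst _ n _ _ y) i j).
  exact: (regmx_mul (@regmx_cst _ n _ _ y) idr i j).
apply/seteqP; split => x [xu xT]; split => //.
  by move=> _ [y [i [j [Ty ->]]]]; rewrite xT// subrr.
move=> y Ty; apply/matrixP => i j; apply/eqP; rewrite -subr_eq0; apply/eqP.
by apply: (xT (fun x => (x *m y) i j - (y *m x) i j)); exists y, i, j.
Qed.

Lemma iter_commutator_sub k A : subgroup A ->
  iter k (@commutator_subgroup F n) A `<=` A.
Proof.
move=> gA; elim: k => [|k IHk] //= z zk; apply: IHk.
exact: (commutator_subgroup_sub (iter_commutator_subgroup k gA)).
Qed.

End Centralizers.

Section SimpleGroup.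
Variable R : realType.
Local Notation C := R[i].
Variable n : nat.
Local Notation M := 'M[C]_n.
Variables (G : set M) (g : {vspace M}).
Hypotheses (simpleG : simple_algebraic_group G) (lieG : lie_algebra_of G g).
Local Notation V := (subvs_of g).
Local Notation Ad := (@Ad R n g).
Local Notation Ad_stable := (@Ad_stable R n g).
Local Notation adg := (@ad _ n g).
Local Notation kappa := (kappa adg).
Implicit Types (x y z : M) (u v w : V) (U W s : {vspace V}) (A K : set M).

Let algG : algebraic_group G. Proof. by case: simpleG. Qed.
Let gclosed := lie_algebra_bracket algG lieG.
Let adl := ad_is_linear gclosed.
Let adA := ad_alternating gclosed.
Let adJ' := ad_is_jacobi gclosed.

(** The closed group generated by the exponentials of [U] is connected, is normal because [U] is
    G-stable, and is not trivial because a constant exponential has zero generator. Simplicity makes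
    it G. *)
Lemma alggen_exp_stable U : Ad_stable G U -> U != 0%VS ->
  alggen (exp_set (matspace U)) = G.
Proof.
move=> GU U0; have [_ _ _ Gsimple] := simpleG.
have eu : forall x, exp_set (matspace U) x -> x \in unitmx by move=> x;
  exact: exp_set_unit.
have gN := algebraic_group_alggen eu.
have cN := zconnected_alggen eu (@exp_set_connected R n (matspace U)).
have [|N1|//] := Gsimple _ gN cN.
  split; first by apply: alggen_min => //; exact: exp_set_sub.
  move=> y x Gy; apply: alggen_conj => //; first exact: (G_unit algG).
  move=> e; apply: exp_set_conj; first exact: (G_unit algG).
  move=> _ /matspaceP[u uU ->].
  by rewrite -(vsval_Ad algG lieG _ Gy) mem_matspace GU.
case/negP: U0; rewrite -subv0; apply/subvP => u uU.
have [E [D XED]] := onepar_exists (vsval u).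
have E1 t : E t = 1%:M.
  have : alggen (exp_set (matspace U)) (E t).
    apply: alggen_sub; exists (vsval u), E, D, t; split => //.
    by rewrite mem_matspace.
  by rewrite N1.
have [_ Ed _ _ _] := XED.
have := mxder_uniq Ed (mxder_ext _ (fun=> erefl) (mxder_cst 1%:M)).
move=> /(_ (fun t => esym (E1 t)) 0); rewrite E1 mul1mx => u0.
rewrite memv0; apply/eqP/val_inj; exact: (etrans u0 (esym (linear0 (@vsval _ _ g)))).
Qed.

(** Otherwise G is generated by the exponentials of a line. They commute with one another, and
    passing twice through centralizers makes G commutative. *)
Lemma no_stable_line e : Ad_stable G <[e]>%VS -> e = 0.
Proof.
move=> Ge; apply: contrapT => /eqP e0; have [_ _ Gna _] := simpleG; apply: Gna.
have NG : alggen (exp_set (matspace <[e]>%VS)) = G.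
  by apply: alggen_exp_stable => //; rewrite -dimv_eq0 dim_vline e0.
have cent1 : G `<=` mx_centralizer (exp_set (matspace <[e]>%VS)).
  rewrite -{1}NG; apply: alggen_min; first exact: algebraic_group_centralizer.
  move=> x ex; split; first exact: exp_set_unit ex.
  case: ex => _ [E1 [D1 [t1 [/matspaceP[_ /vlineP[a ->] ->] XED1 ->]]]].
  move=> _ [_ [E2 [D2 [t2 [/matspaceP[_ /vlineP[b ->] ->] XED2 ->]]]]].
  apply: (onepar_comm t2 XED2); apply/esym; apply: (onepar_comm t1 XED1).
  have vZ c : vsval (c *: e) = c *: vsval e by rewrite linearZ.
  by rewrite !vZ -!scalemxAl -!scalemxAr !scalerA mulrC.
have cent2 : G `<=` mx_centralizer G.
  rewrite -{1}NG; apply: alggen_min; first exact: algebraic_group_centralizer.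
  move=> x ex; split; first exact: exp_set_unit ex.
  by move=> y /cent1[_ /(_ x ex)].
by move=> x y /cent2[_ xG] Gy; exact: xG.
Qed.

Lemma kappa_Ad y u v : G y -> kappa (Ad y u) v = kappa u (Ad (invmx y) v).
Proof.
move=> Gy; have [[_ _ _ GV] _] := algG.
have adAd a b : G a -> ad (Ad a b) = (Ad a \o ad b \o Ad (invmx a))%VF.
  move=> Ga; apply/lfunP => w; rewrite !comp_lfunE.
  by rewrite (Ad_bracket algG lieG b (Ad (invmx a) w) Ga) (AdKV algG lieG w Ga).
rewrite -[LHS]/(lftrace _) -[RHS]/(lftrace _) (adAd y u Gy) (adAd _ v (GV _ Gy)) invmxK.
transitivity (lftrace (Ad y \o (ad u \o Ad (invmx y) \o ad v))%VF).
  by rewrite !comp_lfunA.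
rewrite mxof_id_comp; congr lftrace; apply/lfunP => w.
by rewrite !comp_lfunE.
Qed.

(* A Lie algebra on which [kappa] vanishes is solvable: it would have an      *)
(* eigenvector, whose line would be stable under [G]. *)
Lemma kappa_isotropic_stable U : Ad_stable G U ->
  (forall u v, u \in U -> v \in U -> kappa u v = 0) -> U = 0%VS.
Proof.
move=> GU k0; apply/eqP/negPn/negP => U0.
have NG := alggen_exp_stable GU U0.
have sub_stable : stable adg U U.
  move=> u w uU wU; have [E [D XED]] := onepar_exists (vsval u).
  apply: (exp_ad_stable algG lieG XED) => t; apply: GU => //.
  by apply: (onepar_mem algG lieG _ XED); exact: subvsP.
have [U' dU'] := derived_exists adg U.
have U'U : (U' <= U)%VS by apply: dU'.2; exact: sub_stable.
have nil := cartan_criterion adl adJ' sub_stable dU'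
  (fun u v uU vU' => k0 u v uU (subvP U'U v vU')).
have [u uU u0] : exists2 u, u \in U & u \notin 0%VS by apply/subvPn; rewrite subv0.
have [||||X [_ X0 Xc]] := weight_space adl adA adJ' (U := fullv) (W :=
  0%VS) sub_stable dU' nil.
- by move=> *; exact: memvf.
- by move=> a w _; rewrite !memv0 => /eqP ->; rewrite linear0.
- exact: sub0v.
- by apply/subvPn; exists u => //; exact: memvf.
have [e eX e0] := subvPn X0.
case/negP: e0; rewrite memv0; apply/eqP; apply: no_stable_line.
suff : G `<=` [set y | G y /\ forall u, u \in <[e]>%VS -> Ad y u \in <[e]>%VS].
  by move=> GE y w /GE[_]; apply.
rewrite -{1}NG; apply: alggen_min; first exact: algebraic_group_stab.
move=> x [_ [E [D [t [/matspaceP[a aU ->] XED ->]]]]]; split.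
  by apply: (onepar_mem algG lieG _ XED); exact: subvsP.
apply: (ad_exp_stable algG lieG XED) => _ /vlineP[c ->].
have [d dE] := Xc a aU; rewrite linearZ /= memvZ//.
have := dE e eX; rewrite memv0 subr_eq0 => /eqP ->.
by rewrite memvZ// memv_line.
Qed.

Lemma simple_kappa_nondeg u : (forall v, kappa u v = 0) -> u = 0.
Proof.
move=> u0; have [r rE] : exists r : {vspace V}, forall u, u \in r <-> forall v,
  kappa u v = 0.
  apply: vspace_comprehension => [v|a x y x0 y0 v]; first exact: (kappa0l adl).
  by rewrite (kappa_linear adl) x0 y0 mulr0 addr0.
have r0 : r = 0%VS.
  apply: kappa_isotropic_stable => [y v Gy /rE v0|v w /rE v0 _ //].
  by apply/rE => w; rewrite kappa_Ad.
by apply/eqP; rewrite -memv0 -r0; apply/rE.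
Qed.

Lemma Ad_stable_ad U u w : Ad_stable G U -> w \in U -> ad u w \in U.
Proof.
move=> GU wU; have [E [D XED]] := onepar_exists (vsval u).
apply: (exp_ad_stable algG lieG XED) => t; apply: GU => //.
by apply: (onepar_mem algG lieG _ XED); exact: subvsP.
Qed.

(** Let W be the orthogonal of [U]. The intersection of [U] and W is isotropic, hence zero, so
    [U, W] = 0. Each w in W is then fixed by the exponentials of [U], which generate G, and w = 0 by
    [no_stable_line]. Nondegeneracy concludes. *)
Lemma simple_Ad_stable U : Ad_stable G U -> U != 0%VS -> U = fullv.
Proof.
move=> GU U0; have NG := alggen_exp_stable GU U0.
have [[_ _ _ GV] _] := algG.
have [W WE] : exists W : {vspace V}, forall w, w \in W <-> forall u, u \in U ->
  kappa w u = 0.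
  apply: vspace_comprehension => [v _|a x y x0 y0 v vU]; first exact: (kappa0l adl).
  by rewrite (kappa_linear adl) x0 ?y0 ?mulr0 ?addr0.
have GW : Ad_stable G W.
  move=> y w Gy /WE w0; apply/WE => u uU; rewrite kappa_Ad// w0//.
  by apply: GU => //; exact: GV.
have UW0 : (U :&: W)%VS = 0%VS.
  apply: kappa_isotropic_stable.
    by move=> y w Gy /memv_capP[wU wW]; apply/memv_capP; split; [exact: GU|exact: GW].
  by move=> u v /memv_capP[uU _] /memv_capP[_ /WE vW]; rewrite kappaC vW.
have W0 w : w \in W -> w = 0.
  move=> wW; apply: no_stable_line => y _ Gy /vlineP[c ->].
  have : mx_centralizer [set vsval w] y.
    move: Gy; rewrite -{1}NG; apply; first exact: algebraic_group_centralizer.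
    move=> x ex; split; first exact: exp_set_unit ex.
    case: ex => _ [E [D [t [/matspaceP[u uU ->] XED ->]]]] _ ->.
    apply/esym; apply: (onepar_comm t XED); apply/esym/eqP.
    rewrite -subr_eq0 -(vsval_ad gclosed).
    have : ad u w \in (U :&: W)%VS.
      apply/memv_capP; split; last exact: Ad_stable_ad.
      by rewrite (adC adl adA) memvN; exact: Ad_stable_ad.
    by rewrite UW0 memv0 => /eqP ->; rewrite linear0.
  case=> yu /(_ (vsval w) erefl) yw; rewrite linearZ /= memvZ//.
  rewrite AdE yw mulmxK// vsvalK; exact: memv_line.
apply/eqP; rewrite eqEsubv subvf /=; apply/negPn/negP => /subvPn[v _ vU].
have [phi [phiU phiv]] := vspace_separation vU.
have [w wE] := kappa_riesz adl simple_kappa_nondeg phi.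
have w0 : w = 0 by apply: W0; apply/WE => u uU; rewrite wE phiU.
by have := wE v; rewrite w0 phiv (kappa0l adl) => /esym/eqP; rewrite oner_eq0.
Qed.

Lemma simple_alggen : (fullv : {vspace V}) != 0%VS ->
  alggen (exp_set (matspace (fullv : {vspace V}))) = G.
Proof. by move=> V0; apply: alggen_exp_stable => // y u _ _; exact: memvf. Qed.

Lemma simple_ideal U : (fullv : {vspace V}) != 0%VS ->
  (forall u w, w \in U -> ad u w \in U) -> U != 0%VS -> U = fullv.
Proof.
move=> V0 idU; apply: simple_Ad_stable.
suff : G `<=` [set y | G y /\ forall u, u \in U -> Ad y u \in U].
  by move=> GE y w /GE[_]; apply.
rewrite -{1}(simple_alggen V0); apply: alggen_min; first exact: algebraic_group_stab.
move=> x [_ [E [D [t [/matspaceP[a aU ->] XED ->]]]]]; split.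
  by apply: (onepar_mem algG lieG _ XED); exact: subvsP.
by apply: (ad_exp_stable algG lieG XED) => u; exact: idU.
Qed.

Lemma simple_center y : (fullv : {vspace V}) != 0%VS -> G y -> (forall v, Ad y v = v) ->
  forall z, G z -> y *m z = z *m y.
Proof.
move=> V0 Gy yV z Gz; suff : mx_centralizer [set y] z by case=> _ /(_ y erefl) ->.
move: Gz; rewrite -{1}(simple_alggen V0); apply;
  first exact: algebraic_group_centralizer.
move=> x ex; split; first exact: exp_set_unit ex.
case: ex => _ [E [D [t [/matspaceP[a aU ->] XED ->]]]] _ ->.
apply/esym; apply: (onepar_comm t XED).
have := congr1 (@vsval _ _ g) (yV a); rewrite (vsval_Ad algG lieG _ Gy) => ya.
by rewrite -{2}ya mulmxKV// (G_unit algG).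
Qed.

(** Each term of the flag costs two derived groups, so the derived group of order [d + d] acts
    trivially on g. It is then central in G, and one more commutator makes it trivial. *)
Lemma flag_group_solvable K fl d : (fullv : {vspace V}) != 0%VS ->
  subgroup K -> K `<=` G -> flag fl d ->
  (forall y i u, K y -> u \in fl i -> Ad y u \in fl i) ->
  exists k, iter k (@commutator_subgroup C n) K = [set 1%:M].
Proof.
move=> V0 gK KG [fl0 fld fle] Kfl.
have gD k := iter_commutator_subgroup k gK.
have DK k := @iter_commutator_sub _ _ k _ gK.
have triv j : forall y u, iter (j + j) (@commutator_subgroup C n) K y ->
    u \in fl j -> Ad y u = u.
  elim: j => [|j IHj] y u.
    by rewrite fl0 memv0 => _ /eqP ->; rewrite linear0.
  have [e fe] := fle j; rewrite addSn addnS fe !iterS => Ky uj.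
  apply: (commutators_trivial_step algG lieG (gD (j + j)%N) _ IHj _ Ky uj).
    by move=> z /DK/KG.
  move=> z /DK Kz; rewrite -fe; apply: Kfl => //.
  by rewrite fe memvE addvSr.
exists (d + d).+1; rewrite iterS; apply/seteqP; split; last first.
  by move=> _ ->; have [_ ] := subgroup_commutator (gD (d + d)%N).
have g1 : subgroup [set (1%:M : M)].
  split => //; first by move=> _ ->; exact: unitmx1.
    by move=> _ _ -> ->; rewrite mulmx1.
  by move=> _ ->; rewrite invmx1.
apply: commutator_subgroup_min => // x y Kx Ky.
have Gx : G x by exact/KG/(DK (d + d)%N).
have Gy : G y by exact/KG/(DK (d + d)%N).
have xc : x *m y = y *m x.
  apply: simple_center => // v; apply: (triv d) => //; by rewrite fld memvf.
by rewrite xc mulmxK ?mulmxV// (G_unit algG).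
Qed.

End SimpleGroup.

(** * Borel subalgebras *)

Section BorelSubalgebra.
Variable R : realType.
Local Notation C := R[i].
Variable n : nat.
Local Notation M := 'M[C]_n.
Variables (G B : set M) (g b0 : {vspace M}).
Hypotheses (simpleG : simple_algebraic_group G) (borelB : borel_subgroup G B).
Hypotheses (lieG : lie_algebra_of G g) (lieB : lie_algebra_of B b0).
Local Notation V := (subvs_of g).
Local Notation Ad := (@Ad R n g).
Local Notation Ad_stable := (@Ad_stable R n g).
Local Notation adg := (@ad _ n g).
Local Notation kappa := (kappa adg).
Implicit Types (u v w : V) (U W s : {vspace V}) (A K : set M).
Hypothesis V0 : (fullv : {vspace V}) != 0%VS.

Let algG : algebraic_group G. Proof. by case: simpleG. Qed.
Let algB : algebraic_group B. Proof. by case: borelB => -[]. Qed.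
Let gclosed := lie_algebra_bracket algG lieG.
Let bclosed := lie_algebra_bracket algB lieB.
Let adl := ad_is_linear gclosed.
Let adA := ad_alternating gclosed.
Let adJ' := ad_is_jacobi gclosed.
Let nondeg := simple_kappa_nondeg simpleG lieG.

Lemma borel_sub : B `<=` G.
Proof. by case: borelB => -[]. Qed.

Lemma borel_lie_sub X : X \in b0 -> X \in g.
Proof.
move=> Xb; apply/lieG => p pG; apply: (lieB X).1 => // x Bx.
exact/pG/borel_sub.
Qed.

Lemma borel_solvable : exists k, iter k (@commutator_subgroup C n) B = [set 1%:M].
Proof. by case: borelB => -[]. Qed.

Lemma borel_subspace_exists : exists b : {vspace V}, forall u, u \in b <->
  vsval u \in b0.
Proof.
apply: vspace_comprehension => [|a u v ub vb]; first by rewrite linear0 mem0v.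
by rewrite linearP (memvD (memvZ a ub) vb).
Qed.

Variable b : {vspace V}.
Hypothesis bE : forall u, u \in b <-> vsval u \in b0.

Lemma borel_onepar u E D t : u \in b -> onepar (vsval u) E D -> B (E t).
Proof. by move=> /bE ub XED; exact: (onepar_mem algB lieB ub XED). Qed.

Lemma Ad_stable_borel : Ad_stable B b.
Proof.
move=> y u By /bE ub; apply/bE; rewrite (vsval_Ad algG lieG _ (borel_sub By)).
exact: (lie_algebra_conj algB lieB).
Qed.

Lemma borel_stable U u w : Ad_stable B U -> u \in b -> w \in U -> ad u w \in U.
Proof.
move=> BU ub wU; have [E [D XED]] := onepar_exists (vsval u).
apply: (exp_ad_stable algG lieG XED) => t; apply: BU => //.
exact: borel_onepar XED.
Qed.

Lemma borel_eigenvector U W : Ad_stable B U -> Ad_stable B W ->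
  (W <= U)%VS -> ~~ (U <= W)%VS -> exists v, [/\ v \in U, v \notin W &
    forall y, B y -> exists c, Ad y v - c *: v \in W].
Proof.
have [k Bk] := borel_solvable; have [gB _] := algB.
by have [[_ cB _ _] _] := borelB; apply: (lie_kolchin algG lieG borel_sub gB cB Bk).
Qed.

(* The group generated by [B] and the exponentials of [s] stabilizes a flag,  *)
(* hence is solvable, and is equal to [B] by maximality.                      *)
Lemma borel_maximal s s' : (b <= s)%VS -> Ad_stable B s ->
  stable adg s s -> derived adg s s' -> (forall x : V, x \in s' -> nilpotent (ad x)) ->
  (s <= b)%VS.
Proof.
move=> bs Bs ss ds nil.
have [k Bk] := borel_solvable; have [gB cB] := algB.
have [[_ conB _ _] maxB] := borelB.
pose T : set M := B `|` exp_set (matspace s).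
have Tu : forall x, T x -> x \in unitmx.
  by move=> x [Bx|]; [exact/(G_unit algG)/borel_sub|exact: exp_set_unit].
pose H := alggen T.
have gH : algebraic_group H := algebraic_group_alggen Tu.
have TG : T `<=` G.
  by move=> x [/borel_sub//|]; exact: (exp_set_sub algG lieG).
have HG : H `<=` G by exact: alggen_min.
have cH : zconnected H.
  apply: zconnected_alggen => // x [Bx|sx].
    exists B; split => //; first by move=> y By; left.
    by have [_ ] := gB.
  have [D [cD Ds D1 Dx]] := exp_set_connected sx.
  by exists D; split => // y /Ds ys; right.
pose Ops (T : 'End(V)) := (exists2 y, B y & T = Ad y) \/ (exists2 x : V, x \in
  s & T = ad x).
have [fl [d [flf flO]]] : exists fl d, flag fl d /\ forall T, Ops T -> flag_stable fl T.
  apply: flag_exists => U W OU OW WU UW.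
  have BU : Ad_stable B U by move=> y u By; apply: OU; left; exists y.
  have BW : Ad_stable B W by move=> y u By; apply: OW; left; exists y.
  have sU : stable adg s U by move=> x u xs; apply: OU; right; exists x.
  have sW : stable adg s W by move=> x u xs; apply: OW; right; exists x.
  have [v [vU vW vB vs]] := joint_eigenvector algG lieG borel_sub gB conB Bk
    Bs ss ds nil BU BW sU sW WU UW.
  exists v; split => // _ [[y By ->]|[x xs ->]]; [exact: vB|exact: vs].
have Hfl y i u : H y -> u \in fl i -> Ad y u \in fl i.
  suff : H `<=` [set y | G y /\ forall u, u \in fl i -> Ad y u \in fl i].
    by move=> HE /HE[_]; apply.
  apply: alggen_min; first exact: algebraic_group_stab.
  move=> x Tx; split; first exact: TG.
  case: Tx => [Bx|[_ [E [D [t [/matspaceP[a as_ ->] XED ->]]]]]].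
    by apply: flO; left; exists x.
  by apply: (ad_exp_stable algG lieG XED); apply: flO; right; exists a.
have solH : solvable_group H.
  by apply: (flag_group_solvable simpleG lieG V0 _ HG flf Hfl); have [] := gH.
have HB : H = B.
  by apply: maxB; [split|move=> x Bx; apply: alggen_sub; left].
apply/subvP => u us; apply/bE; have [E [D XED]] := onepar_exists (vsval u).
apply: (onepar_lie lieB XED) => t; rewrite -HB; apply: alggen_sub; right.
by exists (vsval u), E, D, t; split => //; rewrite mem_matspace.
Qed.

Lemma adjoin_subalgebra v : Ad_stable B (b + <[v]>)%VS ->
  stable adg (b + <[v]>)%VS (b + <[v]>)%VS.
Proof.
move=> Bs _ _ /memv_addP[x xb [_ /vlineP[a ->] ->]] /memv_addP[y yb [_
  /vlineP[c ->] ->]].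
have vs : v \in (b + <[v]>)%VS by rewrite memvE addvSr.
rewrite (ad_adjoin adl adA) memvD//.
  by apply: (subvP (addvSl _ _)); exact: (borel_stable Ad_stable_borel).
by rewrite memvB ?memvZ//; exact: borel_stable.
Qed.

Lemma adjoin_Ad_stable v : (forall y, B y -> exists c, Ad y v - c *: v \in b) ->
  Ad_stable B (b + <[v]>)%VS.
Proof.
move=> vB y _ By /memv_addP[x xb [_ /vlineP[a ->] ->]].
have [c yv] := vB y By; rewrite linearD linearZ /= memvD//.
  by apply: (subvP (addvSl _ _)); exact: Ad_stable_borel.
rewrite memvZ// -[Ad y v](subrK (c *: v)) memv_add// memvZ// memv_line//.
Qed.

Lemma flag_derived_nilpotent fl d s s' : flag fl d ->
  (forall x : V, x \in s -> flag_stable fl (ad x)) -> derived adg s s' ->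
  forall x : V, x \in s' -> flag_lower fl (ad x).
Proof.
move=> flf sfl [_ s'min] x xs' i u ui.
have [Z ZE] : exists Z : {vspace V}, forall z, z \in Z <-> ad z u \in fl i.
  apply: vspace_comprehension => [|a z w zZ wZ].
    by rewrite (ad0 adl) lfunE mem0v.
  by rewrite adl add_lfunE scale_lfunE (memvD (memvZ a zZ) wZ).
apply/ZE; apply: (subvP (s'min Z _)) => // y z ys zs; apply/ZE.
by rewrite adJ'; apply: (flag_stable_comm flf (sfl y ys) (sfl z zs)).
Qed.

(** Lie-Kolchin gives a B-stable flag; let N be its stabilizer in g. If N exceeded [b], an
    eigenvector of B in N modulo [b] could be adjoined to [b]: the derived algebra would lower the
    flag, against [borel_maximal]. *)
Lemma borel_flag : exists fl d, [/\ flag fl d,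
  forall x : V, x \in b -> flag_stable fl (ad x) &
  forall h : V, flag_stable fl (ad h) -> h \in b].
Proof.
have [[_ _ BM BV] _] := algB.
have [fl [d [flf flB]]] : exists fl d, flag fl d /\
    forall T, (exists2 y, B y & T = Ad y) -> flag_stable fl T.
  apply: flag_exists => U W OU OW WU UW.
  have [||v [vU vW vB]] := @borel_eigenvector U W _ _ WU UW.
  - by move=> y u By; apply: OU; exists y.
  - by move=> y u By; apply: OW; exists y.
  by exists v; split => // _ [y By ->]; exact: vB.
have Bfl i : Ad_stable B (fl i) by move=> y u By; apply: flB; exists y.
have bfl x : x \in b -> flag_stable fl (ad x).
  by move=> xb i u; apply: (borel_stable (Bfl i)).
exists fl, d; split => //.
have [N NE] : exists N : {vspace V}, forall h, h \in N <-> flag_stable fl (ad h).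
  apply: vspace_comprehension => [i u _|a h h' hf hf' i u ui].
    by rewrite (ad0 adl) lfunE mem0v.
  by rewrite adl add_lfunE scale_lfunE (memvD (memvZ a (hf i u ui)) (hf' i u ui)).
have BN : Ad_stable B N.
  move=> y h By /NE hf; apply/NE => i u ui.
  have -> : ad (Ad y h) u = Ad y (ad h (Ad (invmx y) u)).
    by rewrite (Ad_bracket algG lieG h _ (borel_sub By)) (AdKV algG lieG u
      (borel_sub By)).
  by apply: (Bfl i y _ By); apply: hf; apply: (Bfl i _ _ (BV _ By)).
suff Nb : (N <= b)%VS by move=> h hf; apply: (subvP Nb); apply/NE.
apply/negPn/negP => Nb.
have bN : (b <= N)%VS by apply/subvP => x /bfl xf; apply/NE.
have [v [vN vb vB]] := borel_eigenvector BN Ad_stable_borel bN Nb.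
have Bs := adjoin_Ad_stable vB; have ss := adjoin_subalgebra Bs.
have [s' ds'] := derived_exists adg (b + <[v]>)%VS.
have sN : (b + <[v]> <= N)%VS by rewrite subv_add bN -memvE.
have nil x : x \in s' -> nilpotent (ad x).
  move=> xs'; apply: (flag_lower_nilpotent flf).
  have sfl z : z \in (b + <[v]>)%VS -> flag_stable fl (ad z) by move=> /(subvP sN)/NE.
  exact: (flag_derived_nilpotent flf sfl ds').
have := borel_maximal (addvSl _ _) Bs ss ds' nil.
by move=> /subvP/(_ v); rewrite memvE addvSr (negPf vb) => /(_ isT).
Qed.

(** [ad x] preserves the flag and [ad (ad y z)] lowers it, so their product is nilpotent. *)
Lemma borel_isotropic x y z : x \in b -> y \in b -> z \in b -> kappa x (ad y z) = 0.
Proof.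
move=> xb yb zb; have [fl [d [flf bfl _]]] := borel_flag.
apply: lftrace_nilpotent; apply: (flag_lower_nilpotent flf).
apply: (flag_lower_comp flf); first exact: bfl.
by rewrite adJ'; apply: (flag_stable_comm flf); exact: bfl.
Qed.

Lemma borel_orthogonal_sub w : (forall u, u \in b -> kappa u w = 0) -> w \in b.
Proof.
have [N NE] := kappa_orthogonal adl (fun u => u \in b).
suff Nb : (N <= b)%VS by move=> /NE; exact: (subvP Nb).
have [[_ _ BM BV] _] := algB.
have BN : Ad_stable B N.
  move=> y u By /NE u0; apply/NE => v vb.
  by rewrite kappaC (kappa_Ad simpleG lieG _ _ (borel_sub By)) kappaC u0//
    Ad_stable_borel//; exact: BV.
apply/negPn/negP => Nb.
have BbN : Ad_stable B (b + N)%VS.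
  move=> y _ By /memv_addP[u ub [w' wN ->]]; rewrite linearD /=.
  by apply: memv_add; [exact: Ad_stable_borel|exact: BN].
have bNb : ~~ (b + N <= b)%VS by apply: contra Nb => /(subv_trans (addvSr _ _)).
have [v [/memv_addP[v1 v1b [v2 v2N vE]] vb vB]] :=
  borel_eigenvector BbN Ad_stable_borel (addvSl _ _) bNb.
(* The eigenvector is replaced by its component orthogonal to [b], which has the same class modulo
   [b]; Cartan's criterion then applies to the enlarged algebra. *)
have v2b : v2 \notin b by apply: contra vb => v2b; rewrite vE memvD.
have v2B y : B y -> exists c, Ad y v2 - c *: v2 \in b.
  move=> By; have [c yv] := vB y By; exists c.
  have -> : Ad y v2 - c *: v2 = (Ad y v - c *: v) - (Ad y v1 - c *: v1).
    by rewrite vE [Ad y (_ + _)]linearD /= scalerDr opprD addrACA [RHS]addrAC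
      subrr add0r.
  by rewrite memvB// memvB ?memvZ// Ad_stable_borel.
have Bs := adjoin_Ad_stable v2B; have ss := adjoin_subalgebra Bs.
have [s' ds'] := derived_exists adg (b + <[v2]>)%VS.
have v20 u : u \in b -> kappa u v2 = 0 by move/NE: v2N; apply.
have bb : stable adg b b by move=> x y; exact: (borel_stable Ad_stable_borel).
have iso := kappa_adjoin_derived adl adA adJ' bb borel_isotropic v20 ds'.
have nil := cartan_criterion adl adJ' ss ds' iso.
have := borel_maximal (addvSl _ _) Bs ss ds' nil.
by move=> /subvP/(_ v2); rewrite memvE addvSr (negPf v2b) => /(_ isT).
Qed.

Lemma borel_kappa_neq0 : exists x y : V, [/\ x \in b, y \in b & kappa x y != 0].
Proof.
apply: contrapT => k0.
have kb x y : x \in b -> y \in b -> kappa x y = 0.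
  by move=> xb yb; apply: contrapT => /eqP xy; apply: k0; exists x, y.
have [fl [d [flf bfl flb]]] := borel_flag.
have nilb x : x \in b -> nilpotent (ad x).
  move=> xb; have [q [_ Dd]] := conjugate_derivation adl (derivation_ad adJ' x).
  apply; have [h hE] := derivation_inner adl adJ' nondeg Dd.
  rewrite hE; apply: kb => //; apply: flb => i u ui; rewrite -hE.
  by apply: papp_stable => // w; exact: bfl.
have Bfull : Ad_stable B fullv by move=> y u _ _; exact: memvf.
have [fb|fb] := boolP (fullv <= b)%VS.
  case/negP: V0; rewrite -subv0; apply/subvP => x _; rewrite memv0; apply/eqP.
  by apply: nondeg => y; apply: kb; apply: (subvP fb); exact: memvf.
have [v [_ vb vB]] := borel_eigenvector Bfull Ad_stable_borel (subvf b) fb.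
have Bs := adjoin_Ad_stable vB; have ss := adjoin_subalgebra Bs.
have bv x : x \in b -> ad x v \in b.
  move=> xb; have : ad x v \in (b + <[v]>)%VS.
    by apply: ss; [exact: (subvP (addvSl _ _))|rewrite memvE addvSr].
  case/memv_addP => y yb [_ /vlineP[c ->] xv].
  have [k xk] := nilb x xb; rewrite lpow_papp in xk.
  have bb : forall w, w \in b -> ad x w \in b.
    by move=> w; exact: (borel_stable Ad_stable_borel).
  have xvc : ad x v - c *: v \in b by rewrite xv addrK.
  have := papp_eigenvalue bb xk vb xvc.
  rewrite /root hornerXn expf_eq0 => /andP[_ /eqP c0].
  by rewrite xv c0 scale0r addr0.
have [s' ds'] := derived_exists adg (b + <[v]>)%VS.
have s'b : (s' <= b)%VS.
  apply: ds'.2 => _ _ /memv_addP[x xb [_ /vlineP[a ->] ->]] /memv_addP[y yb [_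
    /vlineP[c ->] ->]].
  rewrite (ad_adjoin adl adA) memvD ?(borel_stable Ad_stable_borel)//.
  by rewrite memvB ?memvZ ?bv.
have := borel_maximal (addvSl _ _) Bs ss ds' (fun x xs' => nilb x (subvP s'b x xs')).
by move=> /subvP/(_ v); rewrite memvE addvSr (negPf vb) => /(_ isT).
Qed.

Lemma invariant_form_scalar (f : V -> V -> C) :
  (forall a x y z, f (a *: x + y) z = a * f x z + f y z) ->
  (forall a x y z, f z (a *: x + y) = a * f z x + f z y) ->
  (forall x y z, f (ad x y) z = f x (ad y z)) ->
  exists c, forall x y, f x y = c * kappa x y.
Proof.
move=> fl fr finv.
have [T [fT Tad]] := invariant_form_operator adl adA adJ' nondeg fl fr finv.
have [rs rs0] := split_annihilator T.
have [v vf v0] : exists2 v, v \in (fullv : {vspace V}) & v \notin 0%VS.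
  by apply/subvPn; rewrite subv0.
have [||c [w [_ w0 wT]]] := @relative_eigenvector_prod _ _ T fullv 0%VS rs v _ vf v0.
- by move=> u _; exact: memvf.
- by rewrite rs0 lfunE mem0v.
have [U UE] : exists U : {vspace V}, forall u, u \in U <-> T u = c *: u.
  apply: vspace_comprehension => [|a x y xE yE]; first by rewrite linear0 scaler0.
  by rewrite linearP /= xE yE scalerDr !scalerA mulrC.
have Uf : U = fullv.
  apply: (simple_ideal simpleG lieG V0).
    by move=> u x /UE xE; apply/UE; rewrite Tad xE linearZ.
  apply: contra w0 => /eqP U0; rewrite -U0; apply/UE.
  by move: wT; rewrite memv0 subr_eq0 => /eqP.
exists c => x y; rewrite fT; have /UE -> : x \in U by rewrite Uf memvf.
exact: (kappaZl adl).
Qed.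

Lemma killing_borel (x y : subvs_of b0) :
  killing x y = 2%:R^-1 * killing (vsproj g (vsval x)) (vsproj g (vsval y)).
Proof.
pose i : 'Hom(subvs_of b0, V) := (linfun (vsproj g) \o linfun (@vsval _ _ b0))%VF.
pose j : 'Hom(V, subvs_of b0) := (linfun (vsproj b0) \o (linfun (@vsval _ _ g)
  \o projv b))%VF.
have iE (u : subvs_of b0) : i u = vsproj g (vsval u) by rewrite comp_lfunE !lfunE.
have jE v : j v = vsproj b0 (vsval (projv b v)) by rewrite !comp_lfunE !lfunE.
clearbody i j.
have vi (u : subvs_of b0) : vsval (i u) = vsval u.
  by rewrite iE vsprojK// borel_lie_sub// subvsP.
have ib (u : subvs_of b0) : i u \in b by apply/bE; rewrite vi subvsP.
have ji (u : subvs_of b0) : j (i u) = u.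
  by apply: val_inj; rewrite jE projv_id// vi /= vsprojK// subvsP.
have ij v : i (j v) = projv b v.
  by apply: val_inj; rewrite /= vi jE vsprojK//; apply/bE; exact: memv_proj.
have iad (u v : subvs_of b0) : i (ad u v) = ad (i u) (i v).
  by apply: val_inj; rewrite /= vi (vsval_ad bclosed) (vsval_ad gclosed) !vi.
have bb : stable adg b b by move=> u v; exact: (borel_stable Ad_stable_borel).
have [N NE] := kappa_orthogonal adl (fun u => u \in b).
have Nb : (N <= b)%VS by apply/subvP => w /NE; exact: borel_orthogonal_sub.
have bbN u v : u \in b -> v \in b -> ad u v \in N.
  by move=> ub vb; apply/NE => w wb; exact: borel_isotropic.
rewrite -!iE -[killing (i x) (i y)]/(kappa (i x) (i y)).
rewrite -(half_killing adl adA adJ' nondeg (memv_proj b) (@projv_id _ _ b) bb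
  NE Nb bbN (ib x) (ib y)).
have -> : projv b = (i \o j)%VF by apply/lfunP => v; rewrite comp_lfunE ij.
transitivity (lftrace (j \o ((ad (i x) \o ad (i y)) \o i))%VF).
  congr lftrace; apply/lfunP => u.
  have e := etrans (iad x (ad y u)) (congr1 (ad (i x)) (iad y u)).
  by rewrite !comp_lfunE; exact: etrans (esym (ji _)) (congr1 j e).
by rewrite [LHS]mxof_id_comp; congr lftrace; apply/lfunP => u; rewrite !comp_lfunE.
Qed.

End BorelSubalgebra.

Theorem mainTheorem10 (R : realType) (n : nat) (G B : set 'M[R[i]]_n)
    (g b : {vspace 'M[R[i]]_n})
    (simpleG : simple_algebraic_group G) (borelB : borel_subgroup G B)
    (lieG : lie_algebra_of G g) (lieB : lie_algebra_of B b)
    (form : {biscalar (subvs_of g)})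
    (form_sym : forall x y : subvs_of g, form x y = form y x)
    (form_inv : invariant_form (fun x y : subvs_of g => form x y)) :
  BRST_defined (restrict_form (M := b) (fun x y : subvs_of g => form x y)) <->
  (forall x y : subvs_of g, form x y = critical_level x y).
Proof.
have [algG _ _ _] := simpleG; have gclosed := lie_algebra_bracket algG lieG.
have adl := ad_is_linear gclosed.
have [V0|V0] := eqVneq (fullv : {vspace subvs_of g}) 0%VS.
  have z0 (x : subvs_of g) : x = 0.
    by apply/eqP; rewrite -memv0 -V0 memvf.
  have f0 (x y : subvs_of g) : form x y = 0 by rewrite (z0 x) linear0l.
  have k0 (x y : subvs_of g) : killing x y = 0.
    by rewrite (z0 x); exact: (kappa0l adl).
  have b0 (x : subvs_of b) : x = 0.
    apply: val_inj; have xg : vsval x \in g.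
      by apply: (borel_lie_sub borelB lieG lieB); exact: subvsP.
    by rewrite /= -(vsprojK xg) (z0 (vsproj g _)) !linear0.
  split=> _ x y; first by rewrite f0 /critical_level k0 mulr0 oppr0.
  rewrite /restrict_form f0 (b0 x).
  have algB : algebraic_group B by case: borelB => -[].
  have bl := ad_is_linear (lie_algebra_bracket algB lieB).
  by rewrite [killing 0 y](kappa0l bl) oppr0.
have [b1 b1E] := borel_subspace_exists g b.
have kb := killing_borel simpleG borelB lieG lieB V0 b1E.
split=> [brst|crit x y]; last by rewrite /restrict_form crit /critical_level kb.
have [c fc] : exists c, forall x y : subvs_of g, form x y = c * killing x y.
  apply: (invariant_form_scalar simpleG lieG V0) => [a x y z|a x y z|x y z].
  - exact: linearPl.
  - exact: linearPr.
  - have := form_inv x y z; rewrite -(adE x y) -(adE y z); exact.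
have [x [y [/b1E xb /b1E yb k0]]] := borel_kappa_neq0 simpleG borelB lieG lieB V0 b1E.
suff cE : c = - 2%:R^-1 by move=> u v; rewrite fc cE /critical_level mulNr.
apply: (mulIf k0); have := brst (vsproj b (vsval x)) (vsproj b (vsval y)).
by rewrite /restrict_form kb !vsprojK// !vsvalK fc mulNr.
Qed.
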